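(* Let $E$ be a locally convex Hausdorff space over $\mathbb{C}$, $G\subset E'$ a subspace, $\Omega\subset\mathbb{C}^{d}$ open and connected, $A\subset\Omega$ thin and closed (in $\Omega$) and $f\colon\Omega\setminus A\to E$ such that $e'\circ f$ is holomorphic on $\Omega\setminus A$ for each $e'\in G$. If for every $z\in\Omega$ there is a polydisc $\mathbb{D}_R(z)\subset\Omega$ such that $f$ is bounded on $\mathbb{D}_R(z)\setminus A$ and (i) $G$ is separating and $E$ is $B_r$-complete, or if (ii) $G$ is dense in $E_b'$ and $E$ is locally complete, then $f$ extends holomorphically to $\Omega$, i.e. there is a holomorphic function $F\colon\Omega\to E$ with $F=f$ on $\Omega\setminus A$.
   Context: $E$ is a non-trivial locally convex Hausdorff space with completion $\widehat{E}$ and dual $E'$; $E_b'$ is $E'$ with the topology of uniform convergence on bounded subsets of $E$. For a bounded, absolutely convex set (disk) $D\subset E$ put $E_D:=\bigcup_{n\in\mathbb{N}}nD$ normed by the gauge of $D$; $E$ is locally complete if $E_D$ is a Banach space for every closed disk $D$. $E$ is $B_r$-complete (an infra-Pták space) if every $\sigma(E',E)$-dense subspace $Q\subset E'$, such that $Q\cap U^\circ$ is $\sigma(E',E)$-closed for every zero neighbourhood $U$ of $E$ ($U^\circ$ the polar), equals $E'$. $G\subset E'$ is separating if for all $x\ne y$ in $E$ there is $e'\in G$ with $e'(x)\ne e'(y)$. A function $f\colon\Omega\to E$ on an open set $\Omega\subset\mathbb{C}^d$ is holomorphic if for every $z\in\Omega$ there is a $\mathbb{C}$-linear map $df(z)\colon\mathbb{C}^d\to\widehat{E}$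 with $\lim_{w\to z,\,w\in\Omega,\,w\ne z}\frac{f(w)-f(z)-df(z)[w-z]}{|w-z|}=0$ in $\widehat{E}$, and $df(\cdot)[v]\colon\Omega\to\widehat{E}$ is continuous for every $v\in\mathbb{C}^d$. $\mathbb{D}_R(z)=\prod_{k=1}^d\{\zeta\in\mathbb{C}:|\zeta-z_k|<R_k\}$, $R\in(0,\infty]^d$. For connected open $\Omega\subset\mathbb{C}^d$, a set $A\subset\Omega$ is thin if for every $z\in A$ there are a polydisc $\mathbb{D}_R(z)\subset\Omega$ and a holomorphic function $g\colon\mathbb{D}_R(z)\to\mathbb{C}$, $g\ne0$ (not identically zero), such that $g=0$ on $A\cap\mathbb{D}_R(z)$. *)

(* Defs.v *)
From HB Require Import structures.
From mathcomp Require Import all_boot all_order all_algebra.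
From mathcomp Require Import complex.
From mathcomp Require Import all_classical all_reals all_analysis.

Set Implicit Arguments.
Unset Strict Implicit.
Unset Printing Implicit Defensive.

Import Order.TTheory GRing.Theory Num.Theory.
Import numFieldNormedType.Exports.

Local Open Scope classical_set_scope.
Local Open Scope complex_scope.
Local Open Scope ring_scope.

(* The complex field [R[i]] gets the topology of its modulus, so that row
   vectors ['rV[R[i]]_d] carry the product topology.  As a target space the
   scalars are written [R[i]^o], which the library equips with the (same)
   structure of locally convex space. *)
HB.instance Definition _ (R : realType) :=
  PseudoPointedMetric.copy R[i] (R[i] : numFieldType)^o.

Section LocallyConvexSpaces.
Context {R : realType}.
Implicit Types E F : tvsType R[i].

Definition tvs_bounded {E} (B : set E) : Prop :=
  forall U : set E, nbhs 0 U ->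
    exists2 r : R, 0 < r &
      forall t : R[i], r%:C <= `|t| -> B `<=` [set t *: x | x in U].

(* A [tvsType] carries a uniform structure that induces its topology but that
   is not required to be the translation invariant one; Cauchy filters are
   therefore defined through the neighbourhoods of the origin. *)
Definition tvs_cauchy {E} (H : set_system E) : Prop :=
  forall U : set E, nbhs 0 U ->
    exists2 B, H B & forall x y, B x -> B y -> U (x - y).

Definition tvs_complete E : Prop :=
  forall H : set_system E, ProperFilter H -> tvs_cauchy H ->
    exists x : E, H --> x.

(* [F], together with [j], is a completion of [E]; it is unique up to a unique
   isomorphism.  The third clause says that [E] has the topology induced
   by [j]; for Hausdorff [E] it makes [j] injective. *)
Definition is_completion E F (j : {linear E -> F}) : Prop :=
  [/\ hausdorff_space F,
      tvs_complete F,
      forall (x : E) (U : set E),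
        nbhs x U <-> exists2 V, nbhs (j x) V & j @^-1` V `<=` U
    & dense (range j)].

Definition absolutely_convex {E} (D : set E) : Prop :=
  forall (a b : R[i]) (x y : E), `|a| + `|b| <= 1 -> D x -> D y ->
    D (a *: x + b *: y).

Definition disk {E} (D : set E) : Prop := tvs_bounded D /\ absolutely_convex D.

Definition disk_span {E} (D : set E) : set E :=
  \bigcup_n [set n%:R *: x | x in D].

Definition gauge {E} (D : set E) (x : E) : R :=
  inf [set t : R | 0 < t /\ [set t%:C *: y | y in D] x].

(* Since the disk [D] is bounded and [E] is meant to be Hausdorff, the gauge is
   a norm on [disk_span D]. *)
Definition banach_disk {E} (D : set E) : Prop :=
  forall u : nat -> E, (forall n, disk_span D (u n)) ->
    (forall e : R, 0 < e -> exists N, forall m n, (N <= m)%N -> (N <= n)%N ->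
      gauge D (u m - u n) < e) ->
    exists2 x, disk_span D x & gauge D (u n - x) @[n --> \oo] --> (0 : R).

Definition locally_complete E : Prop :=
  forall D : set E, disk D -> closed D -> banach_disk D.

(* The dual of [E] is a set of functions, so that its topologies are those
   induced by the library's topologies on function spaces. *)
Definition dual E : set (E -> R[i]^o) := [set u | linear u /\ continuous u].
Arguments dual : clear implicits.

Definition dual_subspace {E} (G : set (E -> R[i]^o)) : Prop :=
  [/\ G `<=` dual E, G (fun=> 0) &
      forall (a : R[i]) u v, G u -> G v -> G (fun x => a *: u x + v x)].

Definition separating {E} (G : set (E -> R[i]^o)) : Prop :=
  forall x y : E, x <> y -> exists2 u, G u & u x <> u y.

(* density and closedness in the dual for the weak-star topology *)
Definition wstar_dense {E} (Q : set (E -> R[i]^o)) : Prop :=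
  dual E `<=` closure (Q : set {ptws E -> R[i]^o}).

Definition wstar_closed {E} (Q : set (E -> R[i]^o)) : Prop :=
  dual E `&` closure (Q : set {ptws E -> R[i]^o}) `<=` Q.

(* density in the dual for uniform convergence on bounded sets *)
Definition strongly_dense {E} (G : set (E -> R[i]^o)) : Prop :=
  dual E `<=` closure (G : set {family @tvs_bounded E, E -> R[i]^o}).

Definition polar {E} (U : set E) : set (E -> R[i]^o) :=
  [set u | dual E u /\ forall x, U x -> `|u x| <= 1].

Definition Br_complete E : Prop :=
  forall Q : set (E -> R[i]^o), dual_subspace Q -> wstar_dense Q ->
    (forall U : set E, nbhs 0 U -> wstar_closed (Q `&` polar U)) ->
    Q = dual E.

End LocallyConvexSpaces.

Arguments dual {R} E _.

Section Scalars.
Context {R : realType}.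

Lemma normc_le_ReIm (x : R[i]) :
  `|x| <= (`|complex.Re x| + `|complex.Im x|)%:C.
Proof.
rewrite normc_def lecR -[leRHS]ger0_norm ?addr_ge0// -sqrtr_sqr ler_wsqrtr//.
rewrite sqrrD !real_normK ?num_real// lerD2r lerDl mulrn_wge0// mulr_ge0//.
Qed.

Lemma tvs_complete_scalars : tvs_complete (R[i]^o : tvsType R[i]).
Proof.
move=> H PH cH.
have ballH (e : R) : 0 < e ->
    exists2 B, H B & forall x y, B x -> B y -> `|x - y| < e%:C.
  move=> e0; have [|B HB xyB] := cH (ball (0 : R[i]^o) e%:C).
    by apply: nbhsx_ballx; rewrite ltcR.
  exists B => // x y Bx By; have := xyB _ _ Bx By.
  by rewrite -ball_normE/= sub0r normrN.
have part (p : R[i] -> R) : (forall x y, `|p x - p y|%:C <= `|x - y|) ->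
    exists a : R, p @ H --> a.
  move=> hp; apply/cvg_ex/cauchy_cvgP/cauchyP => e e0.
  have [B HB xyB] := ballH _ e0.
  have [x Bx] := filter_ex HB.
  exists (p x); rewrite /nbhs/=; apply: (filterS _ HB) => y By.
  rewrite /preimage/= -ball_normE/= -ltcR.
  exact: le_lt_trans (hp _ _) (xyB _ _ Bx By).
have [x y|a Ha] := part (@complex.Re R).
  by rewrite -raddfB; exact: normc_ge_Re.
have [x y|b Hb] := part (@complex.Im R).
  rewrite -raddfB normc_def lecR -sqrtr_sqr ler_wsqrtr// lerDr sqr_ge0//.
exists (a +i* b); apply/(@cvgrPdist_lt _ R[i]^o _ _ _ id) => e e0.
have [e' e'0 ee'] : exists2 e' : R, 0 < e' & e = e'%:C.
  case: e e0 => u v; rewrite ltcE/= => /andP[/eqP v0 u0].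
  by exists u; rewrite // v0.
have e20 : 0 < e' / 2 by rewrite divr_gt0.
move/cvgrPdist_lt : Ha => /(_ _ e20) Ha.
move/cvgrPdist_lt : Hb => /(_ _ e20) Hb.
near=> t; apply: (le_lt_trans (normc_le_ReIm _)); rewrite ee' ltcR.
rewrite !raddfB/= (splitr e') ltrD//; near: t; [exact: Ha|exact: Hb].
Unshelve. all: by end_near. Qed.

Lemma is_completion_scalars :
  is_completion (idfun : {linear (R[i]^o : tvsType R[i]) -> R[i]^o}).
Proof.
split.
- exact: (@norm_hausdorff _ R[i]^o).
- exact: tvs_complete_scalars.
- move=> x U; split; first by exists U.
  by move=> [V xV VU]; exact: filterS xV.
- by move=> O [x Ox] _; exists x; split => //; exists x.
Qed.
End Scalars.

Section Holomorphy.
Context {R : realType} {d : nat}.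
Implicit Types (z : 'rV[R[i]]_d) (S : set 'rV[R[i]]_d).

Definition enorm z : R :=
  Num.sqrt (\sum_(k < d) complex.Re `|z 0 k| ^+ 2).

(* [f] is only considered on the open set [S]; [j] is the embedding of [E] into
   a completion [F], where the derivative takes its values. *)
Definition holomorphic (E F : tvsType R[i]) (j : {linear E -> F}) S
    (f : 'rV[R[i]]_d -> E) : Prop :=
  exists df : 'rV[R[i]]_d -> {linear 'rV[R[i]]_d -> F},
    (forall z, S z ->
      (enorm (w - z))^-1%:C *: (j (f w) - j (f z) - df z (w - z))
        @[w --> within S z^'] --> (0 : F)) /\
    (forall v, {within S, continuous (fun z => df z v)}).

(* The scalars are their own completion, see [is_completion_scalars]. *)
Definition holomorphic_fun S (g : 'rV[R[i]]_d -> R[i]^o) : Prop :=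
  holomorphic idfun S g.

Definition polyradius (r : 'I_d -> \bar R) : Prop := forall k, (0 < r k)%E.

Definition polydisc (r : 'I_d -> \bar R) z : set 'rV[R[i]]_d :=
  [set w | forall k, ((complex.Re `|w 0 k - z 0 k|)%:E < r k)%E].

Definition thin (Omega A : set 'rV[R[i]]_d) : Prop :=
  A `<=` Omega /\
  forall z, A z -> exists r : 'I_d -> \bar R,
    [/\ polyradius r, polydisc r z `<=` Omega &
        exists g : 'rV[R[i]]_d -> R[i]^o,
          [/\ holomorphic_fun (polydisc r z) g,
              exists2 w, polydisc r z w & g w != 0 &
              forall w, (A `&` polydisc r z) w -> g w = 0]].

End Holomorphy.

(* Main.v *)
Require Import Defs.
From HB Require Import structures.
From mathcomp Require Import all_boot all_order all_algebra.
From mathcomp Require Import complex.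
From mathcomp Require Import all_classical all_reals all_analysis.
From mathcomp Require Import ring lra zify.

Set Implicit Arguments.
Unset Strict Implicit.
Unset Printing Implicit Defensive.

Import Order.TTheory GRing.Theory Num.Theory.
Import numFieldNormedType.Exports.

Local Open Scope classical_set_scope.
Local Open Scope complex_scope.
Local Open Scope ring_scope.

(** The proof replaces holomorphy by inequalities for finite differences. A
    function [F] from an open set of row vectors to [E] is called regular
    ([reg]) if
    - [F (z + v) - F z] has size at most [C * nabs v],
    - [F (z + v + u) - F (z + v) - (F (z + u) - F z)] has size at most
      [C * (nabs u * nabs v)],
    - [F (z + a *: v) - F z - a *: (F (z + v) - F z)] has size at most
      [C * ((nabs a + nabs a ^+ 2) * nabs v ^+ 2)],
    where sizes are measured by the functionals of a set [T]. Bounded scalar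
    holomorphic functions are regular on smaller balls ([bholo_test]), by
    repeated use of the Schwarz lemma on complex lines. If the seminorm given
    by [T] is complete and finer than the topology of [E] ([norming]), regular
    functions are holomorphic ([reg_holomorphic]) and extend from dense
    subsets ([reg_extend]). Regularity only involves the scalar functions
    [u \o f] for [u] in [T], one constant, and finitely many values at a time.

    Removable singularities. Let [z0] be a point of [A], and [g] the function
    that vanishes on [A] near [z0]. On a suitable complex line through [z0] the
    zeros of [g] are isolated ([isolated_zeros]); so [g] has no zero near a
    small closed curve around [z0] in this line ([thin_good_direction]). Near
    this curve the scalar functions [u \o f] are holomorphic and bounded, hence
    satisfy the inequalities. Along the parallel lines the maximum principle
    holds across the zeros of [g] ([max_principle_thin]), so the inequalities
    hold near [z0] off these zeros ([good_direction_reg]). The zeros of [g]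
    have a dense complement ([good_direction_dense]), and [reg_extend] gives
    the extension near [z0]. Local extensions agree where they meet, because
    they agree with [f] off [A].

    Choice of [T]. Take the polar of a bounded set [B] that contains the values
    of [f] near [z0]. Its seminorm is the gauge of the bipolar of [B]
    ([tle_gset]), which by the Hahn-Banach theorem induces a topology finer
    than that of [E] ([polar_nbhs]).
    - If [E] is locally complete, this gauge is complete
      ([norming_locally_complete]). If [G] is strongly dense, [u \o f] is a
      uniform limit of holomorphic functions near each point.
    - If [E] is [B_r]-complete, the functionals [u] for which [u \o f] is
      holomorphic form a subspace that contains the separating [G] and meets
      polars of neighbourhoods in closed sets, since regularity is preserved by
      pointwise limits; so they are all of the dual
      ([Br_complete_holomorphic]). The gauge is complete because the pointwise
      limit on the dual of a Cauchy sequence is a linear functional whose kernel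
      again meets these polars in closed sets, which makes it an evaluation
      ([norming_Br_complete]).

    The function theory of one variable starts from Goursat's argument, for
    trapezoidal sums over squares instead of integrals ([goursat]). It suffices
    for the maximum principle ([max_principle]): if [nabs (f 0)] exceeded the
    maximum [m] of the modulus on the boundary, a high power [y] of [f / f 0]
    would be small there, and the sums for the differentiable function
    [(1 - y) ^+ 3 / x] would differ little from those for [x^-1], which stay
    away from 0 ([diamond_inv]). The Schwarz lemma and the isolation of zeros
    follow from the maximum principle. *)

(** * Real-valued norms and complex differentiability *)

(** The norms of spaces over [R[i]] take values in [R[i]]; estimates are carried
    out with their real parts, where the order is total. *)
Definition nabs {R : realType} {V : normedZmodType R[i]} (x : V) : R :=
  complex.Re `|x|.

Section RealNorm.
Context {R : realType}.

Section Zmod.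
Context {V : normedZmodType R[i]}.
Implicit Types x y : V.

Lemma normE x : `|x| = (nabs x)%:C.
Proof. by rewrite /nabs RRe_real// ger0_real. Qed.

Lemma nabs_ge0 x : 0 <= nabs x.
Proof. by rewrite -lecR -normE normr_ge0. Qed.

Lemma nabs0 : nabs (0 : V) = 0.
Proof. by rewrite /nabs normr0. Qed.

Lemma nabs_eq0 x : (nabs x == 0) = (x == 0).
Proof. by rewrite -(inj_eq (@complexI R)) -normE normr_eq0. Qed.

Lemma nabs_gt0 x : (0 < nabs x) = (x != 0).
Proof. by rewrite lt0r nabs_eq0 nabs_ge0 andbT. Qed.

Lemma nabsN x : nabs (- x) = nabs x.
Proof. by rewrite /nabs normrN. Qed.

Lemma nabsB x y : nabs (x - y) = nabs (y - x).
Proof. by rewrite /nabs distrC. Qed.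

Lemma nabsD x y : nabs (x + y) <= nabs x + nabs y.
Proof. by rewrite -lecR rmorphD/= -!normE ler_normD. Qed.

Lemma nabsD_le x y a b : nabs x <= a -> nabs y <= b -> nabs (x + y) <= a + b.
Proof. by move=> xa yb; apply: le_trans (nabsD _ _) (lerD xa yb). Qed.

Lemma nabsB_le x y a b : nabs x <= a -> nabs y <= b -> nabs (x - y) <= a + b.
Proof. by move=> xa yb; apply: nabsD_le; rewrite ?nabsN. Qed.

Lemma nabs_sub_le x y z : nabs (x - z) <= nabs (x - y) + nabs (y - z).
Proof.
by rewrite (_ : x - z = (x - y) + (y - z)) ?nabsD// addrA subrK.
Qed.

End Zmod.

Implicit Types x y : R[i].

Lemma nabs1 : nabs (1 : R[i]) = 1.
Proof. by rewrite /nabs normr1. Qed.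

Lemma nabsM x y : nabs (x * y) = nabs x * nabs y.
Proof. by apply: (@complexI R); rewrite rmorphM/= -!normE normrM. Qed.

Lemma nabsX x n : nabs (x ^+ n) = nabs x ^+ n.
Proof. by apply: (@complexI R); rewrite rmorphXn/= -!normE normrX. Qed.

Lemma nabsV x : nabs x^-1 = (nabs x)^-1.
Proof. by apply: (@complexI R); rewrite fmorphV/= -!normE normfV. Qed.

Lemma nabs_real (r : R) : nabs (r%:C) = `|r|.
Proof. by rewrite /nabs normc_def/= expr0n/= addr0 sqrtr_sqr. Qed.

Lemma nabs_pos (r : R) : 0 <= r -> nabs (r%:C) = r.
Proof. by move=> r0; rewrite nabs_real ger0_norm. Qed.

Lemma nabsi : nabs ('i : R[i]) = 1.
Proof. by rewrite /nabs normc_def/= expr0n/= expr1n add0r sqrtr1. Qed.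

Lemma nabsZ (V : normedModType R[i]) x (v : V) : nabs (x *: v) = nabs x * nabs v.
Proof. by apply: (@complexI R); rewrite rmorphM/= -!normE normrZ. Qed.

Lemma Re_le_nabs x : `|complex.Re x| <= nabs x.
Proof. by rewrite -lecR -normE normc_ge_Re. Qed.

Lemma Im_le_nabs x : `|complex.Im x| <= nabs x.
Proof.
by rewrite -lecR -normE normc_def lecR -sqrtr_sqr ler_wsqrtr// lerDr sqr_ge0.
Qed.

Lemma nabs_le_ReIm x : nabs x <= `|complex.Re x| + `|complex.Im x|.
Proof. by rewrite -lecR -normE normc_le_ReIm. Qed.

Lemma gt0_realC (e : R[i]) : 0 < e -> exists2 r : R, 0 < r & e = r%:C.
Proof.
case: e => u v; rewrite ltcE/= => /andP[/eqP v0 u0].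
by exists u; rewrite // v0.
Qed.

Lemma nbhs_nabs (V : pseudoMetricNormedZmodType R[i]) (x : V) (U : set V) :
  nbhs x U <-> exists2 e : R, 0 < e & forall y : V, nabs (y - x) < e -> U y.
Proof.
split=> [/nbhs_ballP[e /= /gt0_realC[r r0 ->]] rU|[e e0 eU]].
  exists r => // y yx; apply: rU.
  by rewrite -ball_normE/= normE ltcR nabsB.
apply/nbhs_ballP; exists e%:C; rewrite /= ?ltcR// => y.
by rewrite -ball_normE/= normE ltcR nabsB; exact: eU.
Qed.

Lemma pow2_small (K e : R) : 0 <= K -> 0 < e -> exists n, K / 2 ^+ n < e.
Proof.
move=> K0 e0; exists (Num.bound (K / e)).
rewrite ltr_pdivrMr ?exprn_gt0// mulrC -ltr_pdivrMr//.
have /lt_trans -> // := archi_boundP (divr_ge0 K0 (ltW e0)).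
by rewrite -natrX ltr_nat ltn_expl.
Qed.

Lemma complex_complete (x : nat -> R[i]) :
  (forall e : R, 0 < e -> exists N, forall m n, (N <= m)%N -> (N <= n)%N ->
    nabs (x m - x n) <= e) ->
  exists l, forall e : R, 0 < e -> exists N, forall n, (N <= n)%N ->
    nabs (x n - l) <= e.
Proof.
move=> cx.
have [|l Hl] := @tvs_complete_scalars R (x @ \oo) _.
  move=> U /nbhs_nabs[e e0 eU].
  have [N HN] := cx (e / 2) (divr_gt0 e0 (ltr0Sn _ _)).
  exists (x @` [set n | (N <= n)%N]).
    by exists N => // n /= Nn; exists n.
  move=> _ _ [m Nm <-] [n Nn <-]; apply: eU; rewrite subr0.
  by apply: le_lt_trans (HN _ _ Nm Nn) _; rewrite ltr_pdivrMr// ltr_pMr// ltr1n.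
exists l => e e0.
have /Hl [N _ HN] : nbhs (l : R[i]^o) [set y | nabs (y - l) <= e].
  by apply/nbhs_nabs; exists e => // y /ltW.
by exists N => n /HN.
Qed.

Lemma complex_complete_geo (x : nat -> R[i]) (K : R) :
  (forall n, nabs (x n.+1 - x n) <= K / 2 ^+ n.+1) ->
  exists l, forall n, nabs (x n - l) <= K / 2 ^+ n.
Proof.
move=> xK.
have pow n : 0 < (2 : R) ^+ n by rewrite exprn_gt0.
have K0 : 0 <= K.
  by have := le_trans (nabs_ge0 _) (xK 0); rewrite pmulr_lge0// invr_gt0.
have step n k : nabs (x (n + k)%N - x n) <= K / 2 ^+ n * (1 - 2^-1 ^+ k).
  elim: k => [|k IH]; first by rewrite addn0 subrr nabs0 expr0 subrr mulr0.
  apply: le_trans (nabs_sub_le _ (x (n + k)%N) _) _.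
  apply: (@le_trans _ _ (K / 2 ^+ (n + k).+1 + K / 2 ^+ n * (1 - 2^-1 ^+ k))).
    by rewrite lerD// addnS.
  rewrite -addnS exprD invfM exprVn -mulrA !mulrA -mulrDr.
  rewrite le_eqVlt; apply/orP; left; apply/eqP; congr (_ * _).
  by rewrite -!exprVn exprS; field.
have step' n k : nabs (x (n + k)%N - x n) <= K / 2 ^+ n.
  apply: le_trans (step _ _) _.
  by rewrite ler_piMr ?divr_ge0 ?(ltW (pow _))// gerBl exprn_ge0// invr_ge0.
have [|l Hl] := @complex_complete x.
  move=> e e0; have [N /ltW HN] := pow2_small K0 (divr_gt0 e0 (ltr0Sn _ 1)).
  exists N => m n Nm Nn; apply: le_trans (nabs_sub_le _ (x N) _) _.
  rewrite (splitr e) lerD//; first by rewrite -(subnKC Nm) (le_trans (step' _ _)).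
  by rewrite nabsB -(subnKC Nn) (le_trans (step' _ _)).
exists l => n; apply/ler_addgt0Pr => e e0.
have [N HN] := Hl _ e0.
apply: le_trans (nabs_sub_le _ (x (n + N)%N) _) _.
rewrite lerD//; first by rewrite nabsB step'.
by apply: HN; rewrite leq_addl.
Qed.

End RealNorm.

(** The library's derivative in the direction 1 of the complex line. The
    codomain is [R[i]] and not [R[i]^o], so that products and inverses of such
    functions are products and inverses of complex numbers. *)
Definition cdiff {R : realType} (f : R[i] -> R[i]) (p : R[i]) : Prop :=
  @derivable _ R[i]^o R[i]^o f p 1.

Section Cdiff.
Context {R : realType}.
Implicit Types (f g : R[i] -> R[i]) (p : R[i]).

Lemma cdiffP f p : cdiff f p <-> exists a, forall e : R, 0 < e ->
  exists2 t : R, 0 < t & forall x, nabs (x - p) < t ->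
    nabs (f x - f p - a * (x - p)) <= e * nabs (x - p).
Proof.
split.
- move=> /cvg_ex[a /= Ha]; exists a => e e0.
  have := Ha _ (nbhsx_ballx _ e%:C _); rewrite ltcR => /(_ e0).
  move=> /nbhs_nabs[t t0 tH]; exists t => // x xp.
  have [->|xp0] := eqVneq x p; first by rewrite !subrr mulr0 subr0 nabs0 mulr0.
  have xpp : (x - p) * 1 + p = x by rewrite mulr1 subrK.
  have H : ball a e%:C ((x - p)^-1 * (f ((x - p) * 1 + p) - f p)).
    by apply: (tH (x - p)); rewrite ?subr0// subr_eq0.
  move: H; rewrite xpp -ball_normE/= normE ltcR => H.
  have xp1 : x - p != 0 by rewrite subr_eq0.
  rewrite (_ : f x - f p - a * (x - p) =
     - ((a - (x - p)^-1 * (f x - f p)) * (x - p))); last by field.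
  by rewrite nabsN nabsM ler_wpM2r ?nabs_ge0 ?ltW.
- move=> [a Ha]; apply/cvg_ex; exists a => /= U /nbhs_nabs[e e0 eU].
  have [t t0 tH] := Ha (e / 2) (divr_gt0 e0 (ltr0Sn _ _)).
  apply/nbhs_nabs; exists t => // h; rewrite subr0 => ht h0; apply: eU.
  have := tH (p + h); rewrite addrC addKr => /(_ ht) H.
  change (nabs (h^-1 * (f (h * 1 + p) - f p) - a) < e).
  rewrite mulr1 (_ : _ - a = h^-1 * (f (p + h) - f p - a * h)); last first.
    by rewrite [p + h]addrC; field.
  rewrite nabsM nabsV mulrC ltr_pdivrMr ?nabs_gt0//.
  apply: le_lt_trans H _; rewrite ltr_pM2r ?nabs_gt0//.
  by rewrite ltr_pdivrMr// ltr_pMr// ltr1n.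
Qed.

End Cdiff.

Section CdiffTheory.
Context {R : realType}.
Implicit Types (f g : R[i] -> R[i]) (p : R[i]).

Lemma cdiff_cst (a : R[i]) p : cdiff (fun=> a) p.
Proof. exact: (@derivable_cst _ R[i]^o R[i]^o a p 1). Qed.

Lemma cdiff_id p : cdiff id p.
Proof. exact: (@derivable_id _ R[i]^o p 1). Qed.

Lemma cdiffD f g p : cdiff f p -> cdiff g p -> cdiff (fun x => f x + g x) p.
Proof. exact: derivableD. Qed.

Lemma cdiffB f g p : cdiff f p -> cdiff g p -> cdiff (fun x => f x - g x) p.
Proof. exact: derivableB. Qed.

Lemma cdiffM f g p : cdiff f p -> cdiff g p -> cdiff (fun x => f x * g x) p.
Proof. exact: derivableM. Qed.

Lemma cdiffX f n p : cdiff f p -> cdiff (fun x => f x ^+ n) p.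
Proof.
move=> df; elim: n => [|n IH]; first exact: cdiff_cst.
under eq_fun do rewrite exprS.
exact: cdiffM.
Qed.

Lemma cdiffV f p : cdiff f p -> f p != 0 -> cdiff (fun x => (f x)^-1) p.
Proof. by move=> df fp; exact: derivableV. Qed.

Lemma cdiff_cont f p : cdiff f p -> forall e : R, 0 < e ->
  exists2 t : R, 0 < t & forall x, nabs (x - p) < t -> nabs (f x - f p) < e.
Proof.
move=> /cdiffP[a Ha] e e0; have [t t0 tH] := Ha 1 ltr01.
have a1 : 0 < nabs a + 1 by rewrite ltr_wpDl ?nabs_ge0.
exists (Num.min t (e / (nabs a + 1))); first by rewrite lt_min t0 divr_gt0.
move=> x; rewrite lt_min => /andP[/tH xt].
rewrite ltr_pdivlMr//; apply: le_lt_trans.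
rewrite (_ : f x - f p = (f x - f p - a * (x - p)) + a * (x - p)); last by ring.
apply: le_trans (nabsD_le xt (lexx _)) _; rewrite nabsM.
by rewrite le_eqVlt; apply/orP; left; apply/eqP; ring.
Qed.

Lemma cdiff_locbd f p : cdiff f p -> exists M : R, exists2 t : R, 0 < t &
  forall x, nabs (x - p) < t -> nabs (f x) <= M.
Proof.
move=> /cdiff_cont/(_ 1 ltr01)[t t0 tH].
exists (1 + nabs (f p)), t => // x /tH/ltW xt.
by rewrite -[f x](subrK (f p)) nabsD_le.
Qed.

Lemma cdiff_lip f p : cdiff f p -> exists2 L : R, 0 <= L & exists2 t : R, 0 < t &
  forall x, nabs (x - p) < t -> nabs (f x - f p) <= L * nabs (x - p).
Proof.
move=> /cdiffP[a Ha]; have [t t0 tH] := Ha 1 ltr01.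
exists (1 + nabs a); first by rewrite addr_ge0 ?nabs_ge0.
exists t => // x /tH xt; rewrite mulrDl -nabsM.
by rewrite -[f x - f p](subrK (a * (x - p))) nabsD_le.
Qed.

(** The derivative is 0: the bound makes the difference quotients at [p] linear
    in the distance to [p]. This is how functions built from quotients are seen
    to be differentiable at their singular points. *)
Lemma cdiff_quad f p (K t : R) : 0 < t ->
  (forall x, nabs (x - p) < t -> nabs (f x) <= K * nabs (x - p) ^+ 2) ->
  cdiff f p.
Proof.
move=> t0 fK; apply/cdiffP; exists 0 => e e0.
have fp : f p = 0.
  apply/eqP; rewrite -nabs_eq0 eq_le nabs_ge0 andbT.
  by have := fK p; rewrite subrr nabs0 expr0n/= mulr0; exact.
have K1 : 0 < `|K| + 1 by rewrite ltr_wpDl.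
exists (Num.min t (e / (`|K| + 1))); first by rewrite lt_min t0 divr_gt0.
move=> x; rewrite lt_min => /andP[/fK xt]; rewrite ltr_pdivlMr// => xe.
rewrite fp mul0r !subr0; apply: le_trans xt _.
rewrite expr2 mulrA ler_wpM2r ?nabs_ge0//; apply: le_trans (ltW xe).
rewrite mulrC ler_wpM2l ?nabs_ge0//; have := ler_norm K; lra.
Qed.

Lemma cdiff_comp_affine f a b p : cdiff f (a + b * p) ->
  cdiff (fun x => f (a + b * x)) p.
Proof.
move=> /cdiffP[c Hc]; apply/cdiffP; exists (c * b) => e e0.
have b1 : 0 < nabs b + 1 by rewrite ltr_wpDl ?nabs_ge0.
have [t t0 tH] := Hc (e / (nabs b + 1)) (divr_gt0 e0 b1).
exists (t / (nabs b + 1)); first by rewrite divr_gt0.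
move=> x xp.
have E : a + b * x - (a + b * p) = b * (x - p) by ring.
have := tH (a + b * x); rewrite E nabsM -mulrA.
have bx : nabs b * nabs (x - p) <= (nabs b + 1) * nabs (x - p).
  by rewrite ler_wpM2r ?nabs_ge0 ?lerDl.
have /[swap]/[apply] : nabs b * nabs (x - p) < t.
  by apply: le_lt_trans bx _; rewrite mulrC -ltr_pdivlMr.
rewrite [c * (b * _)]mulrA => /le_trans; apply; rewrite ler_wpM2l ?(ltW e0)//.
by rewrite mulrC ler_pdivrMr// [leRHS]mulrC.
Qed.

End CdiffTheory.

(** * Trapezoidal sums over squares *)

Section Edge.
Context {R : realType}.
Implicit Types (f g : R[i] -> R[i]) (a b c w p : R[i]).

(** Twice the trapezoidal sum with [2 ^ N] steps for the integral of [f] along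
    the segment from [a] to [b]. *)
Fixpoint edge f N a b : R[i] :=
  if N is N'.+1 then edge f N' a ((a + b) / 2) + edge f N' ((a + b) / 2) b
  else (f a + f b) * (b - a).

(** The discrete integral along the boundary of the square with the vertices
    [c + w], [c + 'i * w], [c - w], [c - 'i * w]. *)
Definition diamond f N c w : R[i] :=
  edge f N (c + w) (c + 'i * w) + edge f N (c + 'i * w) (c - w)
  + edge f N (c - w) (c - 'i * w) + edge f N (c - 'i * w) (c + w).

Lemma edge_rev f N a b : edge f N b a = - edge f N a b.
Proof.
elim: N a b => [|N IH] a b /=; first by ring.
rewrite [b + a]addrC; set m := (a + b) / 2.
rewrite (IH m b) (IH a m).
by rewrite opprD addrC.
Qed.

Lemma edgeB f g N a b :
  edge (fun x => f x - g x) N a b = edge f N a b - edge g N a b.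
Proof. by elim: N a b => [|N IH] a b /=; rewrite ?IH; ring. Qed.

Lemma diamondB f g N c w :
  diamond (fun x => f x - g x) N c w = diamond f N c w - diamond g N c w.
Proof. by rewrite /diamond !edgeB; ring. Qed.

(** The square is cut into four squares of half the size, whose inner edges are
    run through twice, in opposite directions. The refinement by one step makes
    the identity exact, so that no limit of sums is needed. *)
Lemma diamondS f N c w : diamond f N.+1 c w =
  diamond f N (c + w / 2) (w / 2) + diamond f N (c + 'i * w / 2) (w / 2)
  + diamond f N (c - w / 2) (w / 2) + diamond f N (c - 'i * w / 2) (w / 2).
Proof.
have two : (2 : R[i]) != 0 by rewrite pnatr_eq0.
rewrite /diamond /=.
have -> : (c + w + (c + 'i * w)) / 2 = c + w / 2 + 'i * (w / 2) by field.
have -> : (c + 'i * w + (c - w)) / 2 = c + 'i * w / 2 - w / 2 by field.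
have -> : (c - w + (c - 'i * w)) / 2 = c - w / 2 - 'i * (w / 2) by field.
have -> : (c - 'i * w + (c + w)) / 2 = c + w / 2 - 'i * (w / 2) by field.
have -> : c + w / 2 + w / 2 = c + w by field.
have -> : c + w / 2 - w / 2 = c by field.
have -> : c - w / 2 - w / 2 = c - w by field.
have -> : c - w / 2 + w / 2 = c by field.
have -> : c + 'i * w / 2 + w / 2 = c + w / 2 + 'i * (w / 2) by field.
have -> : c + 'i * w / 2 + 'i * (w / 2) = c + 'i * w by field.
have -> : c + 'i * w / 2 - 'i * (w / 2) = c by field.
have -> : c - w / 2 + 'i * (w / 2) = c + 'i * w / 2 - w / 2 by field.
have -> : c - 'i * w / 2 + w / 2 = c + w / 2 - 'i * (w / 2) by field.
have -> : c - 'i * w / 2 + 'i * (w / 2) = c by field.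
have -> : c - 'i * w / 2 - w / 2 = c - w / 2 - 'i * (w / 2) by field.
have -> : c - 'i * w / 2 - 'i * (w / 2) = c - 'i * w by field.
rewrite (edge_rev f N c (c + w / 2 + _)) (edge_rev f N c (c + w / 2 - _)).
rewrite (edge_rev f N c (c - w / 2 - _)) (edge_rev f N c (_ + 'i * w / 2 - _)).
by ring.
Qed.

(** The trapezoidal rule is exact on affine functions, and already the coarsest
    sum over the closed polygon vanishes. *)
Lemma diamond_affine (a b q : R[i]) N c w :
  diamond (fun x => a + b * (x - q)) N c w = 0.
Proof.
elim: N c w => [|N IH] c w; last by rewrite diamondS !IH !addr0.
by rewrite /diamond /=; ring.
Qed.

Lemma edge_le f (K : set R[i]) (m : R) N a b :
  (forall x y, K x -> K y -> K ((x + y) / 2)) ->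
  (forall x, K x -> nabs (f x) <= m) -> K a -> K b ->
  nabs (edge f N a b) <= 2 * m * nabs (b - a).
Proof.
move=> Kmid fm; elim: N a b => [|N IH] a b Ka Kb /=.
  rewrite nabsM ler_wpM2r ?nabs_ge0// mulr_natl mulr2n.
  by rewrite nabsD_le// fm.
have h2 : nabs (2^-1 : R[i]) = 2^-1.
  by rewrite nabsV (_ : (2 : R[i]) = 2%:C) ?nabs_pos// rmorph_nat.
have two : (2 : R[i]) != 0 by rewrite pnatr_eq0.
have K2 := Kmid _ _ Ka Kb.
apply: le_trans (nabsD_le (IH _ _ Ka K2) (IH _ _ K2 Kb)) _.
have -> : (a + b) / 2 - a = (b - a) / 2 by field.
have -> : b - (a + b) / 2 = (b - a) / 2 by field.
rewrite nabsM h2 -mulrDr; set u := nabs (b - a).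
by have -> : u / 2 + u / 2 = u by field.
Qed.

Lemma diamond_le f (m : R) N c w :
  (forall x, nabs (x - c) <= nabs w -> nabs (f x) <= m) ->
  nabs (diamond f N c w) <= 16 * m * nabs w.
Proof.
move=> fm.
have m0 : 0 <= m.
  by apply: le_trans (nabs_ge0 _) (fm c _); rewrite subrr nabs0 nabs_ge0.
pose K := [set x : R[i] | nabs (x - c) <= nabs w].
have h2 : nabs (2^-1 : R[i]) = 2^-1.
  by rewrite nabsV (_ : (2 : R[i]) = 2%:C) ?nabs_pos// rmorph_nat.
have two : (2 : R[i]) != 0 by rewrite pnatr_eq0.
have Kmid x y : K x -> K y -> K ((x + y) / 2).
  rewrite /K/= => xK yK.
  have -> : (x + y) / 2 - c = ((x - c) + (y - c)) / 2 by field.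
  rewrite nabsM h2; have := nabsD_le xK yK; lra.
have E a b : K a -> K b -> nabs (edge f N a b) <= 4 * m * nabs w.
  move=> Ka Kb; apply: le_trans (edge_le N Kmid fm Ka Kb) _.
  have -> : b - a = (b - c) - (a - c) by ring.
  have := nabsB_le Kb Ka; set u := nabs _; set v := nabs w => uv.
  by apply: le_trans (ler_wpM2l _ uv) _; [rewrite mulr_ge0|lra].
have K1 : K (c + w) by rewrite /K/= addrC addKr.
have K2 : K (c + 'i * w) by rewrite /K/= addrC addKr nabsM nabsi mul1r.
have K3 : K (c - w) by rewrite /K/= addrC addKr nabsN.
have K4 : K (c - 'i * w) by rewrite /K/= addrC addKr nabsN nabsM nabsi mul1r.
have -> : 16 * m * nabs w = 4 * m * nabs w + 4 * m * nabs w
  + 4 * m * nabs w + 4 * m * nabs w by ring.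
by rewrite /diamond !nabsD_le// E.
Qed.

End Edge.

(** * Goursat's lemma for trapezoidal sums *)

Section Goursat.
Context {R : realType}.
Implicit Types (f g : R[i] -> R[i]) (a b c w p : R[i]).

Lemma nabs_half w : nabs (w / 2) = nabs w / 2.
Proof. by rewrite nabsM nabsV (_ : (2 : R[i]) = 2%:C) ?nabs_pos// rmorph_nat. Qed.

Lemma nabs_pow2 w n : nabs (w / 2 ^+ n) = nabs w / 2 ^+ n.
Proof.
elim: n => [|n IH]; first by rewrite !expr0 !divr1.
by rewrite !exprSr !invfM !mulrA nabs_half IH.
Qed.

Lemma nabsiM w : nabs ('i * w) = nabs w.
Proof. by rewrite nabsM nabsi mul1r. Qed.

(** The discrete integrals over the square of radius [w] stay larger than a
    multiple of its area as the subdivision is refined. *)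
Let bad f (e : R) c w := forall N0, exists2 N, (N0 <= N)%N &
  e * nabs w ^+ 2 < nabs (diamond f N c w).

Let bad_split f e c w : bad f e c w ->
  exists2 c', nabs (c' - c) <= nabs w / 2 & bad f e c' (w / 2).
Proof.
move=> bcw; apply: contrapT => nex.
have good c' : nabs (c' - c) <= nabs w / 2 -> exists N0, forall N, (N0 <= N)%N ->
    nabs (diamond f N c' (w / 2)) <= e * nabs (w / 2) ^+ 2.
  move=> c'c; apply: contrapT => ng; apply: nex; exists c' => // N0.
  apply: contrapT => nb; apply: ng; exists N0 => N N0N.
  by rewrite leNgt; apply/negP => ?; apply: nb; exists N.
have [N1 H1] : exists N0, forall N, (N0 <= N)%N ->
    nabs (diamond f N (c + w / 2) (w / 2)) <= e * nabs (w / 2) ^+ 2.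
  by apply: good; rewrite addrC addKr nabs_half.
have [N2 H2] : exists N0, forall N, (N0 <= N)%N ->
    nabs (diamond f N (c + 'i * w / 2) (w / 2)) <= e * nabs (w / 2) ^+ 2.
  by apply: good; rewrite addrC addKr nabs_half nabsiM.
have [N3 H3] : exists N0, forall N, (N0 <= N)%N ->
    nabs (diamond f N (c - w / 2) (w / 2)) <= e * nabs (w / 2) ^+ 2.
  by apply: good; rewrite addrC addKr nabsN nabs_half.
have [N4 H4] : exists N0, forall N, (N0 <= N)%N ->
    nabs (diamond f N (c - 'i * w / 2) (w / 2)) <= e * nabs (w / 2) ^+ 2.
  by apply: good; rewrite addrC addKr nabsN nabs_half nabsiM.
have [[//|N]] := bcw (N1 + N2 + N3 + N4).+1.
rewrite ltnS => NN; apply/negP; rewrite -leNgt diamondS.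
have -> : e * nabs w ^+ 2 = e * nabs (w / 2) ^+ 2 + e * nabs (w / 2) ^+ 2
    + e * nabs (w / 2) ^+ 2 + e * nabs (w / 2) ^+ 2.
  by rewrite nabs_half; field.
have [? ? ? ?] : [/\ (N1 <= N)%N, (N2 <= N)%N, (N3 <= N)%N & (N4 <= N)%N].
  by split; lia.
by rewrite !nabsD_le// ?H1 ?H2 ?H3 ?H4.
Qed.

(** If the sums did not become small compared with the area, one of the four
    quarters of the square would have the same defect ([bad_split]), and the
    nested quarters would shrink to a point [p]. Near [p] the function differs
    from an affine one by less than any multiple of the distance to [p], and
    affine functions contribute nothing. *)
Lemma goursat f c w : (forall p, nabs (p - c) <= nabs w -> cdiff f p) ->
  forall e : R, 0 < e -> exists N0, forall N, (N0 <= N)%N ->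
    nabs (diamond f N c w) <= e * nabs w ^+ 2.
Proof.
move=> df e e0; apply: contrapT => ng.
have b0 : bad f e c w.
  move=> N0; apply: contrapT => nb; apply: ng; exists N0 => N N0N.
  by rewrite leNgt; apply/negP => ?; apply: nb; exists N.
pose good_next n c1 c2 := nabs (c2 - c1) <= nabs w / 2 ^+ n.+1 /\
   bad f e c2 (w / 2 ^+ n.+1).
pose x := fix x n := if n is m.+1 then xget 0 (good_next m (x m)) else c.
have xbad n : bad f e (x n) (w / 2 ^+ n) /\
    nabs (x n.+1 - x n) <= nabs w / 2 ^+ n.+1.
  have next m : bad f e (x m) (w / 2 ^+ m) -> good_next m (x m) (x m.+1).
    move=> /bad_split[c' c'x bc'].
    suff : good_next m (x m) c' by exact: xgetI.
    by split; rewrite exprSr invfM mulrA// -nabs_pow2.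
  have bx : bad f e (x n) (w / 2 ^+ n).
    by elim: n => [|n /next[]//]; rewrite expr0 divr1.
  by split=> //; have [] := next _ bx.
have [p Hp] := complex_complete_geo (fun n => (xbad n).2).
have /df/cdiffP[a Ha] : nabs (p - c) <= nabs w.
  by rewrite nabsB (le_trans (Hp 0)) ?expr0 ?divr1.
(* [16 * (e / 64) * 2 = e / 2] remains after the estimate of [diamond_le] *)
have e'0 : 0 < e / 64 by rewrite divr_gt0.
have [t t0 tH] := Ha _ e'0.
have pow n : 0 < (2 : R) ^+ n by rewrite exprn_gt0.
have [n nt] : exists n, 2 * (nabs w / 2 ^+ n) < t.
  have [n] := pow2_small (mulr_ge0 (ler0n _ 2) (nabs_ge0 w)) t0.
  by rewrite -mulrA; exists n.
have [N _] := (xbad n).1 0; apply/negP; rewrite -leNgt.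
set v := w / 2 ^+ n; have vE : nabs v = nabs w / 2 ^+ n by rewrite nabs_pow2.
rewrite -[diamond f _ _ _]subr0 -(diamond_affine (f p) a p N (x n) v) -diamondB.
have H : nabs (diamond (fun y => f y - (f p + a * (y - p))) N (x n) v) <=
    16 * (e / 64 * (2 * nabs v)) * nabs v.
  apply: diamond_le => y yx.
  have yp : nabs (y - p) <= 2 * nabs v.
    rewrite mulr_natl mulr2n; apply: le_trans (nabs_sub_le _ (x n) _) _.
    by rewrite lerD// vE.
  rewrite opprD addrA; apply: le_trans (tH _ _) _.
    by apply: le_lt_trans yp _; rewrite vE.
  by rewrite ler_wpM2l ?(ltW e'0).
apply: le_trans H _; set u := nabs v.
have -> : 16 * (e / 64 * (2 * u)) * u = e * u ^+ 2 * (1 / 2) by field.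
have : 0 <= e * u ^+ 2 by rewrite mulr_ge0 ?sqr_ge0// ltW.
lra.
Qed.

Lemma edge_rot N a b (f := fun x : R[i] => x^-1) :
  edge f N ('i * a) ('i * b) = edge f N a b.
Proof.
elim: N a b => [|N IH] a b /=.
  have i0 : ('i : R[i]) != 0 by rewrite -nabs_eq0 nabsi oner_eq0.
  rewrite /f !invfM -mulrDr -mulrBr mulrACA.
  by rewrite mulVf// mul1r.
by rewrite -mulrDr -mulrA !IH.
Qed.

(** On an edge of the square the imaginary part of each summand of the sum for
    [x^-1] is an area divided by squared moduli, hence can be bounded below
    uniformly in the subdivision. *)
Lemma edge_inv_Im N (r s t : R) : 0 < r -> 0 <= s -> s <= t -> t <= 1 ->
  2 * (t - s) <= complex.Im (edge (fun x => x^-1) N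
     ((r * (1 - s)) +i* (r * s)) ((r * (1 - t)) +i* (r * t))).
Proof.
move=> r0; elim: N s t => [|N IH] s t s0 st t1 /=.
  have D (u : R) : 0 <= u -> u <= 1 -> 0 < (1 - u) ^+ 2 + u ^+ 2 /\ (1 - u) ^+ 2 + u ^+ 2 <= 1.
    by move=> u0 u1; split; nra.
  have [Ds0 Ds1] := D s s0 (le_trans st t1).
  have [Dt0 Dt1] := D t (le_trans s0 st) t1.
  set Ds := _ + s ^+ 2 in Ds0 Ds1; set Dt := _ + t ^+ 2 in Dt0 Dt1.
  have E u : (r * (1 - u)) ^+ 2 + (r * u) ^+ 2 = r ^+ 2 * ((1 - u) ^+ 2 + u ^+ 2) by ring.
  rewrite !E -/Ds -/Dt.
  rewrite [leRHS](_ : _ = (t - s) * (Ds^-1 + Dt^-1)); last first.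
    rewrite /Ds /Dt; field; rewrite -/Ds -/Dt; by rewrite !gt_eqF.
  rewrite mulrC ler_wpM2l ?subr_ge0// [leLHS](_ : 2 = 1 + 1)// lerD//.
    by rewrite invf_ge1.
  by rewrite invf_ge1.
have two : (2 : R[i]) != 0 by rewrite pnatr_eq0.
pose m := (s + t) / 2.
have -> : (r * (1 - s) +i* (r * s) + r * (1 - t) +i* (r * t)) / 2 =
    (r * (1 - m)) +i* (r * m).
  apply: (mulIf two); rewrite divfK// mulr_natr mulr2n.
  by apply/eqP; rewrite eq_complex/= /m; apply/andP; split; apply/eqP; field.
have ReD (x y : R[i]) : complex.Im (x + y) = complex.Im x + complex.Im y.
  by case: x y => [? ?] [? ?].
rewrite ReD; have := IH s m; have := IH m t.
have sm : s <= m by rewrite /m; lra.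
have mt : m <= t by rewrite /m; lra.
have m1 : m <= 1 by lra.
have m0 : 0 <= m by lra.
move=> /(_ m0 mt t1) H1 /(_ s0 sm m1) H2; lra.
Qed.

(** The four edges contribute equally by [edge_rot], each with an imaginary part
    of at least 2. A positive bound that depends neither on [N] nor on [r] takes
    the place of the winding number in the proof of the maximum principle. *)
Lemma diamond_inv N (r : R) : 0 < r ->
  8 <= nabs (diamond (fun x : R[i] => x^-1) N 0 r%:C).
Proof.
move=> r0; rewrite /diamond !add0r.
set f := fun x : R[i] => x^-1.
have i2 (x : R[i]) : 'i * ('i * x) = - x.
  by rewrite mulrA -expr2 sqr_i mulN1r.
have E1 : edge f N ('i * r%:C) (- r%:C) = edge f N r%:C ('i * r%:C).
  by rewrite -i2 edge_rot.
have NN (a b : R[i]) : edge f N (- a) (- b) = edge f N a b.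
  by rewrite -(i2 a) -(i2 b) !edge_rot.
have E3 : edge f N (- ('i * r%:C)) r%:C = edge f N r%:C ('i * r%:C).
  by rewrite -{2}(opprK r%:C) NN E1.
rewrite E1 NN E3; set z := edge _ _ _ _.
apply: le_trans (Im_le_nabs _); apply: le_trans (ler_norm _).
have -> : complex.Im (z + z + z + z) = 4 * complex.Im z.
  by case: z => [u v] /=; ring.
have := @edge_inv_Im N r 0 1 r0 (lexx 0) ler01 (lexx 1).
rewrite !(subr0, subrr, mulr0, mulr1).
have -> : (0 +i* r) = 'i * r%:C :> R[i].
  by apply/eqP; rewrite eq_complex; apply/andP; split; apply/eqP => /=; ring.
rewrite -[edge _ _ _ _]/z; lra.
Qed.

End Goursat.

(** * The maximum principle *)

Section MaximumPrinciple.
Context {R : realType}.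
Implicit Types (f g h : R[i] -> R[i]) (c p : R[i]).

(** The norm of the plane whose spheres are the squares of [diamond]. *)
Definition taxi (x : R[i]) : R := `|complex.Re x| + `|complex.Im x|.

Lemma nabs_le_taxi x : nabs x <= taxi x.
Proof. exact: nabs_le_ReIm. Qed.

Lemma taxi_le_nabs x : taxi x <= 2 * nabs x.
Proof. by rewrite mulr_natl mulr2n lerD ?Re_le_nabs ?Im_le_nabs. Qed.

Lemma diamond_bd f N (m r : R) : 0 <= r ->
  (forall x, taxi x = r -> nabs (f x) <= m) ->
  nabs (diamond f N 0 r%:C) <= 16 * m * r.
Proof.
move=> r0 fm.
have m0 : 0 <= m.
  apply: le_trans (nabs_ge0 _) (fm r%:C _).
  by rewrite /taxi/= normr0 addr0 ger0_norm.
have E (s1 s2 : R) a b : `|s1| = 1 -> `|s2| = 1 ->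
  s1 * complex.Re a + s2 * complex.Im a = r ->
  0 <= s1 * complex.Re a -> 0 <= s2 * complex.Im a ->
  s1 * complex.Re b + s2 * complex.Im b = r ->
  0 <= s1 * complex.Re b -> 0 <= s2 * complex.Im b ->
  nabs (edge f N a b) <= 4 * m * r.
- move=> s11 s21 a1 a2 a3 b1 b2 b3.
  pose K := [set x : R[i] | [/\ s1 * complex.Re x + s2 * complex.Im x = r,
    0 <= s1 * complex.Re x & 0 <= s2 * complex.Im x]].
  have Kt x : K x -> taxi x = r.
    move=> [x1 x2 x3]; rewrite /taxi -x1.
    by rewrite -(ger0_norm x2) -(ger0_norm x3) !normrM s11 s21 !mul1r.
  have two : (2 : R[i]) != 0 by rewrite pnatr_eq0.
  have half (x y : R[i]) : complex.Re ((x + y) / 2) = (complex.Re x + complex.Re y) / 2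
    /\ complex.Im ((x + y) / 2) = (complex.Im x + complex.Im y) / 2.
    have -> : (x + y) / 2 = ((complex.Re x + complex.Re y) / 2) +i*
        ((complex.Im x + complex.Im y) / 2); last by [].
    apply: (mulIf two); rewrite divfK// mulr_natr mulr2n.
    by case: x y => [x1 x2] [y1 y2]; apply/eqP; rewrite eq_complex/=;
      apply/andP; split; apply/eqP; field.
  have Kmid x y : K x -> K y -> K ((x + y) / 2).
    move=> [x1 x2 x3] [y1 y2 y3]; have [H1 H2] := half x y.
    split; rewrite ?H1 ?H2; lra.
  have Km x : K x -> nabs (f x) <= m by move=> /Kt/fm.
  have Ka : K a by [].
  have Kb : K b by [].
  apply: le_trans (edge_le N Kmid Km Ka Kb) _.
  have := nabsB_le (nabs_le_taxi b) (nabs_le_taxi a).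
  rewrite (Kt _ Ka) (Kt _ Kb) => ab.
  by apply: le_trans (ler_wpM2l _ ab) _; [rewrite mulr_ge0|lra].
have Ei : 'i * r%:C = 0 +i* r :> R[i].
  by apply/eqP; rewrite eq_complex; apply/andP; split; apply/eqP => /=; ring.
have N1 : `|1 : R| = 1 by rewrite normr1.
have N2 : `|-1 : R| = 1 by rewrite normrN1.
have -> : 16 * m * r = 4 * m * r + 4 * m * r + 4 * m * r + 4 * m * r by ring.
rewrite /diamond Ei !add0r.
rewrite !nabsD_le//.
- by apply: (E 1 1) => //=; rewrite ?mul1r ?addr0 ?add0r.
- by apply: (E (-1) 1) => //=; rewrite ?mul1r ?mulN1r ?opprK ?oppr0 ?addr0 ?add0r.
- by apply: (E (-1) (-1)) => //=;
     rewrite ?mul1r ?mulN1r ?opprK ?oppr0 ?addr0 ?add0r.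
- by apply: (E 1 (-1)) => //=; rewrite ?mul1r ?mulN1r ?opprK ?oppr0 ?addr0 ?add0r.
Qed.

Lemma expr_small (q e : R) : 0 <= q -> q < 1 -> 0 < e -> exists n, q ^+ n.+1 < e.
Proof.
move=> q0 q1 e0; have : `|q| < 1 by rewrite ger0_norm.
move/(@cvg_expr R)/cvgrPdist_lt/(_ _ e0) => [N _ HN].
exists N; have := HN N.+1 (leqnSn N).
by rewrite /= sub0r normrN ger0_norm ?exprn_ge0.
Qed.

(** Suppose that [m < nabs (f 0)]. A high power [y] of [f / f 0] is then small on
    the boundary and equals 1 at 0, so [(1 - y) ^+ 3] vanishes at 0 to the third
    order and its quotient by [x] is differentiable everywhere. By [goursat] the
    discrete integrals of this quotient become small; but on the boundary the
    quotient is nearly [x^-1], whose discrete integrals do not. *)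
Let max0 f (r m : R) : 0 < r ->
  (forall x, nabs x <= r -> cdiff f x) ->
  (forall x, taxi x = r -> nabs (f x) <= m) -> nabs (f 0) <= m.
Proof.
move=> r0 df fm; rewrite leNgt; apply/negP => mf.
have m0 : 0 <= m.
  apply: le_trans (nabs_ge0 _) (fm r%:C _).
  by rewrite /taxi/= normr0 addr0 gtr0_norm.
set a := f 0 in mf; have na0 : 0 < nabs a by apply: le_lt_trans mf.
have a0 : a != 0 by rewrite -nabs_gt0.
have q0 : 0 <= m / nabs a by rewrite divr_ge0 ?nabs_ge0.
have q1 : m / nabs a < 1 by rewrite ltr_pdivrMr ?mul1r.
have h32 : (0 : R) < 1 / 64 by lra.
have [n qn] := expr_small q0 q1 h32.
pose y x := (f x / a) ^+ n.+1.
have dy x : nabs x <= r -> cdiff y x.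
  by move=> /df fx; apply: cdiffX; apply: cdiffM; [exact: fx|exact: cdiff_cst].
have y0 : y 0 = 1 by rewrite /y divff// expr1n.
pose chi x := (1 - y x) ^+ 3 / x.
have dchi x : nabs (x - 0) <= nabs r%:C -> cdiff chi x.
  rewrite subr0 nabs_pos ?(ltW r0)// => xr; have [->|x0] := eqVneq x 0.
    have [|L L0 [t t0 tH]] := @cdiff_lip _ y 0.
      by apply: dy; rewrite nabs0 ltW.
    apply: (@cdiff_quad _ _ _ (L ^+ 3) t) => // z zt.
    have := tH z zt; rewrite subr0 y0 /chi nabsM nabsV nabsX nabsB => H.
    have [->|z0] := eqVneq z 0; first by rewrite nabs0 invr0 !mulr0 expr0n/= mulr0.
    rewrite ler_pdivrMr ?nabs_gt0// -mulrA -exprSr -exprMn.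
    by rewrite lerXn2r// nnegrE ?nabs_ge0// mulr_ge0// nabs_ge0.
  apply: cdiffM; last by apply: cdiffV => //; exact: cdiff_id.
  by apply: cdiffX; apply: cdiffB; [exact: cdiff_cst|exact: dy].
have ri : 0 < r^-1 by rewrite invr_gt0.
have [N0 HN] := goursat dchi (exprn_gt0 2 ri).
have := HN _ (leqnn _); rewrite nabs_pos ?(ltW r0)// -exprMn mulVf ?gt_eqF//.
rewrite expr1n => chi1.
have H : nabs (diamond (fun x => chi x - x^-1) N0 0 r%:C) <=
    16 * (7 * (1 / 64) * (2 / r)) * r.
  apply: diamond_bd; first exact: ltW.
  move=> x xr.
  have x0 : x != 0.
    by apply: contra_eq_neq xr => ->; rewrite /taxi/= normr0 addr0 lt_eqF.
  have yx : nabs (y x) <= 1 / 64.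
    rewrite /y nabsX nabsM nabsV; apply: le_trans (ltW qn).
    by rewrite lerXn2r// ?nnegrE ?divr_ge0 ?nabs_ge0// ler_wpM2r ?invr_ge0 ?nabs_ge0// fm.
  have -> : chi x - x^-1 = - (y x * (3 - 3 * y x + y x ^+ 2)) / x.
    by rewrite /chi; field.
  rewrite nabsM nabsN nabsV nabsM; apply: ler_pM.
  - by rewrite mulr_ge0 ?nabs_ge0.
  - by rewrite invr_ge0 nabs_ge0.
  - rewrite mulrC; apply: ler_pM; rewrite ?nabs_ge0//.
    have n3 : nabs (3 : R[i]) = 3.
      by rewrite (_ : (3 : R[i]) = 3%:C) ?nabs_pos// rmorph_nat.
    have -> : (7 : R) = 3 + 3 + 1 by ring.
    apply: nabsD_le; last first.
      by rewrite nabsX expr_le1 ?nabs_ge0//; lra.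
    apply: nabsB_le; first by rewrite n3.
    by rewrite nabsM n3; lra.
  - have := taxi_le_nabs x; rewrite xr => rx.
    have : 0 < nabs x by rewrite nabs_gt0.
    by move=> nx0; rewrite -[leRHS]invrK lef_pV2 ?posrE ?invr_gt0 ?divr_gt0//
      invf_div ler_pdivrMr// mulrC.
have := diamond_inv N0 r0; rewrite leNgt => /negP; apply.
have -> : diamond (fun x => x^-1) N0 0 r%:C =
    diamond chi N0 0 r%:C - diamond (fun x => chi x - x^-1) N0 0 r%:C.
  by rewrite diamondB opprB addrC subrK.
apply: (le_lt_trans (nabsB_le chi1 H)).
have -> : 16 * (7 * (1 / 64) * (2 / r)) * r = 7 / 2 :> R by field; rewrite gt_eqF.
lra.
Qed.

Lemma max_principle f c (r m : R) : 0 < r ->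
  (forall x, nabs (x - c) <= r -> cdiff f x) ->
  (forall x, taxi (x - c) = r -> nabs (f x) <= m) -> nabs (f c) <= m.
Proof.
move=> r0 df fm.
have -> : f c = f (c + 1 * 0) by rewrite mulr0 addr0.
apply: (@max0 (fun x => f (c + 1 * x)) r m r0).
- move=> x xr; apply: cdiff_comp_affine; apply: df.
  by rewrite mul1r addrC addKr.
- by move=> x xr; apply: fm; rewrite mul1r addrC addKr.
Qed.

(** The product [g ^+ 2 * h ^+ n.+1] is differentiable also at the zeros of [g],
    where it is quadratically small because [h] is bounded. The maximum
    principle for all these products bounds [h c] up to a factor that does not
    depend on [n]; the factor disappears as [n] grows. *)
Lemma max_principle_thin g h c (r m : R) : 0 < r ->
  (forall x, nabs (x - c) <= r -> cdiff g x) ->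
  (forall x, nabs (x - c) <= r -> g x != 0 -> cdiff h x) ->
  (forall x, nabs (x - c) <= r -> g x = 0 -> exists M t : R, 0 < t /\
     forall y, nabs (y - x) < t -> g y != 0 -> nabs (h y) <= M) ->
  (exists M : R, forall x, taxi (x - c) = r -> nabs (g x) <= M) ->
  (forall x, taxi (x - c) = r -> g x != 0 -> nabs (h x) <= m) ->
  g c != 0 -> nabs (h c) <= m.
Proof.
move=> r0 dg dh hb [M gM] hm gc.
have M0 : 0 <= M.
  apply: le_trans (nabs_ge0 _) (gM (c + r%:C) _).
  by rewrite addrC addKr /taxi/= normr0 addr0 gtr0_norm.
have key n : nabs (g c) ^+ 2 * nabs (h c) ^+ n.+1 <= M ^+ 2 * `|m| ^+ n.+1.
  have -> : nabs (g c) ^+ 2 * nabs (h c) ^+ n.+1 = nabs (g c ^+ 2 * h c ^+ n.+1).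
    by rewrite nabsM !nabsX.
  apply: (@max_principle (fun x => g x ^+ 2 * h x ^+ n.+1) c r _ r0).
  - move=> x xr; have [gx0|gx0] := eqVneq (g x) 0; last first.
      by apply: cdiffM; apply: cdiffX; [exact: dg|exact: dh].
    have [K [t [t0 tH]]] := hb _ xr gx0.
    have [L L0 [s s0 sH]] := cdiff_lip (dg _ xr).
    apply: (@cdiff_quad _ _ _ (L ^+ 2 * `|K| ^+ n.+1) (Num.min s t)).
      by rewrite lt_min s0.
    move=> y; rewrite lt_min => /andP[/sH ys /tH yt]; move: ys.
    rewrite gx0 subr0 nabsM !nabsX => ys; rewrite [leRHS]mulrAC.
    have [gy0|gy0] := eqVneq (g y) 0.
      by rewrite gy0 nabs0 expr0n/= mul0r !mulr_ge0 ?exprn_ge0 ?nabs_ge0.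
    apply: ler_pM; rewrite ?exprn_ge0 ?nabs_ge0//.
      by rewrite -exprMn lerXn2r// nnegrE ?mulr_ge0 ?nabs_ge0.
    rewrite lerXn2r// ?nnegrE ?nabs_ge0//.
    exact: le_trans (yt gy0) (ler_norm _).
  - move=> x xr; rewrite nabsM !nabsX.
    have [gx0|gx0] := eqVneq (g x) 0.
      by rewrite gx0 nabs0 expr0n/= mul0r mulr_ge0 ?exprn_ge0.
    apply: ler_pM; rewrite ?exprn_ge0 ?nabs_ge0//.
      by rewrite lerXn2r// ?nnegrE ?nabs_ge0// gM.
    rewrite lerXn2r// ?nnegrE ?nabs_ge0//.
    exact: le_trans (hm _ xr gx0) (ler_norm _).
have hm' : nabs (h c) <= `|m|.
  rewrite leNgt; apply/negP => mh.
  have h0 : 0 < nabs (h c) by apply: le_lt_trans mh.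
  have q0 : 0 <= `|m| / nabs (h c) by rewrite divr_ge0 ?nabs_ge0.
  have q1 : `|m| / nabs (h c) < 1 by rewrite ltr_pdivrMr ?mul1r.
  have M1 : 0 < M ^+ 2 + 1 by rewrite ltr_wpDl ?sqr_ge0.
  have g0 : 0 < nabs (g c) ^+ 2 by rewrite exprn_gt0 ?nabs_gt0.
  have [n] := expr_small q0 q1 (divr_gt0 g0 M1).
  rewrite expr_div_n ltr_pdivrMr ?exprn_gt0// mulrAC ltr_pdivlMr//.
  rewrite ltNge => /negP; apply; apply: le_trans (key n) _.
  by rewrite mulrC ler_wpM2l ?exprn_ge0 ?lerDl.
have [m0|m0] := leP 0 m; first by rewrite -(ger0_norm m0).
(* for [m < 0] the boundary would consist of zeros of [g] *)
have gz x : taxi (x - c) = r -> nabs (g x) <= 0.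
  move=> xr; have [->|gx0] := eqVneq (g x) 0; first by rewrite nabs0.
  by have := le_trans (nabs_ge0 _) (hm _ xr gx0); rewrite leNgt m0.
have := max_principle r0 dg gz; rewrite le_eqVlt ltNge nabs_ge0 orbF.
by rewrite nabs_eq0 (negbTE gc).
Qed.

End MaximumPrinciple.

(** * The Schwarz lemma and isolated zeros *)

Section IdentityTheorem.
Context {R : realType}.
Implicit Types (f g h : R[i] -> R[i]) (c p : R[i]).

Lemma cdiff_subr (a p : R[i]) : cdiff (fun x => x - a) p.
Proof. by apply: cdiffB; [exact: cdiff_id|exact: cdiff_cst]. Qed.

(** Compactness of the disc, in the form of the existence of a Lebesgue number. *)
Lemma disc_uniform (r : R) (P : R[i] -> R -> Prop) :
  (forall x e e', 0 < e' -> e' <= e -> P x e -> P x e') ->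
  (forall x, nabs x <= r ->
    exists2 t : R, 0 < t & forall y, nabs y <= r -> nabs (y - x) < t -> P y t) ->
  exists2 t : R, 0 < t & forall x, nabs x <= r -> P x t.
Proof.
move=> Pmono Ploc.
pose K : set (R * R) := `[-r, r]%classic `*` `[-r, r]%classic.
have cK : compact K by apply: compact_setX; exact: segment_compact.
pose Q (t : R) (x : R * R) := nabs (x.1 +i* x.2) <= r -> P (x.1 +i* x.2) t.
have /compact_near_coveringP/(_ _ (0^'+) Q _) cov := cK.
have [|t /= t0 tH] := cov.
  move=> [a b] Kab; have [xr|xr] := leP (nabs (a +i* b)) r.
    have [t t0 tH] := Ploc _ xr.
    exists ([set y | `|a - y.1| < t / 2 /\ `|b - y.2| < t / 2],
       [set s | 0 < s /\ s <= t]) => /=.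
      split=> /=; last first.
        exists t => //= s; rewrite /= sub0r normrN => st s0; split => //.
        by rewrite ltW// (le_lt_trans (ler_norm _)).
      exists ([set y | `|a - y| < t / 2], [set y | `|b - y| < t / 2]) => /=.
        by split; apply: nbhsx_ballx; rewrite divr_gt0.
      by move=> [y1 y2] /= [].
    move=> [[y1 y2] s] /= [[y1a y2b] [s0 st]] yr; apply: (Pmono _ t) => //.
    apply: tH => //; apply: le_lt_trans (nabs_le_ReIm _) _.
    by rewrite /= distrC [X in _ + X]distrC (splitr t) ltrD.
  pose t := nabs (a +i* b) - r.
  have t0 : 0 < t by rewrite subr_gt0.
  exists ([set y | `|a - y.1| < t / 2 /\ `|b - y.2| < t / 2], setT) => /=.
    split=> /=; last exact: filterT.
    exists ([set y | `|a - y| < t / 2], [set y | `|b - y| < t / 2]) => /=.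
      by split; apply: nbhsx_ballx; rewrite divr_gt0.
    by move=> [y1 y2] /= [].
  move=> [[y1 y2] s] /= [[y1a y2b] _] yr; exfalso.
  have : nabs ((a +i* b) - (y1 +i* y2)) < t.
    by apply: le_lt_trans (nabs_le_ReIm _) _; rewrite /= (splitr t) ltrD.
  have := nabsD_le (lexx (nabs ((a +i* b) - (y1 +i* y2)))) yr.
  by rewrite subrK /t; lra.
exists (t / 2); first by rewrite divr_gt0.
move=> x xr.
have /(_ (x : R[i])) : forall x : R[i], x = complex.Re x +i* complex.Im x by case.
move=> xE; rewrite xE; apply: (tH (t / 2) _ _ (complex.Re x, complex.Im x)) => //=.
- by rewrite sub0r normrN gtr0_norm ?divr_gt0// ltr_pdivrMr// ltr_pMr// ltr1n.
- by rewrite divr_gt0.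
- split; rewrite /= in_itv/= -ler_norml.
    exact: le_trans (Re_le_nabs _) xr.
  exact: le_trans (Im_le_nabs _) xr.
- by rewrite /= -xE.
Qed.

Lemma cdiff_bounded f (r : R) : (forall x, nabs x <= r -> cdiff f x) ->
  exists M : R, forall x, nabs x <= r -> nabs (f x) <= M.
Proof.
move=> df; have [||t t0 tH] := @disc_uniform r (fun x t => nabs (f x) <= t^-1).
- by move=> x e e' e'0 ee' /le_trans; apply; rewrite lef_pV2// posrE (lt_le_trans e'0).
- move=> x xr; have [M [t t0 tH]] := cdiff_locbd (df _ xr).
  have M1 : 0 < `|M| + 1 by rewrite ltr_wpDl.
  exists (Num.min t (`|M| + 1)^-1); first by rewrite lt_min t0 invr_gt0.
  move=> y yr; rewrite lt_min => /andP[/tH yt _]; apply: le_trans yt _.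
  apply: (@le_trans _ _ (`|M| + 1)); first by have := ler_norm M; lra.
  rewrite -[leLHS]invrK lef_pV2 ?posrE ?invr_gt0//; last first.
    by rewrite lt_min t0 invr_gt0.
  by rewrite ge_min lexx orbT.
by exists t^-1.
Qed.

Definition zeros_acc f c := forall e : R, 0 < e ->
  exists a, [/\ a != c, nabs (a - c) < e & f a = 0].

(** Centres that are moved by at most [r / 16] leave the boundary of the square
    of size [r / 2] well inside the disc of radius [r] and away from [c]. *)
Lemma far_from_center c x0 x (r : R) : nabs (x0 - c) <= r / 16 ->
  taxi (x - x0) = r / 2 -> 3 * r / 16 <= nabs (x - c).
Proof.
move=> x0c xx0.
have := taxi_le_nabs (x - x0); have := nabs_sub_le x c x0.
rewrite xx0 [nabs (c - x0)]nabsB; lra.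
Qed.

Section Disc.
Variables (f : R[i] -> R[i]) (c : R[i]) (r M : R).
Hypotheses (r0 : 0 < r) (df : forall x, nabs (x - c) <= r -> cdiff f x).
Hypothesis fM : forall x, nabs (x - c) <= r -> nabs (f x) <= M.

Let inner x0 x : nabs (x0 - c) <= r / 16 -> nabs (x - x0) <= r / 2 ->
  nabs (x - c) <= r.
Proof. by move=> h1 h2; have := nabs_sub_le x x0 c; have := r0; lra. Qed.

Let r2 : 0 < r / 2. Proof. by rewrite divr_gt0. Qed.

Let outer x0 x : nabs (x0 - c) <= r / 16 -> taxi (x - x0) = r / 2 ->
  nabs (x - c) <= r.
Proof.
move=> h1 h2; apply: inner h1 _; apply: le_trans (nabs_le_taxi _) _.
by rewrite h2.
Qed.

Let M0 : 0 <= M.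
Proof.
by apply: le_trans (nabs_ge0 _) (fM (_ : nabs (c - c) <= r)); rewrite subrr nabs0 ltW.
Qed.

(** The maximum principle for the difference quotient
    [(f x - f c) / (x - c)], which is bounded near its singular point [c]. *)
Lemma schwarz x0 : nabs (x0 - c) <= r / 16 ->
  nabs (f x0 - f c) <= 16 * M / r * nabs (x0 - c).
Proof.
move=> x0c; have [->|x0nc] := eqVneq x0 c; first by rewrite !subrr !nabs0 mulr0.
have xc0 : x0 - c != 0 by rewrite subr_eq0.
rewrite -ler_pdivrMr ?nabs_gt0// -nabsV -nabsM.
apply: (@max_principle_thin _ (fun x => x - c) (fun x => (f x - f c) / (x - c)) x0 (r / 2)) => //.
- by move=> x _; apply: cdiffB; [exact: cdiff_id|exact: cdiff_cst].
- move=> x xx0 xc; apply: cdiffM; last first.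
    by apply: cdiffV => //; apply: cdiffB; [exact: cdiff_id|exact: cdiff_cst].
  by apply: cdiffB; [apply: df; exact: inner xx0|exact: cdiff_cst].
- move=> x xx0 /eqP; rewrite subr_eq0 => /eqP ->.
  have [|L L0 [t t0 tH]] := @cdiff_lip _ f c.
    by apply: df; rewrite subrr nabs0 ltW.
  exists L, t; split => // y /tH yt yc; rewrite nabsM nabsV.
  by rewrite ler_pdivrMr ?nabs_gt0.
- by exists r => x /(outer x0c).
- move=> x xx0 xc; have xr := outer x0c xx0.
  have := far_from_center x0c xx0; rewrite nabsM nabsV => rx.
  rewrite ler_pdivrMr ?nabs_gt0//.
  have fc : nabs (f c) <= M by apply: fM; rewrite subrr nabs0 ltW.
  apply: le_trans (nabsB_le (fM xr) fc) _.
  have K0 : 0 <= 16 * M / r by rewrite divr_ge0 ?mulr_ge0// ltW.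
  apply: le_trans (ler_wpM2l K0 rx).
  have -> : 16 * M / r * (3 * r / 16) = 3 * M by field; rewrite gt_eqF.
  by have := M0; lra.
Qed.

Hypothesis acc : zeros_acc f c.

(** All the quotients [f x / (x - c) ^+ n] stay bounded near [c]. Inductively, if
    [a] is a zero close to [c], then dividing the quotient for [n] by [x - a]
    instead of [x - c] gives a function without singularity at [a], to which the
    maximum principle applies; now let [a] tend to [c]. The bounds obtained from
    the boundary force [f] to vanish like every power of 1/3. *)
Lemma zeros_acc_vanish x0 : nabs (x0 - c) <= r / 16 -> f x0 = 0.
Proof.
pose s := 3 * r / 16; have s0 : 0 < s by rewrite /s divr_gt0// mulr_gt0.
have dpow n (a x : R[i]) : cdiff (fun x => (x - a) ^+ n) x.
  by apply: cdiffX; exact: cdiff_subr.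
have dq n x : nabs (x - c) <= r -> x - c != 0 -> cdiff (fun x => f x / (x - c) ^+ n) x.
  move=> xr xc; apply: cdiffM; first exact: df.
  by apply: cdiffV; [exact: dpow|rewrite expf_neq0].
have qM n y x : nabs (y - c) <= r / 16 -> taxi (x - y) = r / 2 ->
    nabs (f x / (x - c) ^+ n) <= M / s ^+ n.
  move=> yc xy; rewrite nabsM nabsV nabsX; apply: ler_pM; rewrite ?nabs_ge0//.
  - by rewrite invr_ge0 exprn_ge0 ?nabs_ge0.
  - by apply: fM; exact: outer xy.
  - have := far_from_center yc xy => sx.
    rewrite lef_pV2 ?posrE ?exprn_gt0//; last by apply: lt_le_trans sx.
    by rewrite lerXn2r// nnegrE ?nabs_ge0// ltW.
have P n : exists K t : R, 0 < t /\ forall x, nabs (x - c) < t -> x - c != 0 ->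
    nabs (f x / (x - c) ^+ n) <= K.
  elim: n => [|n [K [t [t0 IH]]]].
    exists M, r; split => // x xr xc; rewrite expr0 divr1; apply: fM.
    exact: ltW.
  exists (8 * (M / s ^+ n) / r), (r / 16); split; first by rewrite divr_gt0.
  move=> {}x0 /ltW x0c xc.
  have -> : f x0 / (x0 - c) ^+ n.+1 = f x0 / (x0 - c) ^+ n / (x0 - c).
    by rewrite exprSr invfM mulrA.
  rewrite nabsM nabsV.
  rewrite ler_pdivrMr ?nabs_gt0//.
  set B := 8 * (M / s ^+ n) / r.
  have B0 : 0 <= B by rewrite /B !(mulr_ge0, invr_ge0, exprn_ge0)// ltW.
  have x0n := nabs_gt0 (x0 - c); rewrite xc in x0n.
  apply/ler_addgt0Pr => e e0.
  have e1 : 0 < e / (B + 1) by rewrite divr_gt0// ltr_wpDl.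
  have r16 : 0 < r / 16 by rewrite divr_gt0.
  have [|a [ac ae fa]] := acc (_ : 0 < Num.min (nabs (x0 - c)) (Num.min (e / (B + 1)) (r / 16))).
    by rewrite !lt_min x0n e1.
  move: ae; rewrite !lt_min => /andP[ax0 /andP[ae /ltW ar]].
  have ac0 : a - c != 0 by rewrite subr_eq0.
  have x0a : x0 - a != 0.
    by rewrite subr_eq0; apply: contraTneq ax0 => ->; rewrite ltxx.
  apply: (@le_trans _ _ (B * nabs (x0 - a))); last first.
    apply: (@le_trans _ _ (B * (nabs (x0 - c) + nabs (a - c)))).
      by rewrite ler_wpM2l// [nabs (a - c)]nabsB nabs_sub_le.
    rewrite mulrDr lerD2l; apply: le_trans (ler_wpM2l B0 (ltW ae)) _.
    by rewrite mulrA ler_pdivrMr ?ltr_wpDl// mulrC ler_wpM2l ?(ltW e0)// lerDl.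
  rewrite -ler_pdivrMr ?nabs_gt0// -nabsV -nabsM.
  apply: (@max_principle_thin _ (fun x => (x - c) * (x - a))
     (fun x => f x / (x - c) ^+ n / (x - a)) x0 (r / 2)) => //.
  - move=> x _; by apply: cdiffM; exact: cdiff_subr.
  - move=> x xx0; rewrite mulf_eq0 negb_or => /andP[xnc xna].
    apply: cdiffM; first by apply: dq => //; exact: inner xx0.
    by apply: cdiffV => //; apply: cdiffB; [exact: cdiff_id|exact: cdiff_cst].
  - move=> x xx0 /eqP; rewrite mulf_eq0 => /orP[|].
      rewrite subr_eq0 => /eqP ->.
      have na := nabs_gt0 (a - c); rewrite ac0 in na.
      exists (`|K| * (nabs (a - c) / 2)^-1), (Num.min t (nabs (a - c) / 2)).
      split; first by rewrite lt_min t0 divr_gt0.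
      move=> y; rewrite lt_min mulf_eq0 negb_or => /andP[yt ya] /andP[yc yna].
      rewrite nabsM nabsV; apply: ler_pM; rewrite ?invr_ge0 ?nabs_ge0//.
        exact: le_trans (IH _ yt yc) (ler_norm _).
      rewrite lef_pV2 ?posrE ?nabs_gt0 ?divr_gt0//.
      by have := nabs_sub_le a y c; rewrite [nabs (a - y)]nabsB; lra.
    rewrite subr_eq0 => /eqP ->.
    have [|L L0 [u u0 uH]] := cdiff_lip (dq n a _ ac0); first lra.
    exists L, u; split => // y /uH; rewrite fa mul0r subr0 => yL.
    rewrite mulf_eq0 negb_or => /andP[yc yna].
    by rewrite nabsM nabsV ler_pdivrMr ?nabs_gt0.
  - exists (r * (2 * r)) => x xx0; have xr := outer x0c xx0.
    rewrite nabsM; apply: ler_pM; rewrite ?nabs_ge0//.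
    by have := nabs_sub_le x c a; rewrite [nabs (c - a)]nabsB; lra.
  - move=> x xx0; rewrite mulf_eq0 negb_or => /andP[xnc xna].
    rewrite nabsM nabsV ler_pdivrMr ?nabs_gt0//.
    apply: le_trans (qM n _ _ x0c xx0) _.
    have xa : r / 8 <= nabs (x - a).
      have := far_from_center x0c xx0; have := nabs_sub_le x a c.
      have := r0; lra.
    apply: le_trans (ler_wpM2l B0 xa).
    rewrite (_ : B * (r / 8) = M / s ^+ n)// /B.
    by field; rewrite ?expf_neq0 ?gt_eqF.
  - by rewrite mulf_neq0.
move=> x0c; have [->|x0nc] := eqVneq x0 c.
  apply/eqP; rewrite -nabs_eq0 eq_le nabs_ge0 andbT; apply/ler_addgt0Pr => e e0.
  have [|t t0 tH] := @cdiff_cont _ f c _ e e0.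
    by apply: df; rewrite subrr nabs0 ltW.
  have [a [_ /tH + fa]] := acc t0.
  by rewrite fa sub0r nabsN add0r => /ltW.
have xc0 : x0 - c != 0 by rewrite subr_eq0.
have key n : nabs (f x0) <= M * (1 / 3) ^+ n.
  have [K [t [t0 tH]]] := P n.
  have H : nabs (f x0 / (x0 - c) ^+ n) <= M / s ^+ n.
    apply: (@max_principle_thin _ (fun x => x - c)
       (fun x => f x / (x - c) ^+ n) x0 (r / 2)) => //.
    - by move=> x _; apply: cdiffB; [exact: cdiff_id|exact: cdiff_cst].
    - by move=> x xx0 xnc; apply: dq => //; exact: inner xx0.
    - move=> x xx0 /eqP; rewrite subr_eq0 => /eqP ->.
      by exists K, t.
    - by exists r => x /(outer x0c).
    - by move=> x /(qM n _ _ x0c).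
  move: H; rewrite nabsM nabsV nabsX ler_pdivrMr ?exprn_gt0 ?nabs_gt0//.
  move=> /le_trans; apply; rewrite -mulrA ler_wpM2l// mulrC -expr_div_n.
  have q3 : nabs (x0 - c) / s <= 1 / 3 by rewrite ler_pdivrMr// /s; lra.
  have q0 : 0 <= nabs (x0 - c) / s by rewrite divr_ge0 ?nabs_ge0// ltW.
  by rewrite lerXn2r// nnegrE; lra.
apply/eqP; rewrite -nabs_eq0 eq_le nabs_ge0 andbT; apply/ler_addgt0Pr => e e0.
have M1 : 0 < M + 1 by rewrite ltr_wpDl.
have [|||n] := @expr_small _ (1 / 3) (e / (M + 1)); [lra|lra|by rewrite divr_gt0|].
rewrite ltr_pdivlMr// add0r => /ltW ne; apply: le_trans (key n.+1) _.
apply: le_trans ne; rewrite mulrC ler_wpM2l ?exprn_ge0//; lra.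
Qed.

End Disc.

(** Zeros that accumulate at [0] fill a disc by [zeros_acc_vanish], hence
    accumulate at a point farther along the segment from 0 to 1. The radius of
    these discs does not shrink, so finitely many steps of length [s] reach 1. *)
Lemma identity_theorem f (rho : R) : 1 < rho ->
  (forall x, nabs x <= rho -> cdiff f x) -> zeros_acc f 0 -> f 1 = 0.
Proof.
move=> rho1 df acc0.
have [M fM] := cdiff_bounded df.
pose r := rho - 1; have r0 : 0 < r by rewrite subr_gt0.
have [N] : exists N, 1 / 2 ^+ N < r / 16 by apply: pow2_small; rewrite ?divr_gt0.
set s := 1 / 2 ^+ N => sr.
have s0 : 0 < s by rewrite /s divr_gt0// exprn_gt0.
have disc k : k%:R * s <= 1 -> zeros_acc f (k%:R * s)%:C ->
    forall x, nabs (x - (k%:R * s)%:C) <= r / 16 -> f x = 0.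
  move=> k1 acck x xk.
  have ins y : nabs (y - (k%:R * s)%:C) <= r -> nabs y <= rho.
    move=> yk; rewrite -[y](subrK (k%:R * s)%:C).
    rewrite (_ : rho = r + 1); last by rewrite /r subrK.
    by rewrite nabsD_le// nabs_pos// mulr_ge0// ltW.
  apply: (@zeros_acc_vanish f (k%:R * s)%:C r M) => //.
  - by move=> y /ins/df.
  - by move=> y /ins/fM.
have acck k : k%:R * s <= 1 -> zeros_acc f (k%:R * s)%:C.
  elim: k => [|k IH] k1; first by rewrite mul0r.
  have k1' : k%:R * s <= 1.
    by apply: le_trans k1; rewrite ler_wpM2r ?(ltW s0)// ler_nat.
  move=> e e0; pose d := Num.min (e / 2) s.
  have d0 : 0 < d by rewrite lt_min s0 divr_gt0.
  have dk (u v : R) : u%:C - v%:C = (u - v)%:C :> R[i] by rewrite rmorphB.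
  exists (k.+1%:R * s - d)%:C; split.
  - by rewrite (inj_eq (@complexI R)) subr_eq addrC -subr_eq subrr lt_eqF.
  - rewrite dk addrAC subrr sub0r nabs_real normrN gtr0_norm//.
    by rewrite gt_min; apply/orP; left; lra.
  - apply: (disc k) => //; first exact: IH.
    rewrite dk (_ : _ - _ = s - d); last by rewrite -natr1; ring.
    rewrite nabs_pos ?subr_ge0 ?ge_min ?lexx ?orbT//.
    by have := ltW sr; have := ltW d0; lra.
have E : (2 ^ N)%:R * s = 1.
  by rewrite /s natrX mul1r divff// expf_neq0// pnatr_eq0.
have := disc (2 ^ N)%N; rewrite E => /(_ (lexx _)); apply.
  by have := acck (2 ^ N)%N; rewrite E; exact.
by rewrite subrr nabs0 divr_ge0// ltW.
Qed.

Lemma isolated_zeros f (rho : R) : 1 < rho ->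
  (forall x, nabs x <= rho -> cdiff f x) -> f 1 != 0 ->
  exists2 e : R, 0 < e & forall a, a != 0 -> nabs a < e -> f a != 0.
Proof.
move=> rho1 df; apply: contraNP => nex; apply/eqP.
apply: (identity_theorem rho1 df) => e e0; apply: contrapT => na.
apply: nex; exists e => // a a0 ae; apply/negP => /eqP fa; apply: na.
by exists a; rewrite subr0.
Qed.

End IdentityTheorem.

(** * Functions holomorphic along complex lines *)

Section LineDifferentiable.
Context {R : realType} {V : normedModType R[i]}.
Implicit Types (h k : V -> R[i]) (z u v : V).

(** With a bound on the modulus this is enough for the estimates of finite
    differences; continuity in all variables is a consequence. *)
Definition ldiff h z := forall v, cdiff (fun t => h (z + t *: v)) 0.

Lemma ldiff_line h z v t : ldiff h (z + t *: v) ->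
  cdiff (fun s => h (z + s *: v)) t.
Proof.
move=> /(_ v) H.
have E : (fun s => h (z + s *: v)) =
    (fun s => (fun x => h (z + t *: v + x *: v)) (- t + 1 * s)).
  by apply/funext => s /=; rewrite mul1r -addrA -scalerDl addrA subrr add0r.
rewrite E; apply: (@cdiff_comp_affine _ (fun x => h (z + t *: v + x *: v))).
by rewrite mul1r addNr; exact: H.
Qed.

Lemma ldiff_shift h z u : ldiff h (z + u) -> ldiff (fun y => h (y + u)) z.
Proof.
move=> H v; have := H v.
have -> : (fun t => h (z + u + t *: v)) = (fun t => h (z + t *: v + u)); last by [].
by apply/funext => t; rewrite addrAC.
Qed.

Lemma ldiffD h k z : ldiff h z -> ldiff k z -> ldiff (fun y => h y + k y) z.
Proof.
by move=> H K v; apply: (cdiffD (f := fun t => h (z + t *: v)) (H v) (K v)).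
Qed.

Lemma ldiffB h k z : ldiff h z -> ldiff k z -> ldiff (fun y => h y - k y) z.
Proof.
by move=> H K v; apply: (cdiffB (f := fun t => h (z + t *: v)) (H v) (K v)).
Qed.

Lemma ldiffM h k z : ldiff h z -> ldiff k z -> ldiff (fun y => h y * k y) z.
Proof.
by move=> H K v; apply: (cdiffM (f := fun t => h (z + t *: v)) (H v) (K v)).
Qed.

Lemma ldiff_cst (a : R[i]) z : ldiff (fun=> a) z.
Proof. by move=> v; exact: cdiff_cst. Qed.

Definition bholo h z (r M : R) :=
  forall y, nabs (y - z) <= r -> ldiff h y /\ nabs (h y) <= M.

Lemma bholo_sub h z z' (r r' M : R) : nabs (z' - z) + r' <= r ->
  bholo h z r M -> bholo h z' r' M.
Proof.
move=> rr H y yz; apply: H; have := nabs_sub_le y z' z; lra.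
Qed.

(** [schwarz] on the complex line through [z] and [z + v]. *)
Lemma bholo_lip h z (r M : R) v : 0 < r -> bholo h z r M ->
  nabs v <= r / 16 -> nabs (h (z + v) - h z) <= 16 * M / r * nabs v.
Proof.
move=> r0 H vr; have [->|v0] := eqVneq v 0.
  by rewrite addr0 subrr !nabs0 mulr0.
have nv : 0 < nabs v by rewrite nabs_gt0.
pose f t := h (z + t *: v).
have ins t : nabs (t - 0) <= r / nabs v -> nabs (z + t *: v - z) <= r.
  by rewrite subr0 addrC addKr nabsZ ler_pdivlMr.
have := @schwarz _ f 0 (r / nabs v) M _ _ _ 1.
rewrite /f subr0 nabs1 mulr1 scale1r scale0r addr0.
have -> : 16 * M / (r / nabs v) = 16 * M / r * nabs v.
  by field; rewrite !gt_eqF.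
apply.
- by rewrite divr_gt0.
- by move=> t /ins/H[] /ldiff_line.
- by move=> t /ins/H[].
- by rewrite mulrAC ler_pdivlMr// mul1r.
Qed.

(** [bholo_lip] twice: the first difference in the direction [u] is again bounded
    and holomorphic, with a bound proportional to [nabs u]. *)
Lemma bholo_second h z (r M : R) u v : 0 < r -> bholo h z r M ->
  nabs u <= r / 32 -> nabs v <= r / 32 ->
  nabs (h (z + v + u) - h (z + v) - (h (z + u) - h z)) <=
  M * (32 / r) ^+ 2 * (nabs u * nabs v).
Proof.
move=> r0 H ur vr.
have H' : bholo (fun y => h (y + u) - h y) z (r / 2) (32 * M / r * nabs u).
  move=> y yz; split.
    apply: ldiffB; last by apply: (H _ _).1; lra.
    apply: ldiff_shift; apply: (H _ _).1.
    have := nabsD_le (lexx (nabs (y - z))) ur; rewrite addrAC; lra.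
  have Hy : bholo h y (r / 2) M by apply: bholo_sub H; lra.
  apply: le_trans (bholo_lip _ Hy _) _; [lra|lra|].
  rewrite le_eqVlt; apply/orP; left; apply/eqP; field; by rewrite gt_eqF.
apply: le_trans (bholo_lip _ H' _) _; [lra|lra|].
rewrite le_eqVlt; apply/orP; left; apply/eqP; field; by rewrite gt_eqF.
Qed.

(** Along the line, [D t] is approximated by dyadic refinement: [bholo_second]
    with equal increments bounds [D t - 2 * D (t / 2)], and these bounds sum up
    geometrically. Thus [D t] differs from [t * A] by a quadratic term, where
    [A] is the derivative, and this is used for the parameters [a] and 1. *)
Lemma bholo_homog h z (r M : R) (a : R[i]) v : 0 < r -> bholo h z r M ->
  nabs v <= r / 32 -> nabs (a *: v) <= r / 32 ->
  nabs (h (z + a *: v) - h z - a * (h (z + v) - h z)) <=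
  M * (32 / r) ^+ 2 * ((nabs a + nabs a ^+ 2) * nabs v ^+ 2).
Proof.
move=> r0 H vr avr.
set K := M * (32 / r) ^+ 2.
have M0 : 0 <= M.
  by apply: le_trans (nabs_ge0 (h z)) (H _ _).2; rewrite subrr nabs0 ltW.
have K0 : 0 <= K by rewrite /K mulr_ge0// sqr_ge0.
pose D t := h (z + t *: v) - h z.
have D2 t : nabs (t *: v) <= r / 32 ->
    nabs (D t - 2 * D (t / 2)) <= K * nabs (t *: v) ^+ 2 / 4.
  move=> tr; pose u := (t / 2) *: v.
  have uE : nabs u = nabs (t *: v) / 2 by rewrite /u !nabsZ nabs_half mulrAC.
  have ur : nabs u <= r / 32 by rewrite uE; have := nabs_ge0 (t *: v); lra.
  have := bholo_second r0 H ur ur; rewrite -/K uE.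
  have -> : z + u + u = z + t *: v.
    by rewrite -addrA -scalerDl; congr (_ + _ *: _); field.
  have -> : h (z + t *: v) - h (z + u) - (h (z + u) - h z) = D t - 2 * D (t / 2).
    by rewrite /D -/u; ring.
  by move=> /le_trans; apply; rewrite le_eqVlt; apply/orP; left; apply/eqP; field.
have D2n t n : nabs (t *: v) <= r / 32 ->
    nabs (D t - 2 ^+ n * D (t / 2 ^+ n)) <= K * nabs (t *: v) ^+ 2 * (1 - 1 / 2 ^+ n).
  move=> tr; elim: n => [|n IH].
    by rewrite !expr0 mul1r !divr1 !subrr nabs0 mulr0.
  have pow : (2 : R) ^+ n != 0 by rewrite expf_neq0 ?pnatr_eq0.
  have powC : (2 : R[i]) ^+ n != 0 by rewrite expf_neq0 ?pnatr_eq0.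
  have p0 : 0 < (2 : R) ^+ n by rewrite exprn_gt0.
  have n2 : nabs ((2 : R[i]) ^+ n) = 2 ^+ n.
    by rewrite nabsX (_ : (2 : R[i]) = 2%:C) ?nabs_pos// rmorph_nat.
  have E : nabs ((t / 2 ^+ n) *: v) = nabs (t *: v) / 2 ^+ n.
    by rewrite !nabsZ nabs_pow2 mulrAC.
  have := D2 (t / 2 ^+ n); rewrite E.
  have sm : nabs (t *: v) / 2 ^+ n <= nabs (t *: v).
    by rewrite ler_pdivrMr// ler_peMr ?nabs_ge0// -natrX ler1n expn_gt0.
  move=> /(_ (le_trans sm tr)) H2.
  rewrite (_ : D t - _ = (D t - 2 ^+ n * D (t / 2 ^+ n)) +
     2 ^+ n * (D (t / 2 ^+ n) - 2 * D (t / 2 ^+ n / 2))); last first.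
    by rewrite exprSr invfM mulrA; ring.
  apply: le_trans (nabsD _ _) _; rewrite nabsM n2.
  apply: le_trans (lerD IH (ler_wpM2l (ltW p0) H2)) _.
  set x := K * nabs (t *: v) ^+ 2.
  have x0 : 0 <= x by rewrite mulr_ge0 ?exprn_ge0 ?nabs_ge0.
  rewrite (_ : _ + _ = x * (1 - 3 / 4 / 2 ^+ n)); last by rewrite /x; field.
  rewrite ler_wpM2l// lerB// exprSr.
  rewrite (_ : 1 / (2 ^+ n * 2) = 1 / 2 / 2 ^+ n); last by field.
  by rewrite ler_wpM2r ?invr_ge0 ?ltW//; lra.
have [A HA] : exists A, forall t, nabs (t *: v) <= r / 32 ->
    nabs (D t - t * A) <= K * nabs (t *: v) ^+ 2.
  have /(_ v)/cdiffP[A HA] : ldiff h z.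
    by apply: (H _ _).1; rewrite subrr nabs0 ltW.
  exists A => t tr; apply/ler_addgt0Pr => e e0.
  have e1 : 0 < e / (nabs t + 1) by rewrite divr_gt0// ltr_wpDl ?nabs_ge0.
  have [s s0 sH] := HA _ e1.
  have [n nt] := pow2_small (nabs_ge0 t) s0.
  have := sH (t / 2 ^+ n); rewrite !subr0 nabs_pow2 => /(_ nt).
  rewrite scale0r addr0 -/(D _) => H1.
  have p0 : 0 < (2 : R) ^+ n by rewrite exprn_gt0.
  have n2 : nabs ((2 : R[i]) ^+ n) = 2 ^+ n.
    by rewrite nabsX (_ : (2 : R[i]) = 2%:C) ?nabs_pos// rmorph_nat.
  have powC : (2 : R[i]) ^+ n != 0 by rewrite expf_neq0 ?pnatr_eq0.
  rewrite (_ : D t - t * A = (D t - 2 ^+ n * D (t / 2 ^+ n)) +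
     2 ^+ n * (D (t / 2 ^+ n) - A * (t / 2 ^+ n))); last by field.
  apply: nabsD_le.
    apply: le_trans (D2n t n tr) _.
    have X0 : 0 <= K * nabs (t *: v) ^+ 2 by rewrite mulr_ge0// sqr_ge0.
    by rewrite -[leRHS]mulr1 ler_wpM2l// gerBl divr_ge0// ltW.
  rewrite nabsM n2; apply: le_trans (ler_wpM2l (ltW p0) H1) _.
  rewrite (_ : 2 ^+ n * _ = e * (nabs t / (nabs t + 1))); last first.
    have m0 : nabs t + 1 != 0 by rewrite gt_eqF// ltr_wpDl ?nabs_ge0.
    have := lt0r_neq0 p0; set q := 2 ^+ n => q0.
    by field; rewrite ?m0 ?q0.
  by rewrite ler_piMr ?(ltW e0)// ler_pdivrMr ?ltr_wpDl ?nabs_ge0// mul1r lerDl.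
have := HA a avr; have := HA 1; rewrite scale1r mul1r => /(_ vr) H1 Ha.
rewrite (_ : _ - _ = (D a - a * A) - a * (D 1 - A)); last first.
  by rewrite /D scale1r; ring.
apply: le_trans (nabsB_le Ha (_ : _ <= nabs a * (K * nabs v ^+ 2))) _.
  by rewrite nabsM ler_wpM2l ?nabs_ge0.
by rewrite nabsZ le_eqVlt; apply/orP; left; apply/eqP; ring.
Qed.

End LineDifferentiable.

(** * Finite differences and norming families *)

Section FiniteDifferences.
Context {R : realType} {V : normedModType R[i]}.
Implicit Types (z u v : V) (s : seq (R[i] * V)).

Definition comb (E : lmodType R[i]) (f : V -> E) s z : E :=
  \sum_(p <- s) p.1 *: f (z + p.2).

(** The finite differences that express holomorphy: the first difference, the
    mixed second difference, and the defect of complex homogeneity of the first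
    difference. A test is a list of coefficients and displacements, with the
    size which the combination must have up to a constant. As only finitely
    many values occur, such estimates pass to pointwise limits. *)
Inductive test : seq (R[i] * V) -> R -> Prop :=
| test_lip v : test [:: (1, v); (-1, 0)] (nabs v)
| test_add u v :
    test [:: (1, v + u); (-1, v); (-1, u); (1, 0)] (nabs u * nabs v)
| test_homog a v : test [:: (1, a *: v); (-1, 0); (- a, v); (a, 0)]
    ((nabs a + nabs a ^+ 2) * nabs v ^+ 2).

Section Comb.
Context {E : lmodType R[i]}.
Implicit Types f : V -> E.

Lemma comb_lip f z v : comb f [:: (1, v); (-1, 0)] z = f (z + v) - f z.
Proof. by rewrite /comb !big_cons big_nil/= scale1r scaleN1r !addr0. Qed.

Lemma comb_add f z u v : comb f [:: (1, v + u); (-1, v); (-1, u); (1, 0)] z =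
  f (z + v + u) - f (z + v) - (f (z + u) - f z).
Proof.
rewrite /comb !big_cons big_nil/= !scale1r !scaleN1r !addr0 opprB !addrA.
by rewrite -!addrA; congr (_ + (_ + _)); rewrite addrC.
Qed.

Lemma comb_homog f z a v :
  comb f [:: (1, a *: v); (-1, 0); (- a, v); (a, 0)] z =
  f (z + a *: v) - f z - a *: (f (z + v) - f z).
Proof.
rewrite /comb !big_cons big_nil/= scale1r scaleN1r !addr0 scaleNr scalerBr.
by rewrite opprB -!addrA; congr (_ + (_ + _)); rewrite addrC.
Qed.

Lemma comb_linear (u : {linear E -> R[i]^o}) f s z :
  u (comb f s z) = comb (u \o f : V -> R[i]^o) s z.
Proof. by rewrite /comb linear_sum; apply: eq_bigr => p _; rewrite linearZ. Qed.

End Comb.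

Lemma comb_dist (h k : V -> R[i]^o) s z (e : R) :
  (forall p, p \in s -> nabs (h (z + p.2) - k (z + p.2)) <= e) ->
  nabs (comb h s z - comb k s z) <= (\sum_(p <- s) nabs p.1) * e.
Proof.
rewrite /comb; elim: s => [|p s IH] hk.
  by rewrite !big_nil subrr nabs0 mul0r.
rewrite !big_cons mulrDl.
have -> (a b c t : R[i]^o) : a + b - (c + t) = (a - c) + (b - t).
  by rewrite opprD addrACA.
apply: nabsD_le; last by apply: IH => q qs; apply: hk; rewrite inE qs orbT.
by rewrite -scalerBr nabsZ ler_wpM2l ?nabs_ge0// hk// mem_head.
Qed.

Lemma comb_norm_le (h : V -> R[i]^o) s z (M : R) :
  (forall p, p \in s -> nabs (h (z + p.2)) <= M) ->
  nabs (comb h s z) <= (\sum_(p <- s) nabs p.1) * M.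
Proof.
move=> hM; have := @comb_dist h (fun=> 0) s z M.
rewrite {2}/comb big1 ?subr0; last by move=> p _; rewrite scaler0.
by apply => p ps; rewrite subr0 hM.
Qed.

Lemma test_ge0 s k : test s k -> 0 <= k.
Proof. by case=> *; rewrite ?mulr_ge0 ?addr_ge0 ?exprn_ge0 ?nabs_ge0. Qed.

(** The three local estimates with one constant. The margin [r / 128] leaves room
    for the balls of radius [r / 2] in which they are applied. *)
Lemma bholo_test (h : V -> R[i]) x (r M : R) s k z :
  0 < r -> bholo h x r M -> test s k ->
  (forall p, p \in s -> nabs (z + p.2 - x) <= r / 128) ->
  nabs (comb (h : V -> R[i]^o) s z) <= (M * (64 / r) ^+ 2 + M * (64 / r)) * k.
Proof.
move=> r0 H t.
have M0 : 0 <= M.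
  by apply: le_trans (nabs_ge0 (h x)) (H _ _).2; rewrite subrr nabs0 ltW.
have r2 : 0 < r / 2 by rewrite divr_gt0.
have B y : nabs (y - x) <= r / 128 -> bholo h y (r / 2) M.
  move=> yx; apply: bholo_sub H; lra.
have sm y v : nabs (y - x) <= r / 128 -> nabs (y + v - x) <= r / 128 ->
    nabs v <= r / 2 / 32.
  move=> y1 y2; have := nabsB_le y2 y1.
  rewrite (_ : y + v - x - (y - x) = v); first lra.
  by rewrite opprB addrA subrK addrC addKr.
have C1 : M * (64 / r) <= M * (64 / r) ^+ 2 + M * (64 / r).
  by rewrite lerDr mulr_ge0// sqr_ge0.
have C2 : M * (64 / r) ^+ 2 <= M * (64 / r) ^+ 2 + M * (64 / r).
  by rewrite lerDl mulr_ge0// divr_ge0// ltW.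
have r64 : 32 / (r / 2) = 64 / r by field; rewrite gt_eqF.
have z0 (w : V) : z + 0 = z by rewrite addr0.
have := test_ge0 t; case: t => [v|u v|a v] k0 H1.
- have zx : nabs (z - x) <= r / 128 by rewrite -(addr0 z) (H1 (-1, 0))// !inE eqxx orbT.
  have vx : nabs (z + v - x) <= r / 128 by rewrite (H1 (1, v))// !inE eqxx.
  rewrite comb_lip; have vr := sm _ _ zx vx.
  apply: le_trans (bholo_lip r2 (B _ zx) _) _; first lra.
  rewrite ler_wpM2r// (le_trans _ C1)//.
  rewrite (_ : 16 * M / (r / 2) = M * (32 / r)); last by field; rewrite gt_eqF.
  by rewrite ler_wpM2l// ler_wpM2r ?invr_ge0 ?(ltW r0)//; lra.
- have zx : nabs (z - x) <= r / 128.
    by rewrite -(addr0 z) (H1 (1, 0))// !inE eqxx !orbT.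
  have vx : nabs (z + v - x) <= r / 128 by rewrite (H1 (-1, v))// !inE eqxx !orbT.
  have ux : nabs (z + u - x) <= r / 128 by rewrite (H1 (-1, u))// !inE eqxx !orbT.
  rewrite comb_add; have vr := sm _ _ zx vx; have ur := sm _ _ zx ux.
  apply: le_trans (bholo_second r2 (B _ zx) ur vr) _.
  by rewrite ler_wpM2r// r64.
- have zx : nabs (z - x) <= r / 128.
    by rewrite -(addr0 z) (H1 (-1, 0))// !inE eqxx !orbT.
  have vx : nabs (z + v - x) <= r / 128 by rewrite (H1 (- a, v))// !inE eqxx !orbT.
  have ux : nabs (z + a *: v - x) <= r / 128.
    by rewrite (H1 (1, a *: v))// !inE eqxx.
  rewrite comb_homog; have vr := sm _ _ zx vx; have ur := sm _ _ zx ux.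
  apply: le_trans (bholo_homog r2 (B _ zx) vr ur) _.
  by rewrite ler_wpM2r// r64.
Qed.

End FiniteDifferences.

Section Norming.
Context {R : realType} {V : normedModType R[i]} {E : tvsType R[i]}.
Implicit Types (T : set (E -> R[i]^o)) (f F : V -> E).

Definition tle T (x : E) (c : R) := forall u, T u -> nabs (u x) <= c.

(** The seminorm defined by the supremum over [T] is complete and induces a
    topology finer than that of [E]. In applications [T] is the polar of a
    bounded set [B], the seminorm is finite on the span of the bipolar of [B],
    and may be infinite elsewhere. *)
Definition norming T := [/\ T `<=` dual E,
  forall U : set E, nbhs 0 U ->
    exists2 c : R, 0 < c & forall x, tle T x c -> U x &
  forall x : nat -> E,
    (forall e : R, 0 < e -> exists N, forall m n, (N <= m)%N -> (N <= n)%N ->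
      tle T (x m - x n) e) ->
    exists l, forall e : R, 0 < e -> exists N, forall n, (N <= n)%N ->
      tle T (x n - l) e].

(** Regularity on [S]: all tests hold with the constant [C], uniformly for the
    functionals in [T]. This replaces holomorphy, because it is inherited by
    pointwise limits and by extension from dense sets. *)
Definition reg T F (S : set V) (C : R) := forall s (k : R) (z : V), test s k ->
  (forall p, p \in s -> S (z + p.2)) -> tle T (comb F s z) (C * k).

Lemma dual_lin (u : E -> R[i]^o) : dual E u ->
  exists w : {linear E -> R[i]^o}, u = w.
Proof.
move=> [lu _].
pose a := GRing.isLinear.Build R[i] E R[i]^o *:%R u lu.
by exists (HB.pack_for {linear E -> R[i]^o} u a).
Qed.

Section Tle.
Variables (T : set (E -> R[i]^o)) (TE : T `<=` dual E).
Implicit Types x y : E.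

Lemma tleD x y (a b : R) : tle T x a -> tle T y b -> tle T (x + y) (a + b).
Proof.
move=> xa yb u Tu; have [w uw] := dual_lin (TE Tu).
by rewrite uw linearD nabsD_le// -uw; [exact: xa|exact: yb].
Qed.

Lemma tleZ x (a : R) (c : R[i]) : tle T x a -> tle T (c *: x) (nabs c * a).
Proof.
move=> xa u Tu; have [w uw] := dual_lin (TE Tu).
by rewrite uw linearZ nabsZ ler_wpM2l ?nabs_ge0// -uw; exact: xa.
Qed.

Lemma tleN x (a : R) : tle T x a -> tle T (- x) a.
Proof. by move=> /(tleZ (-1)); rewrite scaleN1r nabsN nabs1 mul1r. Qed.

Lemma tle_trans x (a b : R) : tle T x a -> a <= b -> tle T x b.
Proof. by move=> xa ab u /xa /le_trans; apply. Qed.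

Lemma tle_lim x (a : R) : (forall e : R, 0 < e -> tle T x (a + e)) -> tle T x a.
Proof. by move=> H u Tu; apply/ler_addgt0Pr => e e0; exact: H. Qed.

End Tle.

Lemma tle_eq0 T x : hausdorff_space E -> norming T ->
  (forall e : R, 0 < e -> tle T x e) -> x = 0.
Proof.
move=> hE [_ T1 _] H; apply: hE => A B /= Ax B0.
have [W W0 WA] : exists2 W, nbhs (0 : E) W & forall y, W y -> A (x - y).
  exists (fun y => A (x - y)) => //.
  have : (x - y) @[y --> (0 : E)] --> x.
    rewrite -[X in _ --> X]subr0.
    by apply: (@continuous_comp _ _ _ (fun y => (x, y)) (fun p : E * E => p.1 - p.2));
      [apply: cvg_pair; [exact: cvg_cst|exact: cvg_id]|exact: sub_continuous].
  by apply.
have [c c0 cW] := T1 _ W0.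
exists 0; split; last exact: nbhs_singleton.
by rewrite -(subrr x); apply: WA; apply: cW; exact: H.
Qed.

End Norming.

(** * Derivatives and extensions of regular functions *)

Lemma nat_max4 (a b c d : nat) :
  exists m, [/\ (a <= m)%N, (b <= m)%N, (c <= m)%N & (d <= m)%N].
Proof. by exists (a + b + c + d)%N; split; lia. Qed.

Section Derivative.
Context {R : realType} {V : normedModType R[i]} {E : tvsType R[i]}.
Hypothesis hE : hausdorff_space E.
Variable T : set (E -> R[i]^o).
Hypothesis nT : norming T.
Implicit Types (F f : V -> E) (z u v w : V).

Let TE : T `<=` dual E. Proof. by case: nT. Qed.

Section Scalarize.
Variable w : {linear E -> R[i]^o}.
Implicit Types x y : E.
Lemma wD x y : (w (x + y) : R[i]) = (w x : R[i]) + w y. Proof. exact: linearD. Qed.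
Lemma wB x y : (w (x - y) : R[i]) = (w x : R[i]) - w y. Proof. exact: linearB. Qed.
Lemma wN x : (w (- x) : R[i]) = - (w x : R[i]). Proof. exact: linearN. Qed.
Lemma wZ (a : R[i]) x : (w (a *: x) : R[i]) = a * w x. Proof. exact: linearZ. Qed.
End Scalarize.
Definition wE := (wB, wD, wN, wZ).

(** Identities between vectors are checked on functionals, where they become
    identities of complex numbers. *)
Lemma tle_eq x y (c : R) : (forall w : {linear E -> R[i]^o}, w x = w y :> R[i]) ->
  tle T x c -> tle T y c.
Proof.
by move=> xy H u Tu; have [w uw] := dual_lin (TE Tu); rewrite uw -xy -uw H.
Qed.

Lemma tle_conv x y (b c : R) : tle T x b ->
  (forall w : {linear E -> R[i]^o}, w x = w y :> R[i]) -> b <= c -> tle T y c.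
Proof. by move=> xb xy bc; apply: tle_trans bc; exact: tle_eq xy xb. Qed.

Lemma norming_cvg (x : nat -> E) l :
  (forall e : R, 0 < e -> exists N, forall n, (N <= n)%N -> tle T (x n - l) e) ->
  x @ \oo --> l.
Proof.
move=> xl U Ul.
have W0 : nbhs (0 : E) (fun y => U (y + l)).
  have : (y + l) @[y --> (0 : E)] --> l.
    rewrite -[X in _ --> X]add0r.
    by apply: (@continuous_comp _ _ _ (fun y => (y, l)) (fun p : E * E => p.1 + p.2));
      [apply: cvg_pair; [exact: cvg_id|exact: cvg_cst]|exact: add_continuous].
  by apply.
have [_ T1 _] := nT; have [c c0 cW] := T1 _ W0.
have [N HN] := xl _ c0; exists N => // n Nn.
by rewrite /= -[x n](subrK l); apply: cW; exact: HN.
Qed.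

(** Dyadic difference quotients suffice to define the directional derivative. *)
Definition quot F (z v : V) n : E :=
  (2 : R[i]) ^+ n *: (F (z + (2 : R[i]) ^- n *: v) - F z).

Definition dlim F (z v : V) : E := xget 0 [set l | quot F z v @ \oo --> l].

Lemma dlim_cvg F z v l : quot F z v @ \oo --> l -> dlim F z v = l.
Proof. move=> H; apply: xget_unique => // y yl.
exact: (@cvg_unique E hE (quot F z v @ \oo) _ y l yl H). Qed.

Lemma nabs_2X n : nabs ((2 : R[i]) ^+ n) = 2 ^+ n.
Proof. by rewrite nabsX (_ : (2 : R[i]) = 2%:C) ?nabs_pos// rmorph_nat. Qed.

Lemma quotD F z v m n : quot F z v (m + n) = 2 ^+ m *: quot F z ((2 : R[i]) ^- m *: v) n.
Proof. by rewrite /quot !scalerA exprD invfM [_^-1 * _]mulrC. Qed.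

Variables (F : V -> E) (z0 : V) (r C : R).
Hypothesis (C0 : 0 <= C).
Hypothesis (regF : reg T F [set y | nabs (y - z0) < r] C).

Let ball_in z v : nabs (z - z0) + nabs v < r -> nabs (z + v - z0) < r.
Proof. by apply: le_lt_trans; rewrite addrAC nabsD. Qed.

Let p0 n : 0 < (2 : R) ^+ n. Proof. by rewrite exprn_gt0. Qed.
Let pC n : (2 : R[i]) ^+ n != 0. Proof. by rewrite expf_neq0// pnatr_eq0. Qed.

Lemma nabs_shrink n (v : V) : nabs ((2 : R[i]) ^- n *: v) = nabs v / 2 ^+ n.
Proof. by rewrite nabsZ nabsV nabs_2X mulrC. Qed.

Let shrink_le n (v : V) : nabs v / 2 ^+ n <= nabs v.
Proof. by rewrite ler_pdivrMr// ler_peMr ?nabs_ge0// -natrX ler1n expn_gt0. Qed.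

Lemma reg_lip z w : nabs (z - z0) < r -> nabs (w - z0) < r ->
  tle T (F w - F z) (C * nabs (w - z)).
Proof.
move=> zr wr; have := regF (z := z) (test_lip (w - z)).
rewrite comb_lip [z + _]addrC subrK; apply=> p; rewrite !inE => /orP[]/eqP-> /=.
  by rewrite [z + _]addrC subrK.
by rewrite addr0.
Qed.

Lemma reg_add z u v : nabs (z - z0) + (nabs u + nabs v) < r ->
  tle T (F (z + v + u) - F (z + v) - (F (z + u) - F z)) (C * (nabs u * nabs v)).
Proof.
move=> zr; rewrite -comb_add; apply: regF; first exact: test_add.
have u0 := nabs_ge0 u; have v0 := nabs_ge0 v.
move=> p; rewrite !inE => /or4P[]/eqP-> /=; apply: ball_in; rewrite ?nabs0; try lra.
by have := nabsD v u; lra.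
Qed.

Lemma reg_homog z a v : nabs (z - z0) + nabs v < r ->
  nabs (z - z0) + nabs (a *: v) < r ->
  tle T (F (z + a *: v) - F z - a *: (F (z + v) - F z))
    (C * ((nabs a + nabs a ^+ 2) * nabs v ^+ 2)).
Proof.
move=> zr zar; rewrite -comb_homog; apply: regF; first exact: test_homog.
have v0 := nabs_ge0 v.
move=> p; rewrite !inE => /or4P[]/eqP-> /=; apply: ball_in; rewrite ?nabs0//; lra.
Qed.

(** The homogeneity test with the parameter [2 ^- n] compares the difference
    quotient with the full increment. *)
Lemma quot_near z v n : nabs (z - z0) + nabs v < r ->
  tle T (quot F z v n - (F (z + v) - F z)) (2 * C * nabs v ^+ 2).
Proof.
move=> zr.
have zr' : nabs (z - z0) + nabs ((2 : R[i]) ^- n *: v) < r.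
  by rewrite nabs_shrink; apply: le_lt_trans zr; rewrite lerD2l.
have := tleZ TE (2 ^+ n) (reg_homog zr zr').
rewrite scalerBr scalerA divff// scale1r -/(quot F z v n) => H.
apply: tle_trans H _; rewrite nabs_2X nabsV nabs_2X.
rewrite (_ : _ * _ = C * nabs v ^+ 2 * (1 + (2 ^+ n)^-1)); last first.
  by field; rewrite gt_eqF.
rewrite [leRHS](_ : _ = C * nabs v ^+ 2 * 2); last by ring.
rewrite ler_wpM2l ?mulr_ge0 ?exprn_ge0 ?nabs_ge0//.
rewrite [leRHS](_ : 2 = 1 + 1)// lerD2l invf_le1//.
by rewrite -natrX ler1n expn_gt0.
Qed.

Lemma quot_cauchy z v m n : nabs (z - z0) + nabs v / 2 ^+ m < r ->
  tle T (quot F z v (m + n) - quot F z v m) (2 * C * nabs v ^+ 2 / 2 ^+ m).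
Proof.
rewrite -nabs_shrink => zr; rewrite quotD.
have := tleZ TE (2 ^+ m) (quot_near n zr); rewrite scalerBr -/(quot F z v m).
move=> /tle_trans; apply; rewrite nabs_2X nabs_shrink.
by rewrite le_eqVlt; apply/orP; left; apply/eqP; field; rewrite gt_eqF.
Qed.

Lemma shrink_in z v : nabs (z - z0) < r ->
  exists m, nabs (z - z0) + nabs v / 2 ^+ m < r.
Proof.
rewrite -subr_gt0 => zr; have [m] := pow2_small (nabs_ge0 v) zr.
by exists m; lra.
Qed.

Let shrink_mono z v m n : (m <= n)%N -> nabs (z - z0) + nabs v / 2 ^+ m < r ->
  nabs (z - z0) + nabs v / 2 ^+ n < r.
Proof.
move=> mn; apply: le_lt_trans; rewrite lerD2l ler_wpM2l ?nabs_ge0//.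
by rewrite lef_pV2 ?posrE// ler_weXn2l// ler1n.
Qed.

(** By [quot_cauchy] the quotients form a Cauchy sequence for the seminorm of
    [T], which is complete; the estimate passes to the limit. *)
Lemma dlimP z v m : nabs (z - z0) + nabs v / 2 ^+ m < r ->
  tle T (quot F z v m - dlim F z v) (2 * C * nabs v ^+ 2 / 2 ^+ m).
Proof.
move=> zr; have [_ _ T2] := nT.
have K0 : 0 <= 2 * C * nabs v ^+ 2 by rewrite !mulr_ge0// ?exprn_ge0 ?nabs_ge0.
have [|l Hl] := T2 (quot F z v).
  move=> e e0; have [k Hk] := pow2_small K0 (divr_gt0 e0 (ltr0Sn _ 1)).
  have zk : nabs (z - z0) + nabs v / 2 ^+ (m + k) < r.
    by apply: shrink_mono zr; rewrite leq_addr.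
  have kk : 2 * C * nabs v ^+ 2 / 2 ^+ (m + k) <= e / 2.
    apply: le_trans (ltW Hk); rewrite ler_wpM2l// lef_pV2 ?posrE//.
    by rewrite ler_weXn2l ?ler1n// leq_addl.
  exists (m + k)%N => a b ma mb.
  have H1 := quot_cauchy (a - (m + k)) zk; have H2 := quot_cauchy (b - (m + k)) zk.
  rewrite !subnKC// in H1 H2.
  have := tleD TE H1 (tleN TE H2); rewrite opprB addrA subrK => /tle_trans; apply.
  lra.
suff -> : dlim F z v = l.
  apply: tle_lim => e e0; have [N HN] := Hl _ e0.
  have := tleD TE (tleN TE (quot_cauchy N zr)) (HN _ (leq_addl m N)).
  by rewrite opprB addrA subrK.
by apply: dlim_cvg; apply: norming_cvg.
Qed.

Lemma dlim_taylor z v : nabs (z - z0) + nabs v < r ->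
  tle T (F (z + v) - F z - dlim F z v) (2 * C * nabs v ^+ 2).
Proof.
move=> zr; have := @dlimP z v 0.
by rewrite /quot !expr0 !invr1 !scale1r !mulr1; exact.
Qed.

Lemma dlim_eq z v l (K : R) : nabs (z - z0) < r -> 0 <= K ->
  (exists m0, forall m, (m0 <= m)%N -> tle T (quot F z v m - l) (K / 2 ^+ m)) ->
  dlim F z v = l.
Proof.
move=> zr K0 [m0 H]; apply: dlim_cvg; apply: norming_cvg => e e0.
have [k Hk] := pow2_small K0 e0; exists (maxn m0 k) => n.
rewrite geq_max => /andP[m0n kn]; apply: tle_trans (H _ m0n) _.
apply: le_trans (ltW Hk); rewrite ler_wpM2l// lef_pV2 ?posrE//.
by rewrite ler_weXn2l ?ler1n.
Qed.

(** The mixed second difference bounds the defect of additivity of the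
    increments by the square of the step, which is negligible after division. *)
Lemma dlimD z u v : nabs (z - z0) < r ->
  dlim F z (u + v) = dlim F z u + dlim F z v.
Proof.
move=> zr; have C2 : 0 <= 2 * C by rewrite mulr_ge0.
apply: (@dlim_eq _ _ _ (C * (nabs v * nabs u) + (2 * C * nabs u ^+ 2 + 2 * C * nabs v ^+ 2))) => //.
  by rewrite !addr_ge0 ?mulr_ge0 ?exprn_ge0 ?nabs_ge0.
have [a Ha] : exists m, nabs (z - z0) + (nabs u + nabs v) / 2 ^+ m < r.
  rewrite -subr_gt0 in zr.
  have [m] := pow2_small (addr_ge0 (nabs_ge0 u) (nabs_ge0 v)) zr.
  by exists m; lra.
exists a => m am.
have Hm : nabs (z - z0) + (nabs v / 2 ^+ m + nabs u / 2 ^+ m) < r.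
  apply: le_lt_trans Ha; rewrite lerD2l -mulrDl [nabs v + _]addrC.
  rewrite ler_wpM2l ?addr_ge0 ?nabs_ge0//.
  by rewrite lef_pV2 ?posrE// ler_weXn2l// ler1n.
have um : nabs (z - z0) + nabs u / 2 ^+ m < r.
  by have := divr_ge0 (nabs_ge0 v) (ltW (p0 m)); lra.
have vm : nabs (z - z0) + nabs v / 2 ^+ m < r.
  by have := divr_ge0 (nabs_ge0 u) (ltW (p0 m)); lra.
have H1 := dlimP um; have H2 := dlimP vm.
rewrite -!nabs_shrink in Hm.
have H3 := tleZ TE (2 ^+ m) (reg_add Hm).
have E0 : quot F z (u + v) m = (2 : R[i]) ^+ m *:
    (F (z + (2 : R[i]) ^- m *: u + (2 : R[i]) ^- m *: v) - F z).
  by rewrite /quot [_ *: (u + v)]scalerDr addrA.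
apply: (tle_conv (tleD TE H3 (tleD TE H1 H2))).
  by move=> w; rewrite E0 /quot !wE; ring.
rewrite nabs_2X !nabs_shrink.
by rewrite le_eqVlt; apply/orP; left; apply/eqP; field; rewrite gt_eqF.
Qed.

(** The homogeneity test, applied to the shrunk increments. *)
Lemma dlimZ z a v : nabs (z - z0) < r -> dlim F z (a *: v) = a *: dlim F z v.
Proof.
move=> zr; have C2 : 0 <= 2 * C by rewrite mulr_ge0.
apply: (@dlim_eq _ _ _ (C * ((nabs a + nabs a ^+ 2) * nabs v ^+ 2) +
   nabs a * (2 * C * nabs v ^+ 2))) => //.
  by rewrite !(addr_ge0, mulr_ge0, exprn_ge0, nabs_ge0).
have [m1 H1] := shrink_in v zr; have [m2 H2] := shrink_in (a *: v) zr.
exists (maxn m1 m2) => m; rewrite geq_max => /andP[m1m m2m].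
have {}H1 := shrink_mono m1m H1; have {}H2 := shrink_mono m2m H2.
have H3 := tleZ TE a (dlimP H1).
rewrite -!nabs_shrink in H1 H2; rewrite scalerA mulrC -scalerA in H2.
have H4 := tleZ TE (2 ^+ m) (reg_homog H1 H2).
have E0 : quot F z (a *: v) m = (2 : R[i]) ^+ m *:
    (F (z + a *: ((2 : R[i]) ^- m *: v)) - F z).
  by rewrite /quot !scalerA [a * _]mulrC.
apply: (tle_conv (tleD TE H4 H3)).
  by move=> w; rewrite E0 /quot !wE; ring.
rewrite nabs_2X !nabs_shrink.
rewrite [leRHS](_ : _ = (C * ((nabs a + nabs a ^+ 2) * nabs v ^+ 2)) / 2 ^+ m +
   nabs a * (2 * C * nabs v ^+ 2 / 2 ^+ m)); last by ring.
rewrite lerD2r le_eqVlt; apply/orP; left; apply/eqP.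
by field; rewrite gt_eqF.
Qed.

(** The difference of the increments at two points is a mixed second difference,
    so the derivative depends Lipschitz continuously on the point. *)
Lemma dlim_lip z z' v : nabs (z - z0) < r -> nabs (z' - z0) < r ->
  nabs (z - z0) + nabs (z' - z) < r ->
  tle T (dlim F z' v - dlim F z v) (C * (nabs (z' - z) * nabs v)).
Proof.
move=> zr z'r zz'.
have C2 : 0 <= 2 * C by rewrite mulr_ge0.
have K0 : 0 <= 4 * C * nabs v ^+ 2 by exact: mulr_ge0 (mulr_ge0 (ler0n _ 4) C0) (sqr_ge0 _).
apply: tle_lim => e e0.
have [m1 H1] := shrink_in v zr; have [m2 H2] := shrink_in v z'r.
have [m3 H3] : exists m, nabs (z - z0) + nabs (z' - z) + nabs v / 2 ^+ m < r.
  rewrite -subr_gt0 in zz'; have [m] := pow2_small (nabs_ge0 v) zz'.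
  by exists m; lra.
have [m4 H4] := pow2_small K0 e0.
have [m [l1 l2 l3 l4]] := nat_max4 m1 m2 m3 m4.
have dec (K : R) k : 0 <= K -> (k <= m)%N -> K / 2 ^+ m <= K / 2 ^+ k.
  move=> K1 km; rewrite ler_wpM2l// lef_pV2 ?posrE//.
  by rewrite ler_weXn2l ?ler1n.
have {}H1 : nabs (z - z0) + nabs v / 2 ^+ m < r.
  exact: shrink_mono l1 H1.
have {}H2 : nabs (z' - z0) + nabs v / 2 ^+ m < r.
  exact: shrink_mono l2 H2.
have {}H3 : nabs (z - z0) + (nabs (z' - z) + nabs v / 2 ^+ m) < r.
  have := dec _ _ (nabs_ge0 v) l3; rewrite addrA => H5.
  by apply: le_lt_trans H3; rewrite lerD2l.
have {}H4 : 4 * C * nabs v ^+ 2 / 2 ^+ m <= e.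
  exact: le_trans (dec _ _ K0 l4) (ltW H4).
have D1 := dlimP H1; have D2 := dlimP H2.
rewrite -nabs_shrink in H3.
have D3 := tleZ TE (2 ^+ m) (reg_add H3).
apply: (tle_conv (tleD TE D3 (tleD TE D1 (tleN TE D2)))).
  move=> w; have -> : z + (2 : R[i]) ^- m *: v + (z' - z) = z' + (2 : R[i]) ^- m *: v.
    by rewrite addrAC [z + _]addrC subrK.
  by rewrite [z + (z' - z)]addrC subrK /quot !wE; ring.
rewrite nabs_2X nabs_shrink.
rewrite (_ : 2 ^+ m * _ = C * (nabs (z' - z) * nabs v)); last first.
  by field; rewrite gt_eqF.
rewrite lerD2l; apply: le_trans H4.
rewrite le_eqVlt; apply/orP; left; apply/eqP; field; by rewrite gt_eqF.
Qed.

End Derivative.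

Section Extension.
Context {R : realType} {V : normedModType R[i]} {E : tvsType R[i]}.
Hypothesis hE : hausdorff_space E.
Variable T : set (E -> R[i]^o).
Hypothesis nT : norming T.
Implicit Types (z v : V) (S B : set V).

(** The tests involve several translates of one point, which have to be moved
    into [S] by the same small vector; plain density would not provide this. *)
Definition sdense S B := forall z (vs : seq V) (e : R), 0 < e ->
  (forall v, v \in vs -> B (z + v)) ->
  exists2 z', nabs (z' - z) < e & forall v, v \in vs -> S (z' + v).

(** The test for first differences makes [f] Lipschitz for the seminorm of [T],
    so it extends by completeness. Each test for the extension is a limit of
    the same test at a slightly moved point, all of whose translates lie
    in [S]. *)
Lemma reg_extend (f : V -> E) S B (C : R) : 0 <= C -> S `<=` B ->
  sdense S B -> reg T f S C ->
  exists F : V -> E, reg T F B C /\ forall z, S z -> F z = f z.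
Proof.
move=> C0 SB dS rf; have [TE T1 T2] := nT.
have lip y y' : S y -> S y' -> tle T (f y - f y') (C * nabs (y - y')).
  move=> Sy Sy'; have := rf _ _ y' (test_lip (y - y')).
  rewrite comb_lip [y' + _]addrC subrK; apply=> p; rewrite !inE.
  by move=> /orP[]/eqP-> /=; rewrite ?addr0// addrC subrK.
have ex z : exists l, B z -> forall y, S y -> tle T (f y - l) (C * nabs (y - z)).
  have [Bz|nBz] := pselect (B z); last by exists 0.
  have near n : exists y, S y /\ nabs (y - z) < 1 / 2 ^+ n.
    have [||z' z'z /(_ 0)] := dS z [:: 0] (1 / 2 ^+ n).
    - by rewrite divr_gt0// exprn_gt0.
    - by move=> v; rewrite inE => /eqP ->; rewrite addr0.
    by rewrite addr0 mem_head => /(_ isT) Sz'; exists z'.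
  have [y Hy] := choice near.
  have small (e : R) : 0 < e -> exists N, forall n, (N <= n)%N -> C * nabs (y n - z) <= e.
    move=> e0; have [N HN] := pow2_small C0 e0; exists N => n Nn.
    apply: le_trans (ltW HN); apply: ler_wpM2l => //.
    apply: le_trans (ltW (Hy n).2) _; rewrite mul1r.
    by rewrite lef_pV2 ?posrE ?exprn_gt0// ler_weXn2l ?ler1n.
  have [|l Hl] := T2 (f \o y).
    move=> e e0; have [N HN] := small (e / 2) (divr_gt0 e0 (ltr0Sn _ 1)).
    exists N => m n Nm Nn; apply: tle_trans (lip _ _ (Hy m).1 (Hy n).1) _.
    have := nabs_sub_le (y m) z (y n); rewrite [nabs (z - _)]nabsB => H.
    apply: le_trans (ler_wpM2l C0 H) _; rewrite mulrDr (splitr e).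
    by rewrite lerD// HN.
  exists l => _ x Sx; apply: tle_lim => e e0.
  have e2 : 0 < e / 2 by rewrite divr_gt0.
  have [N1 H1] := small _ e2; have [N2 H2] := Hl _ e2.
  have := tleD TE (lip _ _ Sx (Hy (N1 + N2)%N).1) (H2 _ (leq_addl N1 N2)).
  rewrite /= addrA subrK => /tle_trans; apply.
  have := nabs_sub_le x z (y (N1 + N2)%N); rewrite [nabs (z - _)]nabsB => H.
  have := ler_wpM2l C0 H; have := H1 _ (leq_addr N2 N1); rewrite mulrDr; lra.
have [F HF] := choice ex; exists F; split.
- move=> s k z tk Bs; apply: tle_lim => e e0 u Tu.
  have [w uw] := dual_lin (TE _ Tu).
  set A := \sum_(p <- s) nabs p.1.
  have A0 : 0 <= A by apply: sumr_ge0 => p _; exact: nabs_ge0.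
  have AC1 : 0 < A * C + 1 by rewrite ltr_wpDl ?mulr_ge0.
  have e1 : 0 < e / (A * C + 1) by rewrite divr_gt0.
  have [|z' z'z Sz'] := dS z [seq p.2 | p <- s] _ e1.
    by move=> v /mapP[p ps ->]; exact: Bs.
  have Sp p : p \in s -> S (z' + p.2) by move=> ps; apply: Sz'; exact: map_f.
  have H := rf _ _ z' tk Sp _ Tu.
  rewrite uw !comb_linear in H *.
  pose h := (w \o F : V -> R[i]^o); pose h' (y : V) := w (f (y + (z' - z))) : R[i]^o.
  have E1 : comb (w \o f : V -> R[i]^o) s z' = comb h' s z.
    rewrite /comb; apply: eq_bigr => p _; rewrite /h' /=.
    by congr (_ *: w (f _)); rewrite addrAC [z + _]addrC subrK.
  have := @comb_dist _ _ h h' s z (C * nabs (z' - z)) _.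
  rewrite -/A -E1 => H2.
  rewrite -[comb _ s z](subrK (comb (w \o f : V -> R[i]^o) s z')) addrC.
  apply: nabsD_le => //; apply: le_trans (H2 _) _.
    move=> p ps; rewrite nabsB.
    have := HF (z + p.2) (Bs _ ps) (z' + p.2) (Sp _ ps) _ Tu.
    rewrite uw wB (_ : z' + p.2 - (z + p.2) = z' - z); last by rewrite opprD addrACA subrr addr0.
    rewrite /h /h' /= (_ : z + p.2 + (z' - z) = z' + p.2)//.
    by rewrite addrAC [z + (z' - z)]addrC subrK.
  rewrite mulrA; apply: le_trans (ler_wpM2l (mulr_ge0 A0 C0) (ltW z'z)) _.
  by rewrite mulrA ler_pdivrMr// mulrC ler_wpM2l ?(ltW e0)// lerDl.
- move=> z Sz; apply/eqP; rewrite eq_sym -subr_eq0; apply/eqP.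
  apply: (tle_eq0 hE nT) => e e0; apply: tle_trans (HF z (SB _ Sz) z Sz) _.
  by rewrite subrr nabs0 mulr0 ltW.
Qed.

End Extension.

(** * Holomorphy on spaces of row vectors *)

Section RowVectors.
Context {R : realType} {d : nat}.
Implicit Types z v w : 'rV[R[i]]_d.

Lemma enormZ (t : R[i]) v : enorm (t *: v) = nabs t * enorm v.
Proof.
rewrite /enorm -[X in X * _]ger0_norm ?nabs_ge0// -sqrtr_sqr -sqrtrM ?sqr_ge0//.
rewrite mulr_sumr; congr Num.sqrt; apply: eq_bigr => k _.
by rewrite mxE -[complex.Re _]/(nabs (t * v 0 k)) nabsM exprMn.
Qed.

Lemma enorm_ge0 v : 0 <= enorm v. Proof. exact: sqrtr_ge0. Qed.

Lemma nabs_le_enorm v : nabs v <= enorm v.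
Proof.
have [->|v0] := eqVneq v 0; first by rewrite nabs0 enorm_ge0.
have [|[a k] /= E] := @mx_norm_neq0 _ _ _ v.
  by rewrite -[mx_norm v]/(`|v|) normr_eq0.
have -> : nabs v = nabs (v 0 k).
  by rewrite /nabs -[`|v|]/(mx_norm v) E (ord1 a).
rewrite -[leLHS]ger0_norm ?nabs_ge0// -sqrtr_sqr ler_wsqrtr//.
by rewrite (bigD1 k)//= lerDl sumr_ge0// => i _; exact: sqr_ge0.
Qed.

Lemma coord_le_nabs v k : nabs (v 0 k) <= nabs v.
Proof.
rewrite -lecR -!normE -[`|v|]/(mx_norm v) mx_normE.
pose ij : 'I_1 * 'I_d := (0, k).
by rewrite -[v 0 k]/(v ij.1 ij.2) -[leLHS]nngE num_le; exact: le_bigmax.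
Qed.

Lemma enorm_le_nabs v : enorm v <= Num.sqrt d%:R * nabs v.
Proof.
rewrite -[X in _ * X]ger0_norm ?nabs_ge0// -sqrtr_sqr -sqrtrM ?ler0n//.
rewrite ler_wsqrtr//; apply: (@le_trans _ _ (\sum_(k < d) nabs v ^+ 2)).
  apply: ler_sum => k _; rewrite lerXn2r ?nnegrE ?nabs_ge0//.
    exact: (nabs_ge0 (v 0 k)).
  exact: (coord_le_nabs v k).
by rewrite sumr_const card_ord mulr_natl.
Qed.

(** By expansion in the standard basis. *)
Lemma linear_le_nabs (L : {linear 'rV[R[i]]_d -> R[i]^o}) :
  exists2 K : R, 0 <= K & forall v, nabs (L v) <= K * nabs v.
Proof.
exists (\sum_(k < d) nabs (L (delta_mx 0 k))).
  by apply: sumr_ge0 => k _; exact: nabs_ge0.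
move=> v; rewrite {1}(row_sum_delta v) linear_sum mulr_suml.
elim/big_ind2 : _ => [|x a y b xa yb|k _]; first by rewrite nabs0.
  exact: nabsD_le.
by rewrite linearZ nabsZ mulrC ler_wpM2l ?nabs_ge0// coord_le_nabs.
Qed.

Section Holo.
Variables (S : set 'rV[R[i]]_d) (g : 'rV[R[i]]_d -> R[i]^o).
Hypothesis hg : holomorphic_fun S g.
Variable z : 'rV[R[i]]_d.
Hypothesis zS : nbhs z S.

Let taylor : exists L : {linear 'rV[R[i]]_d -> R[i]^o}, forall e : R, 0 < e ->
  exists2 t : R, 0 < t & forall w, nabs (w - z) < t ->
    nabs (g w - g z - L (w - z)) <= e * enorm (w - z).
Proof.
have [df [Hd _]] := hg; exists (df z) => e e0.
have := Hd z (nbhs_singleton zS) (fun y : R[i]^o => nabs y < e).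
have W : nbhs (0 : R[i]^o) (fun y : R[i]^o => nabs y < e).
  by apply/nbhs_nabs; exists e => // y; rewrite subr0.
move=> /(_ W); rewrite /= /within /=.
move=> /nbhs_nabs[t t0 tH]; have /nbhs_nabs[s s0 sH] := zS.
exists (Num.min t s); first by rewrite lt_min t0.
move=> w; rewrite lt_min => /andP[wt ws].
have [->|wz] := eqVneq w z.
  by rewrite !subrr linear0 subr0 nabs0 mulr_ge0 ?enorm_ge0 ?ltW.
have E0 : 0 < enorm (w - z).
  by apply: lt_le_trans (nabs_le_enorm _); rewrite nabs_gt0 subr_eq0.
have := tH w wt wz (sH _ ws).
rewrite /= nabsZ nabs_real ger0_norm ?invr_ge0 ?enorm_ge0// mulrC.
by rewrite ltr_pdivrMr// => /ltW.
Qed.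

Lemma holomorphic_ldiff : ldiff (g : 'rV[R[i]]_d -> R[i]) z.
Proof.
move=> v; have [L HL] := taylor; apply/cdiffP; exists (L v) => e e0.
have e1 : 0 < e / (enorm v + 1) by rewrite divr_gt0// ltr_wpDl ?enorm_ge0.
have [t t0 tH] := HL _ e1.
have v1 : 0 < nabs v + 1 by rewrite ltr_wpDl ?nabs_ge0.
exists (t / (nabs v + 1)); first by rewrite divr_gt0.
move=> x; rewrite subr0 ltr_pdivlMr// => xt; rewrite scale0r addr0.
have := tH (z + x *: v); rewrite [z + _]addrC addrK linearZ.
have -> : L v * x = x * L v by rewrite mulrC.
move=> H; apply: le_trans (H _) _.
  rewrite nabsZ; apply: le_lt_trans xt.
  by rewrite ler_wpM2l ?nabs_ge0// lerDl.
rewrite enormZ mulrCA mulrC ler_wpM2r ?nabs_ge0//.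
rewrite mulrAC ler_pdivrMr ?ltr_wpDl ?enorm_ge0//.
by rewrite ler_wpM2l ?(ltW e0)// lerDl.
Qed.

Lemma holomorphic_cont (e : R) : 0 < e ->
  exists2 t : R, 0 < t & forall w, nabs (w - z) < t -> nabs (g w - g z) < e.
Proof.
move=> e0; have [L HL] := taylor; have [K K0 HK] := linear_le_nabs L.
have [t t0 tH] := HL _ ltr01.
pose M := Num.sqrt d%:R + K + 1 : R.
have M1 : 0 < M by rewrite ltr_wpDl// addr_ge0// sqrtr_ge0.
exists (Num.min t (e / M)); first by rewrite lt_min t0 divr_gt0.
move=> w; rewrite lt_min => /andP[/tH H]; rewrite ltr_pdivlMr// => we.
rewrite -[g w - g z](subrK (L (w - z))); apply: le_lt_trans we.
apply: le_trans (nabsD_le H (HK _)) _; rewrite mul1r.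
have := enorm_le_nabs (w - z); have := nabs_ge0 (w - z).
by rewrite /M; nra.
Qed.

End Holo.

(** The derivative at [z] is the limit [dlim F z] of difference quotients, which
    is linear by [dlimD] and [dlimZ] and exists in [E] itself. The quadratic
    remainder of [dlim_taylor] and the continuity of [dlim_lip] hold for the
    seminorm of [T], hence for the topology of the completion. *)
Lemma reg_holomorphic (E Ehat : tvsType R[i]) (j : {linear E -> Ehat})
    (S : set 'rV[R[i]]_d) (F : 'rV[R[i]]_d -> E) :
  hausdorff_space E ->
  (forall U : set Ehat, nbhs 0 U -> nbhs 0 (j @^-1` U)) ->
  open S ->
  (forall z, S z -> exists T (r C : R), [/\ norming T, 0 < r, 0 <= C &
     reg T F [set y | nabs (y - z) < r] C]) ->
  holomorphic j S F.
Proof.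
move=> hE jc oS loc.
have ex z : exists L : {linear 'rV[R[i]]_d -> Ehat},
    S z -> forall v, L v = j (dlim F z v).
  have [Sz|nSz] := pselect (S z); last by exists \0.
  have [T [r [C [nT r0 C0 rT]]]] := loc _ Sz.
  have zr : nabs (z - z) < r by rewrite subrr nabs0.
  have lin : linear (fun v => j (dlim F z v)).
    move=> a u v; rewrite (dlimD hE nT C0 rT)// (dlimZ hE nT C0 rT)//.
    by rewrite linearD linearZ.
  pose m := GRing.isLinear.Build R[i] 'rV[R[i]]_d Ehat *:%R _ lin.
  by exists (HB.pack_for {linear 'rV[R[i]]_d -> Ehat} (fun v => j (dlim F z v)) m).
have [df Hdf] := choice ex; exists df; split.
- move=> z Sz U U0; have [T [r [C [nT r0 C0 rT]]]] := loc _ Sz.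
  have [TE T1 _] := nT; have [c c0 cU] := T1 _ (jc _ U0).
  have C21 : 0 < 2 * C + 1 by rewrite ltr_wpDl// mulr_ge0.
  apply/nbhs_nabs; exists (Num.min r (c / (2 * C + 1))).
    by rewrite lt_min r0 divr_gt0.
  move=> w; rewrite lt_min => /andP[wr wc] wz Sw.
  rewrite /= (Hdf _ Sz) -!linearB -linearZ; apply: cU.
  have zw : nabs (z - z) + nabs (w - z) < r by rewrite subrr nabs0 add0r.
  have := tleZ TE ((enorm (w - z))^-1%:C) (dlim_taylor hE nT C0 rT zw).
  rewrite [z + (w - z)]addrC subrK => /tle_trans; apply.
  have E0 : 0 < enorm (w - z).
    by apply: lt_le_trans (nabs_le_enorm _); rewrite nabs_gt0 subr_eq0.
  rewrite nabs_real ger0_norm ?invr_ge0 ?enorm_ge0// mulrC ler_pdivrMr//.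
  move: wc; rewrite ltr_pdivlMr// => wc.
  have := nabs_le_enorm (w - z); have := nabs_ge0 (w - z).
  set x := nabs (w - z) in wc *; set y := enorm _ in E0 * => x0 xy.
  have cx : 2 * C * x <= c by apply: le_trans (ltW wc); rewrite mulrC ler_wpM2l// lerDl.
  rewrite expr2 mulrA; apply: ler_pM => //; by rewrite mulr_ge0// mulr_ge0.
- move=> v; apply/subspace_continuousP => z Sz U Uz.
  have [T [r [C [nT r0 C0 rT]]]] := loc _ Sz.
  have W0 : nbhs (0 : Ehat) (fun y => U (y + df z v)).
    have : (y + df z v) @[y --> (0 : Ehat)] --> df z v.
      rewrite -[X in _ --> X]add0r.
      by apply: (@continuous_comp _ _ _ (fun y => (y, df z v)) (fun p : Ehat * Ehat => p.1 + p.2));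
        [apply: cvg_pair; [exact: cvg_id|exact: cvg_cst]|exact: add_continuous].
    by apply.
  have [TE T1 _] := nT; have [c c0 cU] := T1 _ (jc _ W0).
  have K1 : 0 < C * nabs v + 1 by rewrite ltr_wpDl// mulr_ge0 ?nabs_ge0.
  apply/nbhs_nabs; exists (Num.min r (c / (C * nabs v + 1))).
    by rewrite lt_min r0 divr_gt0.
  move=> w; rewrite lt_min => /andP[wr]; rewrite ltr_pdivlMr// => wc Sw.
  change (U (df w v)).
  rewrite -[df w v](subrK (df z v)) {1}(Hdf _ Sz) (Hdf _ Sw) -linearB.
  apply: cU; have zr : nabs (z - z) < r by rewrite subrr nabs0.
  have zw : nabs (z - z) + nabs (w - z) < r by rewrite subrr nabs0 add0r.
  apply: tle_trans (dlim_lip hE nT C0 rT v zr wr zw) _.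
  apply: le_trans (ltW wc); rewrite mulrCA ler_wpM2l ?nabs_ge0//.
  by rewrite lerDl.
Qed.

Lemma norming_scalar : norming [set (idfun : R[i]^o -> R[i]^o)].
Proof.
split.
- move=> _ ->; split; first by move=> a x y.
  by move=> x; exact: cvg_id.
- move=> U /nbhs_nabs[e e0 eU]; exists (e / 2); first by rewrite divr_gt0.
  move=> x /(_ idfun erefl) /= xe; apply: eU; rewrite subr0.
  by apply: le_lt_trans xe _; rewrite ltr_pdivrMr// ltr_pMr// ltr1n.
- move=> x cx; have [|l Hl] := @complex_complete _ x.
    move=> e /cx[N HN]; exists N => m n Nm Nn.
    by have := HN _ _ Nm Nn idfun erefl.
  by exists l => e /Hl[N HN]; exists N => n Nn _ ->; exact: HN.
Qed.

Lemma reg_holomorphic_fun (S : set 'rV[R[i]]_d) (h : 'rV[R[i]]_d -> R[i]^o) :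
  open S ->
  (forall z, S z -> exists r C : R, [/\ 0 < r, 0 <= C &
     reg [set idfun] h [set y | nabs (y - z) < r] C]) ->
  holomorphic_fun S h.
Proof.
move=> oS loc; apply: reg_holomorphic => //.
move=> z /loc[r [C [r0 C0 H]]]; exists [set idfun], r, C; split => //.
exact: norming_scalar.
Qed.

End RowVectors.

(** * Propagation of estimates across a thin set *)

Section Transfer.
Context {R : realType} {V : normedModType R[i]}.
Implicit Types (z v y : V) (h : V -> R[i]).

(** Along the complex line through [z0] with the direction [w], the function [g]
    has no zero near the square of radius 1. The two lemmas below propagate
    information from a neighbourhood of this square to the points near [z0],
    along lines parallel to [w]. *)
Definition good_direction (z0 : V) (D : R) (g : V -> R[i]) (w : V) (e : R) :=
  [/\ 0 < e, 2 * nabs w + 4 * e <= D,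
    forall y, nabs (y - z0) < D -> ldiff g y &
    forall t : R[i], taxi t = 1 -> forall y,
      nabs (y - (z0 + t *: w)) <= 2 * e -> g y != 0].

Variables (z0 : V) (D : R) (g : V -> R[i]) (w : V) (e : R).
Hypothesis good : good_direction z0 D g w e.

Let e0 : 0 < e. Proof. by case: good. Qed.
Let we : 2 * nabs w + 4 * e <= D. Proof. by case: good. Qed.
Let dg y : nabs (y - z0) < D -> ldiff g y. Proof. by case: good => _ _ + _; apply. Qed.
Let gw t y : taxi t = 1 -> nabs (y - (z0 + t *: w)) <= 2 * e -> g y != 0.
Proof. by case: good => _ _ _ H /H; apply. Qed.

Let inD y t : nabs (y - z0) <= e -> nabs t <= 2 -> nabs (y + t *: w - z0) < D.
Proof.
move=> yz t2; rewrite addrAC; apply: le_lt_trans (nabsD _ _) _; rewrite nabsZ.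
have := ler_wpM2r (nabs_ge0 w) t2; have := e0; have := we; lra.
Qed.

(** A product of translates of [g], which keeps all points of a test away from
    the zeros of [g] at once. *)
Let gprod (vs : seq V) y := \prod_(v <- vs) g (y + v).

Let gprod_cdiff vs y (r : R) : r <= 2 -> (forall v, v \in vs -> nabs (y + v - z0) <= e) ->
  forall t, nabs t <= r -> cdiff (fun t => gprod vs (y + t *: w)) t.
Proof.
rewrite /gprod => r2; elim: vs => [|v vs IH] H t tr.
  under eq_fun do rewrite big_nil; exact: cdiff_cst.
under eq_fun do rewrite big_cons; apply: cdiffM; last first.
  by apply: IH => // u us; apply: H; rewrite inE us orbT.
have E : (fun t => g (y + t *: w + v)) = (fun t => g (y + v + t *: w)).
  by apply/funext => s; rewrite addrAC.
rewrite E; apply: ldiff_line; apply: dg; apply: inD; last exact: le_trans r2.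
by apply: H; rewrite mem_head.
Qed.

Let gprod_neq0 vs y : (gprod vs y != 0) = all (fun v => g (y + v) != 0) vs.
Proof.
rewrite /gprod; elim: vs => [|v vs IH] /=; first by rewrite big_nil oner_neq0.
by rewrite big_cons mulf_eq0 negb_or IH.
Qed.

(** On the line through [y] with the direction [w] the product of the translates
    of [g] is not identically zero, so its zeros are isolated there. *)
Lemma good_direction_dense (rho : R) : rho <= e ->
  sdense [set y | nabs (y - z0) < rho /\ g y != 0] [set y | nabs (y - z0) < rho].
Proof.
move=> rhoe y vs b b0 Hvs.
have [r [r0 rvs]] : exists r : R, 0 < r /\ forall v, v \in vs -> nabs (y + v - z0) + r <= rho.
  elim: vs Hvs => [|v vs IH] H; first by exists 1.
  have [|r [r0 Hr]] := IH; first by move=> u us; apply: H; rewrite inE us orbT.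
  exists (Num.min r (rho - nabs (y + v - z0))).
  have := H v (mem_head _ _); rewrite /= => Hv.
  split; first by rewrite lt_min r0 subr_gt0.
  move=> u; rewrite inE => /orP[/eqP ->|/Hr].
    by rewrite addrC -lerBrDr ge_min lexx orbT.
  by move/le_trans : (lexx e) => _ H2; apply: le_trans H2; rewrite lerD2l ge_min lexx.
have Hvs' v : v \in vs -> nabs (y + v - z0) <= e by move=> /Hvs/ltW/le_trans; apply.
have [|||s s0 Hs] := @isolated_zeros _ (fun t => gprod vs (y + t *: w)) 2.
- by rewrite ltr1n.
- exact: gprod_cdiff.
- rewrite gprod_neq0; apply/allP => v vv; rewrite scale1r addrAC.
  apply: (@gw 1); first by rewrite /taxi /= normr1 normr0 addr0.
  by rewrite scale1r opprD addrACA subrr addr0; have := Hvs' _ vv; have := e0; lra.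
pose m := Num.min b r; have m0 : 0 < m by rewrite lt_min b0.
have w1 : 0 < nabs w + 1 by rewrite ltr_wpDl ?nabs_ge0.
pose q := Num.min (s / 2) (m / (nabs w + 1)).
have q0 : 0 < q by rewrite lt_min !divr_gt0.
have qs : q < s.
  by apply: (@le_lt_trans _ _ (s / 2)); [rewrite /q ge_min lexx|lra].
have qw : nabs (q%:C *: w) < m.
  rewrite nabsZ nabs_pos ?(ltW q0)//.
  have : q <= m / (nabs w + 1) by rewrite /q ge_min lexx orbT.
  rewrite ler_pdivlMr// mulrDr mulr1 => H; have := q0; lra.
exists (y + q%:C *: w).
  by rewrite addrC addKr; apply: lt_le_trans qw _; rewrite /m ge_min lexx.
have := Hs q%:C; rewrite nabs_pos ?(ltW q0)// gprod_neq0.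
have -> : q%:C != 0 :> R[i] by rewrite -nabs_gt0 nabs_pos// ltW.
move=> /(_ isT qs)/allP Hg v vv; split; last exact: Hg.
have -> : y + q%:C *: w + v - z0 = (y + v - z0) + q%:C *: w.
  by rewrite -!addrA; congr (_ + _); rewrite [LHS]addrC -addrA.
apply: le_lt_trans (nabsD _ _) _.
have : m <= r by rewrite /m ge_min lexx orbT.
have := rvs _ vv; lra.
Qed.

(** When the parameter of the line runs through the boundary of the square of
    radius 1, the points of the test stay in balls of radius [e] without zeros
    of [g], where [bholo_test] applies. The combination of values of [h] is holomorphic in
    the parameter off the zeros of the product of translates of [g], and
    bounded, so [max_principle_thin] carries the estimate to the parameter 0. *)
Lemma good_direction_reg h (M : R) : 0 <= M ->
  (forall y, nabs (y - z0) < D -> g y != 0 -> ldiff h y /\ nabs (h y) <= M) ->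
  reg [set idfun] (h : V -> R[i]^o)
    [set y | nabs (y - z0) < e / 128 /\ g y != 0]
    (M * (64 / e) ^+ 2 + M * (64 / e)).
Proof.
move=> M0 hM s k z tk Hs _ -> /=.
set C := _ + _.
have e128 : e / 128 <= e by have := e0; lra.
have vs_in v : v \in [seq p.2 | p <- s] -> nabs (z + v - z0) <= e.
  move=> /mapP[p ps ->]; apply: le_trans e128; apply: ltW.
  exact: (Hs _ ps).1.
have p_in p t : p \in s -> nabs t <= 2 -> nabs (z + t *: w + p.2 - z0) < D.
  move=> ps t1; rewrite [z + _ + p.2]addrAC.
  by apply: inD => //; apply: vs_in; exact: map_f.
pose gp t := gprod [seq p.2 | p <- s] (z + t *: w).
have gpP t : gp t != 0 -> forall p, p \in s -> g (z + t *: w + p.2) != 0.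
  rewrite /gp gprod_neq0 => /allP H p ps; exact: (H _ (map_f _ ps)).
have -> : comb (h : V -> R[i]^o) s z = comb (h : V -> R[i]^o) s (z + 0 *: w).
  by rewrite scale0r addr0.
have bd t : nabs t <= 2 -> gp t != 0 -> nabs (comb (h : V -> R[i]^o) s (z + t *: w)) <=
    (\sum_(p <- s) nabs p.1) * M.
  move=> t1 gt; apply: comb_norm_le => p ps.
  by apply: (hM _ _ _).2; [exact: p_in|exact: gpP].
have r2 : (1 : R) <= 2 by rewrite ler1n.
have dgp := gprod_cdiff r2 vs_in.
apply: (@max_principle_thin _ gp (fun t => comb (h : V -> R[i]^o) s (z + t *: w)) 0 1 (C * k)) => //.
- by move=> t; rewrite subr0; exact: dgp.
- move=> t; rewrite subr0 => t1 /gpP gt.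
  have dh p : p \in s -> ldiff h (z + p.2 + t *: w).
    move=> ps; rewrite addrAC; apply: (hM _ _ _).1; last exact: gt.
    by apply: p_in => //; lra.
  rewrite /comb; elim: (s) dh => [|p s' IH] dh.
    under eq_fun do rewrite big_nil; exact: cdiff_cst.
  under eq_fun do rewrite big_cons.
  apply: (@cdiffD _ (fun t => p.1 * h (z + t *: w + p.2))); last first.
    by apply: IH => q qs; apply: dh; rewrite inE qs orbT.
  apply: cdiffM; first exact: cdiff_cst.
  have E : (fun t => h (z + t *: w + p.2)) = (fun t => h (z + p.2 + t *: w)).
    by apply/funext => x; rewrite addrAC.
  by rewrite E; apply: ldiff_line; apply: dh; rewrite mem_head.
- move=> t; rewrite subr0 => t1 gt0.
  exists ((\sum_(p <- s) nabs p.1) * M), 1; split => // t' tt' gt'; apply: bd => //.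
  by have := nabsD_le (ltW tt') t1; rewrite subrK.
- have [B HB] := cdiff_bounded dgp; exists B => t; rewrite subr0 => t1.
  by apply: HB; rewrite -t1 nabs_le_taxi.
- move=> t; rewrite subr0 => t1 _.
  apply: (@bholo_test _ _ h (z0 + t *: w) e M s k (z + t *: w)) => //.
    move=> y ye; apply: hM; last by apply: (gw t1); have := e0; lra.
    rewrite -[y](subrK (t *: w)); apply: inD.
      by rewrite -addrA -opprD [t *: w + _]addrC.
    by have := nabs_le_taxi t; rewrite t1; lra.
  move=> p ps; rewrite (_ : _ - _ = z + p.2 - z0).
    exact: ltW (Hs _ ps).1.
  by rewrite [z + _ + p.2]addrAC opprD addrACA subrr addr0.
- rewrite /gp gprod_neq0; apply/allP => v /mapP[p ps ->].
  by rewrite scale0r addr0; exact: (Hs _ ps).2.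
Qed.

End Transfer.

(** * The Hahn-Banach theorem *)

Section MinimalSublinear.
Context {R : realType} {E : lmodType R[i]}.
Implicit Types (p q : E -> R) (x y : E).

Definition sublinear q := (forall x y, q (x + y) <= q x + q y) /\
  (forall (t : R) x, 0 < t -> q (t%:C *: x) = t * q x).

Lemma sublinear0 q : sublinear q -> q 0 = 0.
Proof.
move=> [_ qZ]; have := qZ 2 0 (ltr0Sn _ 1); rewrite scaler0 => H.
by lra.
Qed.

Lemma sublinearN q x : sublinear q -> - q (- x) <= q x.
Proof.
move=> sq; have := sq.1 x (- x); rewrite subrr (sublinear0 sq); lra.
Qed.

(** The largest sublinear functional below [q] with the value [- q a] at
    [- a]. *)
Definition tilt q (a x : E) : R :=
  inf [set q (x + t%:C *: a) - t * q a | t in [set t : R | 0 <= t]].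

Section Tilt.
Variables (q : E -> R) (a : E).
Hypothesis sq : sublinear q.

Let qZ0 (t : R) x : 0 <= t -> q (t%:C *: x) = t * q x.
Proof.
rewrite le_eqVlt => /orP[/eqP <-|t0]; last exact: sq.2.
by rewrite scale0r mul0r sublinear0.
Qed.

Let lb (x : E) (t : R) : 0 <= t -> - q (- x) <= q (x + t%:C *: a) - t * q a.
Proof.
move=> t0; rewrite -qZ0//.
have := sq.1 (x + t%:C *: a) (- x); rewrite addrAC subrr add0r; lra.
Qed.

Let set0 x : [set q (x + t%:C *: a) - t * q a | t in [set t : R | 0 <= t]] !=set0.
Proof. by exists (q (x + 0%:C *: a) - 0 * q a), 0 => /=. Qed.

Let setlb x : has_lbound [set q (x + t%:C *: a) - t * q a | t in [set t : R | 0 <= t]].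
Proof. by exists (- q (- x)) => _ [t t0 <-]; exact: lb. Qed.

Lemma tilt_le (x : E) (t : R) : 0 <= t -> tilt q a x <= q (x + t%:C *: a) - t * q a.
Proof. by move=> t0; apply: ge_inf => //; exists t. Qed.

Lemma tilt_ge (x : E) (r : R) :
  (forall t : R, 0 <= t -> r <= q (x + t%:C *: a) - t * q a) -> r <= tilt q a x.
Proof. by move=> H; apply: lb_le_inf => // _ [t t0 <-]; exact: H. Qed.

Lemma tilt_le_id x : tilt q a x <= q x.
Proof. by have := tilt_le x (lexx 0); rewrite scale0r addr0 mul0r subr0. Qed.

Lemma tilt_sublinear : sublinear (tilt q a).
Proof.
split=> [x y|t x t0].
  rewrite -lerBlDr; apply: tilt_ge => t t0.
  rewrite lerBlDr -lerBlDl; apply: tilt_ge => s s0.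
  rewrite lerBlDl; apply: le_trans (tilt_le _ (addr_ge0 s0 t0)) _.
  have := sq.1 (x + t%:C *: a) (y + s%:C *: a).
  have -> : x + t%:C *: a + (y + s%:C *: a) = x + y + (s + t)%:C *: a.
    by rewrite addrACA -scalerDl -rmorphD [t + s]addrC.
  rewrite mulrDl; lra.
apply/eqP; rewrite eq_le; apply/andP; split.
  rewrite -ler_pdivrMl//; apply: tilt_ge => s s0.
  rewrite ler_pdivrMl//; apply: le_trans (tilt_le _ (mulr_ge0 (ltW t0) s0)) _.
  by rewrite rmorphM -scalerA -scalerDr sq.2// mulrBr mulrA.
apply: tilt_ge => s s0; have st : 0 <= s / t by rewrite divr_ge0// ltW.
have := ler_wpM2l (ltW t0) (tilt_le x st) => /le_trans; apply.
have E1 : s = t * (s / t) by field; rewrite gt_eqF.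
have E2 : t%:C *: x + s%:C *: a = t%:C *: (x + (s / t)%:C *: a).
  by rewrite scalerDr scalerA -rmorphM -E1.
by rewrite E2 sq.2// mulrBr mulrA -E1.
Qed.

End Tilt.

(** Zorn's lemma: the pointwise infimum of a chain of sublinear functionals is
    sublinear, and finite because [- q (- x) <= q x]. *)
Lemma minimal_sublinear p : sublinear p ->
  exists q, [/\ sublinear q, forall x, q x <= p x &
    forall q', sublinear q' -> (forall x, q' x <= q x) -> q' = q].
Proof.
move=> sp; pose P q := sublinear q /\ forall x, q x <= p x.
pose T := {q | P q}.
pose below (q1 q2 : T) := `[< forall x, sval q2 x <= sval q1 x >].
have [||||q Hq] := @Zorn T below.
- by move=> q; apply/asboolP.
- by move=> q1 q2 q3 /asboolP h1 /asboolP h2; apply/asboolP => x; exact: le_trans (h1 x).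
- move=> [q1 P1] [q2 P2] /asboolP /= h1 /asboolP /= h2.
  have E12 : q1 = q2 by apply/funext => x; apply/eqP; rewrite eq_le h1 h2.
  by case: _ / E12 P2 h1 h2 => P2 _ _; congr exist; exact: Prop_irrelevance.
- move=> A Atot; have [[q0 Aq0]|nA] := pselect (A !=set0); last first.
    by exists (exist P p (conj sp (fun x => lexx _))) => s As; exfalso; apply: nA; exists s.
  pose I x := [set sval q x | q in A].
  have I0 x : I x !=set0 by exists (sval q0 x), q0.
  have Ilb x : has_lbound (I x).
    exists (- p (- x)) => _ [[q [sq qp]] Aq <-] /=.
    by apply: le_trans (sublinearN _ sq); rewrite lerN2.
  pose m x := inf (I x).
  have mle (q : T) x : A q -> m x <= sval q x by move=> Aq; apply: ge_inf => //; exists q.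
  have mge x r : (forall q : T, A q -> r <= sval q x) -> r <= m x.
    by move=> H; apply: lb_le_inf => // _ [q Aq <-]; exact: H.
  have sm : sublinear m.
    split=> [x y|t x t0].
      rewrite -lerBlDr; apply: (mge) => q1 Aq1; rewrite lerBlDr -lerBlDl.
      apply: (mge) => q2 Aq2; rewrite lerBlDl.
      have [/asboolP h|/asboolP h] := Atot _ _ Aq1 Aq2.
        apply: le_trans (mle _ _ Aq2) _; apply: le_trans ((svalP q2).1.1 x y) _.
        by rewrite lerD2r.
      apply: le_trans (mle _ _ Aq1) _; apply: le_trans ((svalP q1).1.1 x y) _.
      by rewrite lerD2l.
    apply/eqP; rewrite eq_le; apply/andP; split.
      rewrite -ler_pdivrMl//; apply: (mge) => q Aq; rewrite ler_pdivrMl//.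
      by rewrite -((svalP q).1.2 _ _ t0); exact: mle.
    apply: (mge) => q Aq; rewrite ((svalP q).1.2 _ _ t0).
    by rewrite ler_wpM2l ?(ltW t0)//; exact: mle.
  have mp x : m x <= p x by apply: le_trans (mle _ _ Aq0) ((svalP q0).2 x).
  exists (exist P m (conj sm mp)) => q Aq; apply/asboolP => x /=; exact: mle.
exists (sval q); split; [exact: (svalP q).1|exact: (svalP q).2|].
move=> q' sq' q'q.
have Pq' : P q' by split => // x; exact: le_trans (q'q x) ((svalP q).2 x).
by have := Hq (exist P q' Pq'); move=> /(_ (asboolT q'q)) <-.
Qed.

(** A minimal functional equals all of its tilts, which is additivity. *)
Lemma minimal_additive q : sublinear q ->
  (forall q', sublinear q' -> (forall x, q' x <= q x) -> q' = q) ->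
  (forall x y, q (x + y) = q x + q y) /\ (forall (t : R) x, q (t%:C *: x) = t * q x).
Proof.
move=> sq qmin.
have qD x y : q (x + y) = q x + q y.
  apply/eqP; rewrite eq_le sq.1 /=.
  have E1 := qmin _ (tilt_sublinear y sq) (tilt_le_id y sq).
  have := tilt_le y sq x ler01; rewrite E1 scale1r mul1r; lra.
split=> // t x; have q0 := sublinear0 sq.
have qN y : q (- y) = - q y by have := qD y (- y); rewrite subrr q0; lra.
have [t0|t0|->] := ltgtP t 0; [|exact: sq.2|by rewrite scale0r mul0r].
have -> : t%:C *: x = - ((- t)%:C *: x) by rewrite rmorphN scaleNr opprK.
by rewrite qN sq.2 ?oppr_gt0// mulNr opprK.
Qed.

(** A minimal functional below the tilt of [p] in the direction [x0]: the tilt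
    makes it attain [p x0] at [x0]. *)
Lemma hahn_banach_real p x0 : sublinear p -> exists phi : E -> R,
  [/\ forall x y, phi (x + y) = phi x + phi y,
      forall (t : R) x, phi (t%:C *: x) = t * phi x,
      forall x, phi x <= p x & p x0 <= phi x0].
Proof.
move=> sp; have st := tilt_sublinear x0 sp.
have [q [sq qt qmin]] := minimal_sublinear st.
have [qD qZ] := minimal_additive sq qmin.
exists q; split => // [x|].
  exact: le_trans (qt x) (tilt_le_id _ sp x).
have := le_trans (qt (- x0)) (tilt_le x0 sp (- x0) ler01).
rewrite scale1r addNr mul1r (sublinear0 sp).
have := qZ (-1) x0; rewrite rmorphN1 scaleN1r; lra.
Qed.

End MinimalSublinear.

Section ComplexHahnBanach.
Context {R : realType} {E : lmodType R[i]}.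
Implicit Types (p : E -> R) (x y : E).

(** The real functional is the real part of
    [phi x - 'i * phi ('i *: x)]; rotating [x] so that the value becomes
    real and nonnegative turns the bound on [phi] into a bound on the modulus. *)
Lemma hahn_banach p x0 : sublinear p ->
  (forall (a : R[i]) x, nabs a = 1 -> p (a *: x) = p x) ->
  exists u : {linear E -> R[i]^o},
    (forall x, nabs (u x) <= p x) /\ p x0 <= nabs (u x0).
Proof.
move=> sp pb; have [phi [phiD phiZ phip phi0]] := hahn_banach_real x0 sp.
pose U x : R[i]^o := (phi x)%:C - 'i * (phi ('i *: x))%:C.
have phiN x : phi (- x) = - phi x.
  by have := phiZ (-1) x; rewrite rmorphN1 scaleN1r mulN1r.
have sqi : 'i * 'i = -1 :> R[i] by rewrite -expr2 sqr_i.
have phii x : phi ('i *: ('i *: x)) = - phi x by rewrite scalerA sqi scaleN1r phiN.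
have linU : linear U.
  move=> a x y; rewrite /U.
  have aE : a = (complex.Re a)%:C + 'i * (complex.Im a)%:C by exact: complexE.
  move: (complex.Re a) (complex.Im a) aE => r s ->.
  have phia z : phi ((r%:C + 'i * s%:C) *: z) = r * phi z + s * phi ('i *: z).
    by rewrite scalerDl phiD phiZ ['i * _]mulrC -scalerA phiZ.
  rewrite scalerDr !phiD scalerA [in 'i * (_ + _)]mulrC -scalerA !phia phii.
  rewrite -[(r%:C + 'i * s%:C) *: _]/((r%:C + 'i * s%:C) * (_ - _)).
  have cD (b c : R) : (b + c)%:C = b%:C + c%:C by rewrite rmorphD.
  have cM (b c : R) : (b * c)%:C = b%:C * c%:C by rewrite rmorphM.
  have cN (b : R) : (- b)%:C = - b%:C by rewrite rmorphN.
  rewrite !cD !cM !cN.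
  move: (phi x)%:C (phi ('i *: x))%:C (phi y)%:C (phi ('i *: y))%:C r%:C s%:C => A B C D r' s'.
  have -> : r' * A + s' * B + C - 'i * (r' * B + s' * - A + D) =
     r' * A + s' * B - 'i * (r' * B) + 'i * s' * A + (C - 'i * D) by ring.
  have -> : (r' + 'i * s') * (A - 'i * B) = r' * A - ('i * 'i) * (s' * B)
     - 'i * (r' * B) + 'i * s' * A by ring.
  by rewrite sqi; ring.
pose m := GRing.isLinear.Build R[i] E R[i]^o *:%R U linU.
pose u : {linear E -> R[i]^o} := HB.pack_for {linear E -> R[i]^o} U m.
have uE x : u x = U x by [].
have ReU x : complex.Re (U x) = phi x.
  by rewrite /U /=; ring.
exists u; split=> [x|].
  have [u0|u0] := eqVneq (u x : R[i]) 0.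
    rewrite u0 nabs0; have h1 := phip x; have h2 := phip (- x).
    have := pb (-1) x; rewrite nabsN nabs1 scaleN1r => /(_ erefl) E1.
    by rewrite E1 phiN in h2; lra.
  pose l := (nabs (u x))%:C / (u x : R[i]).
  have nu : 0 < nabs (u x : R[i]) by rewrite nabs_gt0.
  have nl : nabs l = 1.
    by rewrite /l nabsM nabsV nabs_pos ?nabs_ge0// divff ?gt_eqF.
  rewrite -(pb _ x nl); apply: le_trans (phip _); rewrite -ReU -uE.
  have -> : u (l *: x) = l * u x :> R[i] by exact: linearZ.
  by rewrite /l divfK.
by apply: le_trans phi0 _; rewrite -ReU; apply: le_trans (ler_norm _) (Re_le_nabs _).
Qed.

End ComplexHahnBanach.

(** * Gauges and separation *)

Section AbsolutelyConvex.
Context {R : realType} {E : tvsType R[i]}.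
Implicit Types (x y : E) (D N U : set E).

Lemma absconv_balanced D (a : R[i]) x : absolutely_convex D -> nabs a <= 1 ->
  D x -> D (a *: x).
Proof.
move=> cD a1 Dx; have := cD a 0 x x _ Dx Dx.
by rewrite normr0 addr0 scale0r addr0 normE => /(_ (_ : _)); apply; rewrite lecR.
Qed.

Lemma convex_setP D : convex_set (D : set (convex_lmodType E)) ->
  forall (s : R) x y, 0 <= s -> s <= 1 -> D x -> D y ->
    D (s%:C *: x + (1 - s)%:C *: y).
Proof.
move=> cD s x y s0 s1 Dx Dy.
have s0' : 0 <= s%:C :> R[i] by rewrite lecR.
have s1' : s%:C <= 1 :> R[i] by rewrite lecR.
have := cD x y (Itv01 s0' s1') (mem_set Dx) (mem_set Dy).
move/set_mem => H; have {}H : D (s%:C *: x + (1 - s%:C) *: y) := H.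
by rewrite rmorphB.
Qed.

(** A convex neighbourhood need not be balanced: the points all of whose multiples
    by scalars of the unit disc lie in it form a balanced one, which is again
    convex, and a neighbourhood by continuity of the scalar multiplication
    at 0. *)
Lemma absconv_nbhs U : nbhs (0 : E) U ->
  exists N, [/\ nbhs (0 : E) N, absolutely_convex N & N `<=` U].
Proof.
move=> U0; have [Bs Bconv [Bopen Bbase]] := @locally_convex _ E.
have [W [BW W0 WU]] : exists W, [/\ Bs W, W 0 & W `<=` U].
  by have [W [BW W0] WU] := Bbase 0 U U0; exists W.
have cW := convex_setP (Bconv W (mem_set BW)).
have nW : nbhs (0 : E) W by exact: open_nbhs_nbhs (conj (Bopen _ BW) W0).
exists [set y | forall a : R[i], nabs a <= 1 -> W (a *: y)]; split.
- have := @scale_continuous _ E (0, 0) W; rewrite /= scaler0 => /(_ nW).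
  move=> [[B1 B2] /= [/nbhs_nabs[e e0 eB] nB2] BW2].
  have e2 : (e / 2)%:C != 0 :> R[i].
    by rewrite -nabs_gt0 nabs_pos ?divr_ge0 ?(ltW e0)// divr_gt0.
  apply: filterS (nbhs0Z e2 nB2) => _ [y By <-] a a1.
  rewrite scalerA; apply: (BW2 (_, _)); split => //=.
  apply: eB; rewrite subr0 nabsM nabs_pos ?divr_ge0 ?(ltW e0)//.
  by have := ler_wpM2r (ltW e0) a1; lra.
- move=> a b x y; rewrite !normE -rmorphD lecR => ab Nx Ny c c1.
  set s := nabs a in ab; set t := nabs b in ab.
  have s0 : 0 <= s := nabs_ge0 _; have t0 : 0 <= t := nabs_ge0 _.
  have polar (v : R[i]) : exists2 l : R[i], nabs l <= 1 & v = (nabs v)%:C * l.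
    have [->|v0] := eqVneq v 0; first by exists 0; rewrite ?nabs0 ?mulr0.
    have nv0 : (nabs v)%:C != 0 :> R[i].
      by rewrite -normE normr_eq0.
    exists (v / (nabs v)%:C); last by rewrite mulrCA divff ?mulr1.
    by rewrite nabsM nabsV nabs_pos ?nabs_ge0// divff// nabs_eq0.
  have [la la1 aE] := polar a; have [lb lb1 bE] := polar b.
  have cl l : nabs l <= 1 -> nabs (c * l) <= 1.
    by move=> l1; rewrite nabsM -[leRHS]mul1r ler_pM ?nabs_ge0.
  have Wx := Nx _ (cl _ la1); have Wy := Ny _ (cl _ lb1).
  have W00 : W 0 by have := Nx 0; rewrite nabs0 scale0r => /(_ ler01).
  have E1 : c *: (a *: x + b *: y) = s%:C *: (c * la *: x) + t%:C *: (c * lb *: y).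
    rewrite scalerDr !scalerA /s /t {1}aE {1}bE.
    by congr (_ *: _ + _ *: _); ring.
  rewrite E1.
  have [st0|st0] := eqVneq (s + t) 0.
    have -> : s = 0 by lra. have -> : t = 0 by lra.
    by rewrite !scale0r addr0.
  have st1 : 0 < s + t by rewrite lt0r st0 addr_ge0.
  have p0 : 0 <= s / (s + t) by rewrite divr_ge0// ltW.
  have p1 : s / (s + t) <= 1 by rewrite ler_pdivrMr// mul1r lerDl.
  have W1 := cW _ _ _ p0 p1 Wx Wy.
  have W2 := cW _ _ _ (ltW st1) ab W1 W00.
  rewrite scaler0 addr0 scalerDr !scalerA -!rmorphM in W2.
  rewrite (_ : (s + t) * (s / (s + t)) = s) in W2; last by field.
  rewrite (_ : (s + t) * (1 - s / (s + t)) = t) in W2; last by field.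
  by rewrite !scalerA.
- by move=> y /(_ 1); rewrite nabs1 scale1r => /(_ (lexx _))/WU.
Qed.

(** The set whose infimum is the gauge; inclusion in it is easier to handle. *)
Definition gset D x := [set t : R | 0 < t /\ [set t%:C *: y | y in D] x].

Section Gauge.
Variable D : set E.
Hypothesis cD : absolutely_convex D.

Lemma gset_inv x (t : R) : 0 < t -> gset D x t <-> D ((t^-1)%:C *: x).
Proof.
move=> t0; have tC : t%:C != 0 :> R[i] by rewrite -nabs_gt0 nabs_pos// ltW.
split=> [[_ [y Dy <-]]|Dx].
  by rewrite scalerA -rmorphM mulVf ?gt_eqF// scale1r.
split=> //; exists ((t^-1)%:C *: x) => //.
by rewrite scalerA -rmorphM divff ?gt_eqF// scale1r.
Qed.

Lemma gset_up x (s t : R) : gset D x s -> s <= t -> gset D x t.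
Proof.
move=> Gs st; have s0 := Gs.1; have t0 : 0 < t := lt_le_trans s0 st.
apply/gset_inv => //; move/(gset_inv _ s0) : Gs => Ds.
have -> : (t^-1)%:C *: x = (s / t)%:C *: ((s^-1)%:C *: x).
  by rewrite scalerA -rmorphM; congr (_%:C *: _); field; rewrite !gt_eqF.
apply: absconv_balanced => //.
have p0 : 0 <= s / t by rewrite divr_ge0// ltW.
by rewrite nabs_pos// ler_pdivrMr// mul1r.
Qed.

Lemma gset_lb x : has_lbound (gset D x).
Proof. by exists 0 => t [/ltW]. Qed.

Lemma gauge_le x (t : R) : gset D x t -> gauge D x <= t.
Proof. by move=> H; apply: ge_inf => //; exact: gset_lb. Qed.

Lemma gauge_lt x (t : R) : gset D x !=set0 -> gauge D x < t -> gset D x t.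
Proof.
move=> G0 xt; have [s Gs st] := inf_lt G0 xt.
by apply: gset_up Gs (ltW st).
Qed.

Lemma gsetD x y (s t : R) : gset D x s -> gset D y t -> gset D (x + y) (s + t).
Proof.
move=> Gs Gt; have s0 := Gs.1; have t0 := Gt.1; have st := addr_gt0 s0 t0.
apply/gset_inv => //.
move/(gset_inv _ s0) : Gs => Ds; move/(gset_inv _ t0) : Gt => Dt.
have := cD (a := (s / (s + t))%:C) (b := (t / (s + t))%:C) _ Ds Dt.
have ps : 0 <= s / (s + t) by rewrite divr_ge0// ltW.
have pt : 0 <= t / (s + t) by rewrite divr_ge0// ltW.
rewrite !normE (nabs_pos ps) (nabs_pos pt) -rmorphD lecR -mulrDl divff ?gt_eqF//.
move=> /(_ (lexx _)); rewrite !scalerA -!rmorphM scalerDr.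
have -> : s / (s + t) / s = (s + t)^-1 by field; rewrite !gt_eqF.
by have -> : t / (s + t) / t = (s + t)^-1 by field; rewrite !gt_eqF.
Qed.

Lemma gsetZ x (t : R) (a : R[i]) : a != 0 -> gset D x t -> gset D (a *: x) (nabs a * t).
Proof.
move=> a0 Gt; have t0 := Gt.1; have na : 0 < nabs a by rewrite nabs_gt0.
apply/gset_inv; first by rewrite mulr_gt0.
move/(gset_inv _ t0) : Gt => Dt.
have -> : ((nabs a * t)^-1)%:C *: (a *: x) = (a / (nabs a)%:C) *: ((t^-1)%:C *: x).
  rewrite !scalerA invfM rmorphM fmorphV; congr (_ *: _); ring.
apply: absconv_balanced => //.
by rewrite nabsM nabsV nabs_pos ?nabs_ge0// divff ?gt_eqF.
Qed.

Hypothesis D0 : nbhs (0 : E) D.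

Lemma gset_neq0 x : gset D x !=set0.
Proof.
have := @scale_continuous _ E (0, x) D; rewrite /= scale0r => /(_ D0).
move=> [[B1 B2] /= [/nbhs_nabs[e e0 eB] nB2] BW].
exists (2 / e); apply/gset_inv; first by rewrite divr_gt0.
apply: (BW (_, _)); split => /=; last exact: nbhs_singleton.
apply: eB; rewrite subr0 invf_div nabs_pos ?divr_ge0 ?(ltW e0)//.
by rewrite ltr_pdivrMr// ltr_pMr// ltr1n.
Qed.

Lemma gauge_sublinear : sublinear (gauge D : E -> R).
Proof.
have D2 x y : gauge D (x + y) <= gauge D x + gauge D y.
  apply/ler_addgt0Pr => e e0; have e2 : 0 < e / 2 by rewrite divr_gt0.
  have Gx : gset D x (gauge D x + e / 2) by apply: gauge_lt; rewrite ?ltrDl//; exact: gset_neq0.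
  have Gy : gset D y (gauge D y + e / 2) by apply: gauge_lt; rewrite ?ltrDl//; exact: gset_neq0.
  have := gauge_le (gsetD Gx Gy); lra.
have DZ (t : R) x : 0 < t -> gauge D (t%:C *: x) <= t * gauge D x.
  move=> t0; apply/ler_addgt0Pr => e e0; have et : 0 < e / t by rewrite divr_gt0.
  have Gx : gset D x (gauge D x + e / t) by apply: gauge_lt; rewrite ?ltrDl//; exact: gset_neq0.
  have t0' : t%:C != 0 :> R[i] by rewrite -nabs_gt0 nabs_pos// ltW.
  have := gauge_le (gsetZ t0' Gx); rewrite nabs_pos ?(ltW t0)// mulrDr.
  by have -> : t * (e / t) = e by field; rewrite gt_eqF.
split=> // t x t0; apply/eqP; rewrite eq_le DZ//=.
have ti : 0 < t^-1 by rewrite invr_gt0.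
have := DZ _ (t%:C *: x) ti; rewrite scalerA -rmorphM mulVf ?gt_eqF// scale1r.
by rewrite ler_pdivlMl.
Qed.

Lemma gauge_unimodular (a : R[i]) x : nabs a = 1 -> gauge D (a *: x) = gauge D x.
Proof.
have le (b : R[i]) y : nabs b = 1 -> gauge D (b *: y) <= gauge D y.
  move=> b1; have b0 : b != 0 by rewrite -nabs_gt0 b1.
  apply/ler_addgt0Pr => e e0.
  have Gy : gset D y (gauge D y + e) by apply: gauge_lt; rewrite ?ltrDl//; exact: gset_neq0.
  by have := gauge_le (gsetZ b0 Gy); rewrite b1 mul1r.
move=> a1; apply/eqP; rewrite eq_le le//=.
have a0 : a != 0 by rewrite -nabs_gt0 a1.
have := le a^-1 (a *: x); rewrite nabsV a1 invr1 => /(_ erefl).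
by rewrite scalerA mulVf// scale1r.
Qed.

(** A functional dominated by the gauge of [D] that attains the gauge at [x]. It
    is continuous because it is bounded on the neighbourhood [D]. *)
Lemma hahn_banach_separation x : ~ D x ->
  exists u, [/\ dual E u, forall y, D y -> nabs (u y) <= 1 & 1 <= nabs (u x)].
Proof.
move=> nDx; have [u [up ux]] := hahn_banach x gauge_sublinear gauge_unimodular.
have D1 y : D y -> gauge D y <= 1.
  by move=> Dy; apply: gauge_le; apply/gset_inv => //; rewrite invr1 scale1r.
have uD y : D y -> nabs (u y) <= 1 by move=> /D1; exact: le_trans.
have x1 : 1 <= gauge D x.
  rewrite leNgt; apply/negP => x1; apply: nDx.
  have := gauge_lt (gset_neq0 x) x1.
  by move/(gset_inv _ ltr01); rewrite invr1 scale1r.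
exists u; split => //; last exact: le_trans ux.
split; first exact: linearP.
move=> y U /nbhs_nabs[e e0 eU].
have e2 : (e / 2)%:C != 0 :> R[i].
  by rewrite -nabs_gt0 nabs_pos ?divr_ge0 ?(ltW e0)// divr_gt0.
have := nbhsT y (nbhs0Z e2 D0); apply: filterS => _ [_ [z Dz <-] <-].
apply: eU; rewrite linearD addrC addKr linearZ nabsZ nabs_pos ?divr_ge0 ?(ltW e0)//.
have := ler_wpM2l (divr_ge0 (ltW e0) (ler0n _ 2)) (uD _ Dz); rewrite mulr1 => H.
by apply: le_lt_trans H _; rewrite ltr_pdivrMr// ltr_pMr// ltr1n.
Qed.

End Gauge.
End AbsolutelyConvex.

(** * Polars of bounded sets as norming families *)

Section DualClosures.
Context {R : realType} {E : tvsType R[i]}.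
Implicit Types (x y : E) (Q A : set (E -> R[i]^o)) (u g : E -> R[i]^o).

Lemma dual_scale u (a : R[i]) : dual E u -> dual E (fun x => a * u x).
Proof.
move=> [lu cu]; split.
  move=> b x y; rewrite lu mulrDr; congr (_ + _).
  by rewrite -[b *: u x]/(b * u x) -[b *: (a * u x)]/(b * (a * u x)) mulrCA.
move=> x; apply: (@continuous_comp _ _ _ u (fun y : R[i]^o => a *: y)).
  exact: cu.
exact: (@scaler_continuous _ R[i]^o a).
Qed.

Lemma dual_comb (a : R[i]) u v : dual E u -> dual E v ->
  dual E (fun x => a *: u x + v x).
Proof.
move=> [lu cu] [lv cv]; split.
  by move=> b s t; rewrite lu lv !scalerDr !scalerA [a * b]mulrC addrACA.
move=> s; have c1 : (a *: u t) @[t --> s] --> a *: u s.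
  apply: (@continuous_comp _ _ _ u (fun y : R[i]^o => a *: y)); first exact: cu.
  exact: (@scaler_continuous _ R[i]^o a).
exact: cvgD c1 (cv s).
Qed.

Lemma filter_finite_points (F : set_system (E -> R[i]^o)) : Filter F ->
  forall u (e : R) (H : forall x, F [set g | nabs (g x - u x) < e]) (xs : seq E),
    F [set g | forall x, x \in xs -> nabs (g x - u x) < e].
Proof.
move=> FF u e H; elim=> [|x xs IH].
  rewrite (_ : [set g | _] = setT); first exact: filterT.
  by apply/seteqP; split => // g _ x; rewrite in_nil.
apply: filterS (filterI (H x) IH) => g [gx gxs] y; rewrite inE.
by move=> /orP[/eqP ->//|]; exact: gxs.
Qed.

Lemma ptws_closure_approx A u : closure (A : set {ptws E -> R[i]^o}) u ->
  forall (xs : seq E) (e : R), 0 < e ->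
    exists2 g, A g & forall x, x \in xs -> nabs (g x - u x) < e.
Proof.
move=> clu xs e e0.
have H := @filter_finite_points _ (nbhs_filter (u : {ptws E -> R[i]^o})) u e _ xs.
have {}H := H (fun x => @proj_continuous E (fun=> R[i]^o) x u _ (_ : nbhs (u x : R[i]^o) (fun y : R[i]^o => nabs (y - u x) < e))).
have {}H := clu _ (H _).
have [|g [Ag Hg]] := H; last by exists g.
by move=> x; apply/nbhs_nabs; exists e.
Qed.

Lemma ptws_closure_interp A u :
  (forall xs : seq E, exists2 g, A g & forall x, x \in xs -> g x = u x) ->
  closure (A : set {ptws E -> R[i]^o}) u.
Proof.
move=> H; pose B (xs : seq E) : set (E -> R[i]^o) :=
  [set g | A g /\ forall x, x \in xs -> g x = u x].
pose F := filter_from [set: seq E] B.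
have FF : Filter F.
  apply: filter_from_filter; first by exists [::].
  move=> xs ys _ _; exists (xs ++ ys) => // g [Ag Hg]; split; split => // x xx;
    by apply: Hg; rewrite mem_cat xx ?orbT.
have cF : {ptws, F --> u}.
  apply/pointwise_cvgP => t U Ut; exists [:: t] => // g [_ Hg].
  by rewrite /preimage /= Hg ?mem_head//; exact: nbhs_singleton.
move=> W /cF[xs _ HW]; have [g Ag Hg] := H xs.
by exists g; split => //; apply: HW; split.
Qed.

(** The step of the lemma on the intersection of kernels, by induction on [xs].
    For empty [xs] the hypothesis leaves only [x = 0]. Otherwise, either the
    condition at the first point [y] is implied by the others, or
    some [q0] in [Q] vanishes on the other points but not at [y]; subtracting a
    multiple of [q0] from the members of [Q] then shows that [x] can be
    replaced by [x - a *: y]. *)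
Lemma separating_span Q (xs : seq E) x : dual_subspace Q -> separating Q ->
  (forall q, Q q -> (forall y, y \in xs -> q y = 0) -> q x = 0) ->
  forall u : {linear E -> R[i]^o}, (forall y, y \in xs -> u y = 0) -> u x = 0.
Proof.
move=> [QE Q0 Qlin] Qsep; elim: xs x => [|y ys IH] x Hx u Hu.
  have [->|/eqP x0] := eqVneq x 0; first exact: linear0.
  have [q Qq] := Qsep x 0 x0; have [w qw] := dual_lin (QE _ Qq).
  by rewrite (Hx q) // {1}qw linear0.
have [Hy|/existsNP[q0]] := pselect (forall q, Q q -> (forall y, y \in ys -> q y = 0) -> q y = 0).
  apply: IH => [q Qq qys|z zys]; last by apply: Hu; rewrite inE zys orbT.
  apply: Hx => // z; rewrite inE => /orP[/eqP ->|]; last exact: qys.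
  exact: Hy.
move=> /not_implyP[Qq0 /not_implyP[q0ys /eqP q0y]].
have [w0 q0w] := dual_lin (QE _ Qq0).
pose a : R[i] := q0 x / q0 y.
have ux : u (x - a *: y) = 0.
  apply: IH => [q Qq qys|z zys]; last by apply: Hu; rewrite inE zys orbT.
  have [w qw] := dual_lin (QE _ Qq).
  have Qr : Q (fun z => (- (q y / q0 y)) *: q0 z + q z) by exact: Qlin.
  have E1 : (- (q y / q0 y)) *: q0 x + q x = 0.
    apply: (Hx _ Qr) => z; rewrite inE => /orP[/eqP ->|zys].
      by rewrite -[_ *: _]/(_ * _) mulNr divfK// addNr.
    by rewrite (q0ys z zys) (qys z zys) scaler0 addr0.
  rewrite qw wB wZ -qw -[RHS]E1 -[_ *: q0 x]/(_ * q0 x) /a; ring.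
have uy : u y = 0 by apply: Hu; rewrite mem_head.
by move: ux; rewrite wB wZ uy mulr0 subr0.
Qed.

(** Interpolation point by point: the interpolating functional is corrected at
    the new point [x] by a member of [Q] that vanishes at the old ones. If
    there is none, [separating_span] says that it is correct at [x]. *)
Lemma separating_interp Q u : dual_subspace Q -> separating Q -> dual E u ->
  forall xs : seq E, exists2 g, Q g & forall x, x \in xs -> g x = u x.
Proof.
move=> sQ Qsep du; have [QE Q0 Qlin] := sQ.
elim=> [|x xs [g Qg gxs]]; first by exists (fun=> 0).
have [H|/existsNP[q]] := pselect (forall q, Q q -> (forall y, y \in xs -> q y = 0) -> q x = 0).
  exists g => // y; rewrite inE => /orP[/eqP ->|]; last exact: gxs.
  have dv := dual_comb (-1) (QE _ Qg) du; have [v vE] := dual_lin dv.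
  have vB z : v z = u z - g z by rewrite -vE scaleN1r addrC.
  apply/eqP; rewrite eq_sym -subr_eq0 -vB; apply/eqP.
  apply: (separating_span sQ Qsep H) => z zxs.
  by rewrite vB gxs// subrr.
move=> /not_implyP[Qq /not_implyP[qxs /eqP qx]].
exists (fun y => ((u x - g x) / q x) *: q y + g y); first exact: Qlin.
move=> y; rewrite inE => /orP[/eqP ->|yxs].
  by rewrite -[_ *: _]/(_ * _) divfK// subrK.
by rewrite (qxs y yxs) scaler0 add0r gxs.
Qed.

Lemma separating_dense Q : dual_subspace Q -> separating Q -> wstar_dense Q.
Proof.
move=> sQ Qsep u du; apply: ptws_closure_interp.
exact: separating_interp.
Qed.

Lemma strongly_dense_approx G (B : set E) u : strongly_dense G -> tvs_bounded B ->
  dual E u -> forall e : R, 0 < e ->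
  exists2 g, G g & forall x, B x -> nabs (g x - u x) < e.
Proof.
move=> dG bB du e e0.
pose ent : set (R[i]^o * R[i]^o) := [set xy | nabs (xy.1 - xy.2) < e].
have Eent : entourage ent.
  rewrite -entourage_ballE; exists e%:C => /=; first by rewrite ltcR.
  by move=> [x y] /=; rewrite -ball_normE /ent/= normE ltcR.
have [g [Gg Hg]] := dG _ du _ (@fam_nbhs _ _ (@tvs_bounded R E) B ent u Eent bB).
by exists g => // x Bx; rewrite nabsB; exact: Hg.
Qed.

End DualClosures.

Section PolarNorming.
Context {R : realType} {E : tvsType R[i]}.
Variable B : set E.
Hypothesis bB : tvs_bounded B.
Implicit Types (x y : E) (u g : E -> R[i]^o).

Lemma polarP (U : set E) u :
  polar U u <-> dual E u /\ forall x, U x -> nabs (u x) <= 1.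
Proof.
by split=> -[du H]; split=> // x /H; rewrite normE lecR.
Qed.

Lemma polar_dual : polar B `<=` dual E. Proof. by move=> u []. Qed.

(** By [hahn_banach_separation] a point outside an absolutely convex
    neighbourhood is separated from it by a functional; a multiple of the
    functional, with a factor given by how the neighbourhood absorbs [B], lies
    in the polar of [B]. *)
Lemma polar_nbhs (U : set E) : nbhs 0 U ->
  exists2 c : R, 0 < c & forall x, tle (polar B) x c -> U x.
Proof.
move=> U0; have [N [N0 cN NU]] := absconv_nbhs U0.
have [r r0 BN] := bB N0.
exists (1 / (2 * r)); first by rewrite divr_gt0// mulr_gt0.
move=> x xr; apply: NU; apply: contrapT => nNx.
have [u [du uN ux]] := hahn_banach_separation cN N0 nNx.
pose v x : R[i]^o := (r^-1)%:C * u x.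
have pv : polar B v.
  apply/polarP; split; first exact: dual_scale.
  move=> b /(BN r%:C) [|n Nn <-]; first by rewrite normE nabs_pos// ltW.
  have [w uw] := dual_lin du.
  rewrite /v uw wZ mulrA -rmorphM mulVf ?gt_eqF//.
  by rewrite mul1r -uw; exact: uN.
have ri : 0 <= r^-1 by rewrite invr_ge0 ltW.
have := xr _ pv; rewrite /v nabsM nabs_pos//.
rewrite leNgt => /negP; apply; apply: (@lt_le_trans _ _ r^-1); last first.
  by rewrite ler_peMr.
rewrite mul1r ltf_pV2 ?posrE ?mulr_gt0//; have := r0; lra.
Qed.

Lemma dual_polar_bd u : dual E u ->
  exists2 K : R, 0 < K & forall x (e : R), 0 < e -> tle (polar B) x e -> nabs (u x) <= K * e.
Proof.
move=> du; have [w uw] := dual_lin du.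
have N0 : nbhs (0 : E) [set x | nabs (u x) < 1].
  have := du.2 0 (fun y : R[i]^o => nabs y < 1); apply.
  apply/nbhs_nabs; exists 1 => // y.
  by rewrite uw linear0 subr0.
have [c c0 cH] := polar_nbhs N0; exists c^-1; first by rewrite invr_gt0.
move=> x e e0 xe.
have p0 : 0 < c / e by rewrite divr_gt0.
have := cH ((c / e)%:C *: x).
rewrite /= uw wZ nabsM nabs_pos ?(ltW p0)// => H.
have : c / e * nabs (w x) < 1.
  apply: H; have := tleZ polar_dual (c / e)%:C xe.
  by rewrite nabs_pos ?(ltW p0)// divfK ?gt_eqF.
rewrite -ltr_pdivlMl// invf_div mulr1 => /ltW.
by rewrite [e / c]mulrC.
Qed.

(** The gauge of the bipolar of [B] is the seminorm of the polar of [B], which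
    connects Banach disks with norming families. *)
Lemma tle_gset x (e : R) : 0 < e ->
  gset [set y | tle (polar B) y 1] x e <-> tle (polar B) x e.
Proof.
move=> e0; split=> [[_ [y y1 <-]]|xe].
  by have := tleZ polar_dual e%:C y1; rewrite mulr1 nabs_pos// ltW.
split=> //; exists ((e^-1)%:C *: x); last first.
  by rewrite scalerA -rmorphM divff ?gt_eqF// scale1r.
have := tleZ polar_dual (e^-1)%:C xe.
by rewrite nabs_pos ?invr_ge0 ?(ltW e0)// mulVf ?gt_eqF.
Qed.

Let D := [set y | tle (polar B) y 1].

Let cD : absolutely_convex D.
Proof.
move=> a b x y ab Dx Dy; apply: tle_trans (tleD polar_dual (tleZ polar_dual a Dx) (tleZ polar_dual b Dy)) _.
by move: ab; rewrite !normE -rmorphD lecR !mulr1.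
Qed.

Let bD : tvs_bounded D.
Proof.
move=> U /polar_nbhs[c c0 cU]; exists c^-1; first by rewrite invr_gt0.
move=> t; rewrite normE lecR => ct x Dx.
have t0 : 0 < nabs t by apply: lt_le_trans ct; rewrite invr_gt0.
have tn0 : t != 0 by rewrite -nabs_gt0.
exists (t^-1 *: x); last by rewrite scalerA divff// scale1r.
apply: cU; apply: tle_trans (tleZ polar_dual t^-1 Dx) _.
by rewrite mulr1 nabsV -[leRHS]invrK lef_pV2 ?posrE ?invr_gt0.
Qed.

Let closedD : closed D.
Proof.
move=> x clx u pu; apply/ler_addgt0Pr => e e0.
have [w uw] := dual_lin (polar_dual pu).
have := (polar_dual pu).2 x (fun y : R[i]^o => nabs (y - u x) < e).
have H0 : nbhs (u x : R[i]^o) (fun y : R[i]^o => nabs (y - u x) < e).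
  by apply/nbhs_nabs; exists e.
move=> /(_ H0)/clx[y [Dy yx]].
rewrite -[u x](subrK (u y)) addrC; apply: nabsD_le; first exact: Dy.
by rewrite nabsB ltW.
Qed.

(** The bipolar [D] of [B] is a closed disk, hence a Banach disk. A Cauchy
    sequence for the seminorm need not lie in the span of [D], but its
    differences do, eventually. *)
Lemma norming_locally_complete : locally_complete E -> norming (polar B).
Proof.
move=> lcE; split; [exact: polar_dual|exact: polar_nbhs|].
have bdD := lcE D (conj bD cD) closedD.
move=> x cx; have [N1 HN1] := cx 1 ltr01.
pose y n := x (n + N1)%N - x N1.
have yy m n : y m - y n = x (m + N1)%N - x (n + N1)%N.
  by rewrite /y opprB addrA subrK.
have [|e e0|l [k _ [l' Dl' ll']] Hl] := bdD y.
- move=> n; exists 1%N => //; exists (y n); last by rewrite scale1r.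
  by apply: HN1; rewrite ?leq_addl.
- have e2 : 0 < e / 2 by rewrite divr_gt0.
  have [N HN] := cx _ e2; exists N => m n Nm Nn.
  have : gauge D (y m - y n) <= e / 2.
    apply: gauge_le; apply/tle_gset => //; rewrite yy; apply: HN.
      by rewrite (leq_trans Nm)// leq_addr.
    by rewrite (leq_trans Nn)// leq_addr.
  lra.
exists (l + x N1) => e e0.
have := Hl (fun t : R => t < e).
have He : nbhs (0 : R) (fun t : R => t < e).
  apply/nbhs_ballP; exists e => //= t; rewrite /ball /= sub0r normrN.
  exact: le_lt_trans (ler_norm _).
move=> /(_ He)[N _ HN]; exists (N + N1)%N => n Nn.
have nE : n = ((n - N1) + N1)%N by lia.
have Nn' : (N <= n - N1)%N by lia.
have -> : x n - (l + x N1) = y (n - N1)%N - l by rewrite /y -nE opprD [- l - _]addrC addrA.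
apply/tle_gset => //; apply: gauge_lt (HN _ Nn') => //.
exists (1 + k%:R); apply/tle_gset; first by rewrite ltr_wpDr.
apply: (tleD polar_dual); first by apply: HN1; rewrite ?leq_addl.
apply: (tleN polar_dual); rewrite -ll'.
apply: tle_trans (tleZ polar_dual _ Dl') _.
by rewrite mulr1 (_ : (k%:R : R[i]) = k%:R%:C) ?nabs_pos// rmorph_nat.
Qed.

(** A Cauchy sequence [x] for the seminorm converges pointwise on the dual of
    [E]; let [phi] be the limit functional and [Q] its kernel. On the polars of
    neighbourhoods the convergence is uniform, so [Q] meets them in closed sets.
    If [Q] is separating, it is dense and [Br_complete] gives [phi = 0];
    otherwise all of [Q] vanishes at some point [a - b] which [G] detects, so
    [phi] is a multiple of the evaluation there. In both cases [phi] is the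
    evaluation at some [l], to which the sequence converges for the
    seminorm. *)
Lemma norming_Br_complete (G : set (E -> R[i]^o)) : dual_subspace G -> separating G ->
  Br_complete E -> norming (polar B).
Proof.
move=> sG Gsep BrE; split; [exact: polar_dual|exact: polar_nbhs|].
move=> x cx.
have exl u : exists l : R[i], dual E u -> forall e : R, 0 < e -> exists N, forall n,
    (N <= n)%N -> nabs (u (x n) - l) <= e.
  have [du|ndu] := pselect (dual E u); last by exists 0.
  have [w uw] := dual_lin du; have [K K0 HK] := dual_polar_bd du.
  have [|l Hl] := @complex_complete _ (fun n => u (x n)); last by exists l.
  move=> e e0; have eK : 0 < e / K by rewrite divr_gt0.
  have [N HN] := cx _ eK; exists N => m n Nm Nn.
  have := HK _ _ eK (HN _ _ Nm Nn); rewrite uw wB mulrCA divff ?gt_eqF//.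
  by rewrite mulr1.
have [phi Hphi] := choice exl.
have phi_uniq u l : dual E u -> (forall e : R, 0 < e -> exists N, forall n,
    (N <= n)%N -> nabs (u (x n) - l) <= e) -> phi u = l.
  move=> du Hl; apply/eqP; rewrite -subr_eq0 -nabs_eq0 eq_le nabs_ge0 andbT.
  apply/ler_addgt0Pr => e e0; have e2 : 0 < e / 2 by rewrite divr_gt0.
  have [N1 H1] := Hphi u du _ e2; have [N2 H2] := Hl _ e2.
  apply: le_trans (nabs_sub_le _ (u (x (N1 + N2)%N)) _) _.
  have := H1 _ (leq_addr N2 N1); have := H2 _ (leq_addl N1 N2).
  rewrite [nabs (phi u - _)]nabsB; lra.
have GE : G `<=` dual E by case: sG.
have phi_lin (a : R[i]) u v : dual E u -> dual E v ->
    phi (fun x => a *: u x + v x) = a * phi u + phi v.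
  move=> du dv; apply: phi_uniq; first exact: dual_comb.
  move=> e e0; have a1 : 0 < nabs a + 1 by rewrite ltr_wpDl ?nabs_ge0.
  have e1 : 0 < e / (nabs a + 1) by rewrite divr_gt0.
  have [N1 H1] := Hphi u du _ e1; have [N2 H2] := Hphi v dv _ e1.
  exists (N1 + N2)%N => n Nn.
  have -> : a *: u (x n) + v (x n) - (a * phi u + phi v) =
     a * (u (x n) - phi u) + (v (x n) - phi v) by rewrite -[a *: _]/(a * _); ring.
  have h1 : nabs (u (x n) - phi u) <= e / (nabs a + 1) by apply: H1; lia.
  have h2 : nabs (v (x n) - phi v) <= e / (nabs a + 1) by apply: H2; lia.
  have h3 : nabs (a * (u (x n) - phi u)) <= nabs a * (e / (nabs a + 1)).
    by rewrite nabsM ler_wpM2l ?nabs_ge0.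
  apply: le_trans (nabsD_le h3 h2) _.
  rewrite le_eqVlt; apply/orP; left; apply/eqP; field; by rewrite gt_eqF.
pose Q : set (E -> R[i]^o) := [set u | dual E u /\ phi u = 0].
have phi0 : phi (fun=> 0) = 0.
  have d0 : dual E (fun=> 0 : R[i]^o) by case: sG => _ G0 _; exact: GE.
  by apply: phi_uniq => // e e0; exists 0%N => n _; rewrite subrr nabs0 ltW.
have sQ : dual_subspace Q.
  split; first by move=> u [].
    by split => //; case: sG => _ G0 _; exact: GE.
  move=> a u v [du pu] [dv pv]; split; first exact: dual_comb.
  by rewrite phi_lin// pu pv mulr0 addr0.
have [l Hl] : exists l, forall u, dual E u -> phi u = u l.
  have [Qsep|nQ] := pselect (separating Q).
    have QE : Q = dual E.
      apply: BrE => //; first exact: separating_dense.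
      move=> U U0 u [du clu].
      have [c c0 cU] := polar_nbhs U0.
      have approx := ptws_closure_approx clu.
      have upol : polar U u.
        apply/polarP; split => // y Uy; apply/ler_addgt0Pr => e e0.
        have [g [_ /polarP[_ pg]] Hg] := approx [:: y] e e0.
        rewrite -[u y](subrK (g y)) addrC; apply: nabsD_le; first exact: pg.
        by rewrite nabsB ltW// Hg// mem_head.
      split=> //; split=> //; apply/eqP; rewrite -nabs_eq0 eq_le nabs_ge0 andbT.
      apply/ler_addgt0Pr => e e0; rewrite add0r.
      have e3 : 0 < e / 8 by rewrite divr_gt0.
      have ce : 0 < c * (e / 8) by rewrite mulr_gt0.
      have [N HN] := cx _ ce.
      (* by [polar_nbhs] small differences for the seminorm lie in [U] *)
      have unif g : dual E g -> polar U g -> nabs (phi g - g (x N)) <= e / 8 + e / 8.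
        move=> dg /polarP[_ pg]; have [N' HN'] := Hphi g dg _ e3.
        apply: le_trans (nabs_sub_le _ (g (x (N + N')%N)) _) _; apply: lerD.
          by rewrite nabsB; apply: HN'; rewrite leq_addl.
        have [w gw] := dual_lin dg.
        have Uy : U (((e / 8)^-1)%:C *: (x (N + N')%N - x N)).
          apply: cU; have := tleZ polar_dual ((e / 8)^-1)%:C (HN (N + N')%N N (leq_addr _ _) (leqnn _)).
          move=> /tle_trans; apply; have ri : 0 <= (e / 8)^-1 by rewrite invr_ge0 ltW.
          by rewrite nabs_pos// mulrCA mulVf ?gt_eqF// mulr1.
        have := pg _ Uy; rewrite gw wZ wB nabsM nabs_pos ?invr_ge0 ?(ltW e3)//.
        by rewrite ler_pdivrMl// mulr1.
      have [g [[dg pg0] pg] Hg] := approx [:: x N] _ e3.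
      have h1 := unif _ du upol; have h2 := unif _ dg pg.
      rewrite pg0 sub0r nabsN in h2.
      have h3 : nabs (g (x N) - u (x N)) < e / 8 by apply: Hg; rewrite mem_head.
      have := nabs_sub_le (phi u) (u (x N)) 0; rewrite !subr0.
      have := nabs_sub_le (u (x N)) (g (x N)) 0; rewrite !subr0 [nabs (u _ - _)]nabsB.
      lra.
    exists 0 => u du; have [w uw] := dual_lin du; rewrite {2}uw linear0.
    by have [] : Q u by rewrite QE.
  move: nQ => /existsNP[a /existsNP[b /not_implyP[ab nq]]].
  have Qab u : Q u -> u (a - b) = 0.
    move=> Qu; have [w uw] := dual_lin Qu.1; rewrite uw linearB; apply/eqP.
    rewrite subr_eq0; apply/eqP; rewrite -uw; apply: contrapT => uab.
    by apply: nq; exists u.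
  have [g Gg gab] := Gsep _ _ ab; have dg := GE _ Gg; have [wg gw] := dual_lin dg.
  have g0 : g (a - b) != 0 by rewrite gw linearB -gw subr_eq0; apply/eqP.
  have pg0 : phi g != 0.
    by apply: contra_neq g0 => pg; apply: Qab; split.
  exists ((phi g / g (a - b)) *: (a - b)) => u du.
  have [w uw] := dual_lin du; rewrite {2}uw wZ -uw.
  have : Q (fun y => (- (phi u / phi g)) *: g y + u y).
    by split; [exact: dual_comb|rewrite phi_lin// mulNr divfK// addNr].
  move=> /Qab; rewrite -[_ *: g _]/(_ * g _) => H.
  have -> : u (a - b) = phi u / phi g * g (a - b).
    by apply/eqP; rewrite -subr_eq0 -[X in _ == X]H addrC mulNr.
  by field; rewrite pg0 g0.
exists l => e e0; have e2 : 0 < e / 2 by rewrite divr_gt0.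
have [N HN] := cx _ e2; exists N => n Nn u pu.
have du := polar_dual pu; have [w uw] := dual_lin du.
have [N' HN'] := Hphi u du _ e2.
have := HN n (N + N')%N Nn (leq_addr _ _) u pu.
have := HN' (N + N')%N (leq_addl _ _); rewrite Hl// uw !wB => h1 h2.
have := nabs_sub_le (w (x n)) (w (x (N + N')%N)) (w l); lra.
Qed.

End PolarNorming.

(** * Extension across thin sets *)

Section Geometry.
Context {R : realType} {d : nat}.
Implicit Types (z w y v : 'rV[R[i]]_d) (Omega A : set 'rV[R[i]]_d).

Lemma polydisc_ball (r : 'I_d -> \bar R) z w : polydisc r z w ->
  exists2 t : R, 0 < t & forall y, nabs (y - w) < t -> polydisc r z y.
Proof.
move=> zw.
have ex k : exists t : R, 0 < t /\ forall a : R[i], nabs (a - w 0 k) < t ->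
    ((nabs (a - z 0 k))%:E < r k)%E.
  have := zw k; case: (r k) => [b| |]; last by rewrite ltNge leNye.
    rewrite lte_fin -[complex.Re _]/(nabs (w 0 k - z 0 k)) => wb.
    exists (b - nabs (w 0 k - z 0 k)); rewrite subr_gt0; split=> // a ab.
    by rewrite lte_fin; have := nabs_sub_le a (w 0 k) (z 0 k); lra.
  by move=> _; exists 1; split=> // a _; exact: ltry.
have [t Ht] := choice ex; exists (\big[Num.min/1]_(k < d) t k).
  by apply: lt_bigmin => // k _; have [] := Ht k.
move=> y yw k; rewrite -[complex.Re _]/(nabs (y 0 k - z 0 k)).
apply: (Ht k).2; apply: (@le_lt_trans _ _ (nabs (y - w))).
  by have := coord_le_nabs (y - w) k; rewrite !mxE.
by apply: lt_le_trans yw _; exact: bigmin_le_cond.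
Qed.

Lemma polydisc_nbhs (r : 'I_d -> \bar R) z w : polydisc r z w -> nbhs w (polydisc r z).
Proof. by move=> /polydisc_ball H; apply/nbhs_nabs. Qed.

Lemma polydisc_center (r : 'I_d -> \bar R) z : polyradius r -> polydisc r z z.
Proof. by move=> r0 k; rewrite subrr normr0; exact: r0. Qed.

Lemma polydisc_line (r : 'I_d -> \bar R) z w : polydisc r z w ->
  exists2 rho : R, 1 < rho & forall a : R[i], nabs a <= rho ->
    polydisc r z (z + a *: (w - z)).
Proof.
move=> /polydisc_ball[t t0 Ht].
have v1 : 0 < nabs (w - z) + 1 by rewrite ltr_wpDl ?nabs_ge0.
pose s := t / (nabs (w - z) + 1); have s0 : 0 < s by rewrite divr_gt0.
have rho0 : 0 <= 1 + s by rewrite addr_ge0// ltW.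
exists (1 + s); first by rewrite ltrDl.
move=> a ar; have H : polydisc r z (z + (1 + s)%:C *: (w - z)).
  apply: Ht; rewrite rmorphD scalerDl scale1r addrA [z + _]addrC subrK.
  rewrite addrAC subrr add0r nabsZ nabs_pos ?(ltW s0)//.
  have : s * (nabs (w - z) + 1) = t by rewrite divfK// gt_eqF.
  by rewrite mulrDr mulr1; lra.
move=> k; apply: le_lt_trans (H k); rewrite lee_fin.
rewrite !mxE [z 0 k + _]addrC addrK [z 0 k + _]addrC addrK.
rewrite -[leLHS]/(nabs _) -[leRHS]/(nabs _) !nabsM ler_wpM2r ?nabs_ge0//.
by rewrite (nabs_pos rho0).
Qed.

Lemma open_setD_subspace Omega A : open Omega ->
  closed (A : set (subspace Omega)) -> open (Omega `\` A).
Proof.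
move=> oO cA; have [V cV VA] := (closed_subspaceP _ _).1 cA.
have -> : Omega `\` A = Omega `&` ~` V.
  apply/seteqP; split => y [Oy nA]; split => // Vy; apply: nA.
    by have [] : (A `&` Omega) y by rewrite -VA.
  by have [] : (V `&` Omega) y by rewrite VA.
by apply: openI => //; exact: closed_openC.
Qed.

Lemma open_ball_sub (S : set 'rV[R[i]]_d) z : open S -> S z ->
  exists2 t : R, 0 < t & forall y, nabs (y - z) < t -> S y.
Proof. by move=> oS Sz; apply/nbhs_nabs; exact: open_nbhs_nbhs. Qed.

Lemma good_direction_trivial z (D : R) : 0 < D ->
  good_direction z D (fun=> 1) 0 (D / 4).
Proof.
move=> D0; split.
- by rewrite divr_gt0.
- by rewrite nabs0; lra.
- by move=> y _; exact: ldiff_cst.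
- by move=> t _ y _; exact: oner_neq0.
Qed.

Lemma taxi_neq1_near (x : R[i]) : taxi x != 1 ->
  exists2 t : R, 0 < t & forall y : R[i], nabs (y - x) < t -> taxi y != 1.
Proof.
move=> x1; exists (`|taxi x - 1| / 2); first by rewrite divr_gt0// normr_gt0 subr_eq0.
move=> y yx; apply/eqP => y1.
have : `|taxi x - taxi y| <= taxi (y - x).
  rewrite /taxi !raddfB/= [`|complex.Re y - _|]distrC [`|complex.Im y - _|]distrC.
  rewrite opprD addrACA; apply: le_trans (ler_normD _ _) (lerD _ _); exact: ler_dist_dist.
rewrite y1; have := taxi_le_nabs (y - x); lra.
Qed.

(** At a point of [A] let [g] be the function that defines [A] locally, and move
    from [z0] towards a point where [g] does not vanish. The zeros of [g] on
    this complex line are isolated, so small closed curves around [z0] avoid them,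
    and so do neighbourhoods of these curves by compactness. *)
Lemma thin_good_direction Omega A z0 (D0 : R) : open Omega -> thin Omega A ->
  closed (A : set (subspace Omega)) -> Omega z0 -> 0 < D0 ->
  exists D g w e, [/\ D <= D0, good_direction z0 D g w e &
    forall y, nabs (y - z0) < D -> g y != 0 -> (Omega `\` A) y].
Proof.
move=> oO [_ thinA] cA Oz0 D00.
have [Az0|nAz0] := pselect (A z0); last first.
  have [t t0 Ht] := open_ball_sub (open_setD_subspace oO cA) (conj Oz0 nAz0).
  exists (Num.min D0 t), (fun=> 1), 0, (Num.min D0 t / 4); split.
  - by rewrite ge_min lexx.
  - by apply: good_direction_trivial; rewrite lt_min D00.
  - by move=> y; rewrite lt_min => /andP[_ yt] _; exact: Ht.
have [r [r0 rO [g [hg [w0 rw0 gw0] gA]]]] := thinA _ Az0.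
have [rho rho1 Hrho] := polydisc_line rw0.
pose v := w0 - z0.
have [||e1 e10 He1] := @isolated_zeros _ (fun a => g (z0 + a *: v)) _ rho1.
- move=> a /Hrho H; apply: ldiff_line; apply: holomorphic_ldiff hg _ _.
  exact: polydisc_nbhs.
- by rewrite scale1r addrC subrK.
have [t t0 Ht] := polydisc_ball (polydisc_center z0 r0).
pose D := Num.min D0 t; have Dpos : 0 < D by rewrite lt_min D00.
have inP y : nabs (y - z0) < D -> polydisc r z0 y.
  by rewrite lt_min => /andP[_]; exact: Ht.
have v1 : 0 < nabs v + 1 by rewrite ltr_wpDl ?nabs_ge0.
pose q := Num.min (e1 / 2) (D / (4 * (nabs v + 1))).
have q0 : 0 < q by rewrite lt_min !divr_gt0// mulr_gt0.
have qe : q < e1 by apply: (@le_lt_trans _ _ (e1 / 2)); [rewrite /q ge_min lexx|lra].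
have qD : q * (4 * (nabs v + 1)) <= D.
  by rewrite -ler_pdivlMr ?mulr_gt0// /q ge_min lexx orbT.
pose w := q%:C *: v.
have wE : nabs w = q * nabs v by rewrite nabsZ nabs_pos// ltW.
have w4 : 4 * nabs w <= D by rewrite wE; lra.
have gw t1 : taxi t1 = 1 -> g (z0 + t1 *: w) != 0.
  move=> t11; rewrite scalerA; apply: He1.
    rewrite mulf_neq0//; last by rewrite -nabs_gt0 nabs_pos// ltW.
    by apply: contra_eq_neq t11 => ->; rewrite /taxi/= normr0 addr0 eq_sym oner_neq0.
  rewrite nabsM [X in _ * X]nabs_pos ?(ltW q0)//; apply: le_lt_trans qe.
  by rewrite ler_piMl ?(ltW q0)// -t11 nabs_le_taxi.
pose P (x : R[i]) (b : R) := taxi x = 1 -> forall y,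
  nabs (y - (z0 + x *: w)) <= 2 * b -> g y != 0.
have [|x x1|b b0 Hb] := @disc_uniform _ 1 P.
- move=> x b b' _ bb' H x1 y yx; apply: (H x1); lra.
- have [tx|/taxi_neq1_near[t1 t10 Ht1]] := eqVneq (taxi x) 1; last first.
    by exists t1 => // y _ yx y1; have := Ht1 _ yx; rewrite y1 eqxx.
  pose p := z0 + x *: w.
  have pP : polydisc r z0 p.
    apply: inP; rewrite /p addrC addKr nabsZ.
    have := ler_wpM2r (nabs_ge0 w) x1; have := Dpos; have := w4; lra.
  have gp : 0 < nabs (g p : R[i]) by rewrite nabs_gt0; exact: gw.
  have [t1 t10 Ht1] := holomorphic_cont hg (polydisc_nbhs pP) gp.
  have w3 : 0 < nabs w + 2 + 1 by rewrite ltr_wpDl// addr_ge0 ?nabs_ge0.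
  pose t2 := t1 / (nabs w + 2 + 1); have t20 : 0 < t2 by rewrite divr_gt0.
  exists t2 => // y _ yx y1 u uy.
  have up : nabs (u - p) < t1.
    apply: le_lt_trans (nabs_sub_le _ (z0 + y *: w) _) _.
    rewrite (_ : z0 + y *: w - p = (y - x) *: w); last first.
      by rewrite /p opprD addrACA subrr add0r scalerBl.
    rewrite nabsZ; have := ler_wpM2r (nabs_ge0 w) (ltW yx).
    have : t2 * (nabs w + 2 + 1) = t1 by rewrite divfK// gt_eqF.
    lra.
  by have := Ht1 _ up; apply: contraTneq => ->; rewrite sub0r nabsN ltxx.
exists D, g, w, (Num.min b (D / 8)); split.
- by rewrite /D ge_min lexx.
- split.
  + by rewrite lt_min b0 divr_gt0.
  + have : Num.min b (D / 8) <= D / 8 by rewrite ge_min lexx orbT.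
    lra.
  + move=> y /inP yP; apply: holomorphic_ldiff hg _ _; exact: polydisc_nbhs.
  + move=> t1 t11 y yt; apply: (Hb t1 _ t11); first by rewrite -t11 nabs_le_taxi.
    apply: le_trans yt _; have : Num.min b (D / 8) <= b by rewrite ge_min lexx.
    lra.
- move=> y /inP yP gy; split; first exact: rO.
  by move=> Ay; move: gy; rewrite gA ?eqxx.
Qed.

End Geometry.

Section Limits.
Context {R : realType} {V : normedModType R[i]}.
Implicit Types (z v y : V) (h : V -> R[i]).

(** A test involves finitely many values of [h], and the constant depends only on
    the bound [M]; approximation at finitely many points by functions with this
    common bound is therefore enough. *)
Lemma good_direction_limit z0 (D : R) g w (e : R) h (M : R) :
  good_direction z0 D g w e -> 0 <= M ->
  (forall (xs : seq V) (n : R), 0 < n -> exists k : V -> R[i],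
    (forall y, nabs (y - z0) < D -> g y != 0 -> ldiff k y /\ nabs (k y) <= M) /\
    forall x, x \in xs -> nabs (x - z0) < D -> g x != 0 -> nabs (k x - h x) <= n) ->
  reg [set idfun] (h : V -> R[i]^o)
    [set y | nabs (y - z0) < e / 128 /\ g y != 0]
    (M * (64 / e) ^+ 2 + M * (64 / e)).
Proof.
move=> good M0 H s k z tk Hs _ -> /=; apply/ler_addgt0Pr => n n0.
set A := \sum_(p <- s) nabs p.1.
have A0 : 0 <= A by apply: sumr_ge0 => p _; exact: nabs_ge0.
have A1 : 0 < A + 1 by rewrite ltr_wpDl.
have [f [fM fh]] := H [seq z + p.2 | p <- s] _ (divr_gt0 n0 A1).
have := good_direction_reg good M0 fM tk Hs erefl => /=.
set C := _ * k => fC.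
rewrite -[comb _ s z](subrK (comb (f : V -> R[i]^o) s z)) addrC.
apply: nabsD_le => //; rewrite nabsB.
apply: le_trans (comb_dist (e := n / (A + 1)) _) _.
  move=> p ps; have [p1 p2] := Hs p ps; apply: fh => //; first exact: map_f.
  case: good => e0 De _ _; have := nabs_ge0 w; lra.
by rewrite -/A mulrCA ler_piMr ?(ltW n0)// ler_pdivrMr// mul1r lerDl.
Qed.

(** Regular functions are continuous, even if they are regular for different
    families [T1] and [T2], and limits in [E] are unique. *)
Lemma reg_agree (E : tvsType R[i]) (T1 T2 : set (E -> R[i]^o)) (F1 F2 : V -> E)
    z z1 z2 (r1 r2 C1 C2 : R) :
  hausdorff_space E -> norming T1 -> norming T2 -> 0 <= C1 -> 0 <= C2 ->
  reg T1 F1 [set y | nabs (y - z1) < r1] C1 ->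
  reg T2 F2 [set y | nabs (y - z2) < r2] C2 ->
  nabs (z - z1) < r1 -> nabs (z - z2) < r2 ->
  (forall e : R, 0 < e -> exists y,
    [/\ nabs (y - z) < e, nabs (y - z1) < r1, nabs (y - z2) < r2 & F1 y = F2 y]) ->
  F1 z = F2 z.
Proof.
move=> hE n1 n2 C10 C20 H1 H2 zr1 zr2 H.
have ex n : exists y, [/\ nabs (y - z) < 1 / 2 ^+ n, nabs (y - z1) < r1,
   nabs (y - z2) < r2 & F1 y = F2 y].
  by apply: H; rewrite divr_gt0// exprn_gt0.
have [y Hy] := choice ex.
have cvg T (F : V -> E) z' (r C : R) : norming T -> 0 <= C ->
    reg T F [set y | nabs (y - z') < r] C ->
    nabs (z - z') < r -> (forall n, nabs (y n - z') < r) ->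
    (F \o y) @ \oo --> F z.
  move=> nT C0 HF zr yr; apply: (norming_cvg nT) => e e0.
  have [N HN] := pow2_small C0 e0; exists N => n Nn.
  apply: tle_trans (reg_lip HF zr (yr n)) _; apply: le_trans (ltW HN).
  apply: ler_wpM2l => //; have [/ltW yn _ _ _] := Hy n; apply: le_trans yn _.
  rewrite mul1r lef_pV2 ?posrE ?exprn_gt0// ler_weXn2l ?ler1n//.
have c1 := cvg _ _ _ _ _ n1 C10 H1 zr1 (fun n => let: And4 _ a _ _ := Hy n in a).
have c2 := cvg _ _ _ _ _ n2 C20 H2 zr2 (fun n => let: And4 _ _ a _ := Hy n in a).
have E12 : F1 \o y = F2 \o y by apply/funext => n /=; have [] := Hy n.
rewrite -E12 in c2; exact: (@cvg_unique E hE ((F1 \o y) @ \oo) _ _ _ c1 c2).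
Qed.

End Limits.

Section Assembly.
Context {R : realType} {d : nat} {E : tvsType R[i]}.
Implicit Types (z w y : 'rV[R[i]]_d) (u g : E -> R[i]^o).

Lemma limit_holomorphic_fun (O : set 'rV[R[i]]_d) (h : 'rV[R[i]]_d -> R[i]^o) :
  open O ->
  (forall z, O z -> exists D M : R, [/\ 0 < D, 0 <= M &
    forall (xs : seq 'rV[R[i]]_d) (n : R), 0 < n -> exists k : 'rV[R[i]]_d -> R[i]^o,
    (forall y, nabs (y - z) < D -> ldiff k y /\ nabs (k y) <= M) /\
    forall x, x \in xs -> nabs (x - z) < D -> nabs (k x - h x) <= n]) ->
  holomorphic_fun O h.
Proof.
move=> oO H; apply: reg_holomorphic_fun => // z /H[D [M [D0 M0 Hk]]].
have D4 : 0 < D / 4 by rewrite divr_gt0.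
exists (D / 4 / 128), (M * (64 / (D / 4)) ^+ 2 + M * (64 / (D / 4))); split.
- by rewrite divr_gt0.
- by rewrite addr_ge0// mulr_ge0// ?sqr_ge0// divr_ge0// ltW.
move=> s k x tk Hs.
apply: (good_direction_limit (good_direction_trivial z D0) M0 _ tk).
  move=> xs n n0; have [g [H1 H2]] := Hk xs n n0; exists g; split.
    by move=> y yD _; exact: H1.
  by move=> y ys yD _; exact: H2.
by move=> p ps; split; [exact: Hs|exact: oner_neq0].
Qed.

Lemma bounded_functionals (B U : set E) : tvs_bounded B -> nbhs 0 U ->
  exists2 M : R, 0 < M & forall u, dual E u -> (forall x, U x -> nabs (u x) <= 1) ->
    forall x, B x -> nabs (u x) <= M.
Proof.
move=> bB /bB[M M0 HM]; exists M => // u du uU x Bx.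
have [|y Uy <-] := HM M%:C _ x Bx; first by rewrite normE nabs_pos// ltW.
have [v vE] := dual_lin du; rewrite vE wZ nabsM nabs_pos ?(ltW M0)//.
by rewrite ler_piMr ?(ltW M0)// -vE; exact: uU.
Qed.

Lemma dual_bounded (B : set E) u : tvs_bounded B -> dual E u ->
  exists2 M : R, 0 < M & forall x, B x -> nabs (u x) <= M.
Proof.
move=> bB du.
have N0 : nbhs (0 : E) [set x | nabs (u x) <= 1].
  have := du.2 0 (fun y : R[i]^o => nabs y <= 1); apply.
  have [w uw] := dual_lin du.
  apply/nbhs_nabs; exists 1 => // y.
  by rewrite uw linear0 subr0 => /ltW.
have [M M0 HM] := bounded_functionals bB N0; exists M => // x Bx.
by apply: HM.
Qed.

Variables (Omega A : set 'rV[R[i]]_d) (f : 'rV[R[i]]_d -> E).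
Hypothesis hE : hausdorff_space E.
Hypothesis oOmega : open Omega.
Hypothesis thinA : thin Omega A.
Hypothesis closedA : closed (A : set (subspace Omega)).
Hypothesis bf : forall z, Omega z -> exists r : 'I_d -> \bar R,
      [/\ polyradius r, polydisc r z `<=` Omega &
          tvs_bounded (f @` (polydisc r z `\` A))].

Let O := Omega `\` A.
Let oO : open O. Proof. exact: open_setD_subspace. Qed.

Let f_bounded z : Omega z -> exists2 D : R, 0 < D &
  exists2 B : set E, tvs_bounded B &
    forall y, nabs (y - z) < D -> Omega y /\ (~ A y -> B (f y)).
Proof.
move=> /bf[r [r0 rO bB]]; have [D D0 HD] := polydisc_ball (polydisc_center z r0).
exists D => //; exists (f @` (polydisc r z `\` A)) => // y /HD yP.
by split=> [|nA]; [exact: rO|exists y].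
Qed.

Let O_bounded z : O z -> exists2 D : R, 0 < D &
  exists2 B : set E, tvs_bounded B & forall y, nabs (y - z) < D -> O y /\ B (f y).
Proof.
move=> Oz; have [D D0 [B bB HB]] := f_bounded Oz.1.
have [t t0 Ht] := open_ball_sub oO Oz.
exists (Num.min D t); first by rewrite lt_min D0.
exists B => // y; rewrite lt_min => /andP[/HB[_ yB] /Ht Oy].
by split => //; apply: yB; case: Oy.
Qed.

Let O_ldiff u y : holomorphic_fun O (u \o f) -> O y -> ldiff (u \o f) y.
Proof.
by move=> hu Oy; apply: holomorphic_ldiff hu _ _; exact: open_nbhs_nbhs.
Qed.

Lemma holomorphic_comb (a : R[i]) u v : dual E u -> dual E v ->
  holomorphic_fun O (u \o f) -> holomorphic_fun O (v \o f) ->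
  holomorphic_fun O ((fun x => a *: u x + v x) \o f).
Proof.
move=> du dv hu hv; apply: limit_holomorphic_fun => // z Oz.
have [D D0 [B bB HB]] := O_bounded Oz.
have dw := dual_comb a du dv; have [M M0 HM] := dual_bounded bB dw.
exists D, M; split => //; first exact: ltW.
move=> xs n n0; exists ((fun x => a *: u x + v x) \o f); split.
  move=> y /HB[Oy By]; split; last exact: HM.
  have l1 := @ldiffM _ _ (fun=> a) (u \o f) y (@ldiff_cst _ _ a y) (O_ldiff hu Oy).
  have l2 := @ldiffD _ _ (fun y => a * u (f y)) (v \o f) y l1 (O_ldiff hv Oy).
  exact: l2.
by move=> x _ _; rewrite subrr nabs0 ltW.
Qed.

(** The functionals whose composition with [f] is holomorphic form a subspace of
    the dual that contains [G]. Its intersection with the polar of a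
    neighbourhood is closed: the members of the polar are uniformly bounded on
    the bounded images of [f], and [limit_holomorphic_fun] applies to their
    pointwise limits. So this subspace is the whole dual. *)
Lemma Br_complete_holomorphic (G : set (E -> R[i]^o)) u : dual_subspace G ->
  separating G -> Br_complete E -> (forall g, G g -> holomorphic_fun O (g \o f)) ->
  dual E u -> holomorphic_fun O (u \o f).
Proof.
move=> [GE G0 Glin] Gsep BrE hG du.
pose Q : set (E -> R[i]^o) := [set u | dual E u /\ holomorphic_fun O (u \o f)].
have GQ : G `<=` Q by move=> g Gg; split; [exact: GE|exact: hG].
have sQ : dual_subspace Q.
  split; [by move=> v []|exact: GQ|].
  move=> a v w [dv hv] [dw hw]; split; first exact: dual_comb.
  exact: (holomorphic_comb a dv dw hv hw).
have Qsep : separating Q by move=> x y /Gsep[g /GQ Qg gxy]; exists g.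
have QE : Q = dual E.
  apply: (BrE _ sQ (separating_dense sQ Qsep)).
  move=> U U0 v [dv clv]; have approx := ptws_closure_approx clv.
  split; last first.
    apply/polarP; split => // y Uy; apply/ler_addgt0Pr => e e0.
    have [g [_ /polarP[_ pg]] Hg] := approx [:: y] e e0.
    rewrite -[v y](subrK (g y)) addrC; apply: nabsD_le; first exact: pg.
    by rewrite nabsB ltW// Hg// mem_head.
  split=> //; apply: limit_holomorphic_fun => // z Oz.
  have [D D0 [B bB HB]] := O_bounded Oz.
  have [M M0 HM] := bounded_functionals bB U0.
  exists D, M; split => //; first exact: ltW.
  move=> xs n n0; have [g [[dg hg] /polarP[_ pg]] Hg] := approx [seq f x | x <- xs] n n0.
  exists (g \o f); split.
    by move=> y /HB[Oy By]; split; [exact: O_ldiff|exact: HM].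
  by move=> x xs1 _; apply/ltW/Hg; exact: map_f.
by have [] : Q u by rewrite QE.
Qed.

(** The two assumptions that the completeness of [E] and the size of [G] provide:
    functionals are approximated on bounded sets by functionals that compose
    with [f] to holomorphic functions, and polars of bounded sets are norming. *)
Hypothesis approx : forall u (B : set E), dual E u -> tvs_bounded B ->
  forall n : R, 0 < n -> exists g, holomorphic_fun O (g \o f) /\
    forall x, B x -> nabs (g x - u x) <= n.
Hypothesis normB : forall B : set E, tvs_bounded B -> norming (polar B).

(** For [u] in the polar of a bounded set that contains the values of [f], the
    modulus of [u (f y)] is at most 1; its approximations stay below 2. *)
Let reg_f z0 (D : R) (g : 'rV[R[i]]_d -> R[i]) w (e : R) (B : set E) : tvs_bounded B ->
  good_direction z0 D g w e ->
  (forall y, nabs (y - z0) < D -> g y != 0 -> O y /\ B (f y)) ->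
  reg (polar B) f [set y | nabs (y - z0) < e / 128 /\ g y != 0]
    (2 * (64 / e) ^+ 2 + 2 * (64 / e)).
Proof.
move=> bB good HB s k z tk Hs u /polarP[du uB].
have [v uv] := dual_lin du; rewrite uv comb_linear -uv.
have := @good_direction_limit _ _ z0 D g w e (u \o f) 2 good (ler0n _ 2) _.
move=> H; apply: (H _ s k z tk Hs idfun erefl) => xs n n0.
have m0 : 0 < Num.min n 1 by rewrite lt_min n0 ltr01.
have [h [hh Hh]] := approx du bB m0; exists (h \o f); split.
  move=> y yD gy; have [Oy By] := HB y yD gy; split; first exact: O_ldiff.
  have := Hh _ By; rewrite le_min => /andP[_ h1].
  rewrite /= -[h (f y)](subrK (u (f y))).
  by rewrite -[2]/(1 + 1); apply: nabsD_le => //; exact: uB.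
move=> x _ xD gx; have [_ /Hh] := HB x xD gx.
by rewrite le_min => /andP[].
Qed.

Let O_dense z (e : R) : Omega z -> 0 < e -> exists2 y, nabs (y - z) < e & O y.
Proof.
move=> Oz e0; have [D [g [w [b [De good gO]]]]] := thin_good_direction oOmega thinA closedA Oz e0.
have [b0 wb _ _] := good; have := nabs_ge0 w => w0.
have [|y yz /(_ 0)] := @good_direction_dense _ _ z D g w b good b (lexx b) z [:: 0] b b0.
  by move=> v; rewrite inE => /eqP ->; rewrite /= addr0 subrr nabs0.
rewrite addr0 mem_head => /(_ isT)[/= yb gy].
by exists y; [lra|apply: gO => //; lra].
Qed.

(** Off the zeros of [g] the function [f] is regular near [z], so it extends. The
    extension also agrees with [f] at those zeros of [g] that are not in [A],
    because [f] is regular around such points too. *)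
Let local_extension z : Omega z -> exists F : 'rV[R[i]]_d -> E,
  exists T, exists r C : R, [/\ norming T, 0 < r, 0 <= C,
    reg T F [set y | nabs (y - z) < r] C &
    forall y, nabs (y - z) < r -> Omega y /\ (~ A y -> F y = f y)].
Proof.
move=> Oz; have [D0 D00 [B bB HB]] := f_bounded Oz.
have [D [g [w [e [DD good gO]]]]] := thin_good_direction oOmega thinA closedA Oz D00.
have [e0 we _ _] := good; have w0 := nabs_ge0 w.
have nT := normB bB.
have inOB y : nabs (y - z) < D -> g y != 0 -> O y /\ B (f y).
  move=> yD gy; have Oy := gO y yD gy; split => //.
  by apply: (HB y _).2; [lra|case: Oy].
have rS := reg_f bB good inOB.
pose C e : R := 2 * (64 / e) ^+ 2 + 2 * (64 / e).
have C0 b : 0 < b -> 0 <= C b.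
  by move=> b0; rewrite addr_ge0// mulr_ge0// ?sqr_ge0// divr_ge0// ltW.
have e128 : e / 128 <= e by lra.
have dS := good_direction_dense good e128.
have [|F [rF Ff]] := reg_extend hE nT (C0 _ e0) _ dS rS; first by move=> y [].
exists F, (polar B), (e / 128), (C e); split => //; first by rewrite divr_gt0.
- exact: C0.
move=> y yz; have yD : nabs (y - z) < D by lra.
have Omy : Omega y by apply: (HB y _).1; lra.
split=> // nAy; have Oy : O y by [].
have [t t0 Ht] := open_ball_sub oO Oy.
pose t' := Num.min t (D - nabs (y - z)).
have t'0 : 0 < t' by rewrite lt_min t0 subr_gt0.
have t4 : 0 < t' / 4 by rewrite divr_gt0.
have rf := reg_f bB (good_direction_trivial y t'0).
have {}rf : reg (polar B) f [set x | nabs (x - y) < t' / 4 / 128] (C (t' / 4)).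
  move=> s k x tk Hs; apply: rf => //.
    move=> p; rewrite lt_min => /andP[pt pD] _; split; first exact: Ht.
    apply: (HB p _).2; last by case: (Ht _ pt).
    have := nabs_sub_le p y z; lra.
  by move=> p ps; split; [exact: Hs|exact: oner_neq0].
apply: (reg_agree hE nT nT (C0 _ e0) (C0 _ t4) rF rf yz).
  by rewrite subrr nabs0 divr_gt0.
move=> b b0; pose b' := Num.min b (t' / 4 / 128).
have b'0 : 0 < b' by rewrite lt_min b0 divr_gt0.
have [|x xy /(_ 0)] := dS y [:: 0] b' b'0.
  by move=> v; rewrite inE => /eqP ->; rewrite /= addr0.
rewrite addr0 mem_head => /(_ isT) Sx; exists x; case: (Sx) => xz _.
move: xy; rewrite lt_min => /andP[xb xt].
by split => //; exact: Ff.
Qed.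

(** The local extensions agree with [f] on a dense set, hence with each other
    wherever they meet; so [F z] can be read off from the extension chosen
    at [z]. *)
Lemma extension (Ehat : tvsType R[i]) (j : {linear E -> Ehat}) :
  (forall U : set Ehat, nbhs 0 U -> nbhs 0 (j @^-1` U)) ->
  exists F : 'rV[R[i]]_d -> E,
    holomorphic j Omega F /\ forall z, O z -> F z = f z.
Proof.
move=> jc.
have ex z : exists F : 'rV[R[i]]_d -> E, Omega z ->
  exists T, exists r C : R, [/\ norming T, 0 < r, 0 <= C,
    reg T F [set y | nabs (y - z) < r] C &
    forall y, nabs (y - z) < r -> Omega y /\ (~ A y -> F y = f y)].
  have [Oz|nOz] := pselect (Omega z); last by exists f.
  by have [F HF] := local_extension Oz; exists F.
have [H HH] := choice ex; exists (fun z => H z z); split; last first.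
  move=> z [Oz nA]; have [T [r [C [_ r0 _ _ Hf]]]] := HH z Oz.
  by apply: (Hf z _).2 => //; rewrite subrr nabs0.
apply: reg_holomorphic => // z Oz.
have [T [r [C [nT r0 C0 rF Hf]]]] := HH z Oz; exists T, r, C; split => //.
have glue y : nabs (y - z) < r -> H y y = H z y.
  move=> yz; have Oy := (Hf y yz).1.
  have [T' [r' [C' [nT' r'0 C'0 rF' Hf']]]] := HH y Oy.
  have yy : nabs (y - y) < r' by rewrite subrr nabs0.
  apply: (reg_agree hE nT' nT C'0 C0 rF' rF yy yz) => e e0.
  have m0 : 0 < Num.min e (Num.min r' (r - nabs (y - z))).
    by rewrite !lt_min e0 r'0 subr_gt0.
  have [x + Ox] := O_dense Oy m0; rewrite !lt_min => /and3P[xe xr' xr].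
  have xz : nabs (x - z) < r by have := nabs_sub_le x y z; lra.
  have nAx := Ox.2.
  by exists x; split => //; rewrite (Hf' x xr').2// (Hf x xz).2.
move=> s k x tk Hs; rewrite (_ : comb _ s x = comb (H z) s x); first exact: rF.
by rewrite /comb; apply: eq_big_seq => p ps; rewrite glue//; exact: Hs.
Qed.

End Assembly.

Theorem theorem7p4 (R : realType)
    (E : tvsType R[i]) (hE : hausdorff_space E) (E_neq0 : exists x : E, x != 0)
    (Ehat : tvsType R[i]) (j : {linear E -> Ehat}) (hj : is_completion j)
    (G : set (E -> R[i]^o)) (hG : dual_subspace G)
    (d : nat) (d_gt0 : (0 < d)%N)
    (Omega : set 'rV[R[i]]_d) (oOmega : open Omega) (cOmega : connected Omega)
    (A : set 'rV[R[i]]_d) (thinA : thin Omega A)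
    (closedA : closed (A : set (subspace Omega)))
    (f : 'rV[R[i]]_d -> E)
    (hf : forall u, G u -> holomorphic_fun (Omega `\` A) (u \o f))
    (bf : forall z, Omega z -> exists r : 'I_d -> \bar R,
      [/\ polyradius r, polydisc r z `<=` Omega &
          tvs_bounded (f @` (polydisc r z `\` A))])
    (hEG : (separating G /\ Br_complete E) \/
           (strongly_dense G /\ locally_complete E)) :
  exists F : 'rV[R[i]]_d -> E,
    holomorphic j Omega F /\ forall z, (Omega `\` A) z -> F z = f z.
Proof.
have [_ _ jtop _] := hj.
have jc (U : set Ehat) : nbhs 0 U -> nbhs 0 (j @^-1` U).
  by move=> U0; apply/jtop; exists U => //; rewrite linear0.
apply: (extension hE oOmega thinA closedA bf _ _ jc) => [u B du bB n n0|B bB].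
  case: hEG => [[Gsep BrE]|[Gdense _]].
    exists u; split; last by move=> x _; rewrite subrr nabs0 ltW.
    exact: (Br_complete_holomorphic oOmega closedA bf hG Gsep BrE hf du).
  have [g Gg Hg] := strongly_dense_approx Gdense bB du n0.
  by exists g; split=> [|x /Hg/ltW//]; exact: hf.
case: hEG => [[Gsep BrE]|[_ lcE]]; first exact: (norming_Br_complete bB hG Gsep).
exact: norming_locally_complete.
Qed.
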